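(* Let $\mathcal{K} \subseteq \operatorname{BM}$ be a nonempty, closed and hereditary class satisfying (JEP). Let $\mathcal{I} \in \{\mathcal{P}, \mathcal{P}_\infty, \mathcal{B}\}$ if $\mathcal{K}$ is infinite-dimensional, or $\mathcal{I} = \mathcal{P}$ otherwise. The following conditions are equivalent: (1) $\mathcal{K}$ is a guarded Fraïssé class; (2) there exists $\mu \in \sigma\mathcal{K}\cap \mathcal{I}$ such that $\langle\mu\rangle^{\mathcal I}_{\equiv}:=\{\nu\in\mathcal I : X_\nu \text{ is linearly isometric to } X_\mu\}$ is comeager in $\sigma\mathcal{K} \cap \mathcal{I}$. Moreover, if these conditions are satisfied, then the pseudonorm $\mu$ from condition (2) can be chosen in such a way that $X_\mu = \operatorname{Flim}(\mathcal{K})$ (up to isometry).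
   Context: All Banach spaces are real. For $C \geq 0$, $\operatorname{Emb}_C(Y,Z)$ is the set of bounded linear operators $T\colon Y\to Z$ with $e^{-C}\|y\| \le \|Ty\| \le e^{C}\|y\|$ for all $y$; $\operatorname{Emb}(Y,Z)=\operatorname{Emb}_0(Y,Z)$. $\operatorname{Iso}(X)$ is the group of surjective linear isometries of $X$. $\operatorname{BM}$ is the set of isometry classes of finite-dimensional real normed spaces, topologized as the disjoint union over $n$ of the sets $\operatorname{BM}_n$ of isometry classes of $n$-dimensional spaces, each with the metric $d_{\operatorname{BM}}(E,F)=\inf\{\log(\|T\|\|T^{-1}\|) : T\colon E\to F \text{ isomorphism}\}$. $\operatorname{Age}(X)\subseteq\operatorname{BM}$ is the set of finite-dimensional spaces isometric to a subspace of $X$; $\operatorname{Age}_{cl}(X)$ is its closure in $\operatorname{BM}$. Codings. $V$ is the $\mathbb{Q}$-vector space of finitely supported rational sequences, and $c_{00}$ the real vector space of finitely supported real sequences. $\mathcal{P}$ is the (Polish) space of all pseudonorms on $V$ with the topology of pointwise convergence; each $\mu\in\mathcal P$ is identified with its extension to a pseudonorm on $c_{00}$. $X_\mu$ is the completion of the quotient of $(c_{00},\mu)$ by $\{x : \mu(x)=0\}$. $\mathcal{P}_\infty$ is the set of $\mu\in\mathcal{P}$ with $X_\mu$ infinite-dimensional, and $\mathcal{B}$ the set of $\mu\in\mathcal{P}_\infty$ whose extension to $c_{00}$ is a norm; both carry the subspace topology. For $\mathcal K\subseteq\operatorname{BM}$, $\sigma\mathcal K:=\{\mu\in\mathcal P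 : \operatorname{Age}(X_\mu)\subseteq\mathcal K\}$. Classes. $\mathcal K\subseteq\operatorname{BM}$ is infinite-dimensional if $\mathcal K\cap\operatorname{BM}_n\neq\varnothing$ for every $n\in\mathbb N$. (HP)/hereditary: if $F\in\mathcal K$ and $E\in\operatorname{BM}$ embeds isometrically into $F$, then $E\in\mathcal K$. (JEP): for all $F,G\in\mathcal K$ there is $H\in\mathcal K$ into which both $F$ and $G$ embed isometrically. (GAP): for every $E\in\mathcal K$ and $\varepsilon>0$ there exist $F\in\mathcal K$, $\phi\in\operatorname{Emb}_\varepsilon(E,F)$ and $\delta>0$ such that for all $G,H\in\mathcal K$, $\psi_G\in\operatorname{Emb}_\delta(F,G)$, $\psi_H\in\operatorname{Emb}_\delta(F,H)$ there exist $K\in\mathcal K$, $\iota_G\in\operatorname{Emb}(G,K)$, $\iota_H\in\operatorname{Emb}(H,K)$ with $\|\iota_G\circ\psi_G\circ\phi-\iota_H\circ\psi_H\circ\phi\|<\varepsilon$. $\mathcal K$ is a guarded Fraïssé class if it is nonempty, closed in $\operatorname{BM}$, hereditary, and satisfies (JEP) and (GAP). A separable Banach space $X$ is guarded Fraïssé if for every finite-dimensional subspace $E\subseteq X$ and every $\varepsilon>0$ there exist $\delta>0$ and a finite-dimensional subspace $F\subseteq X$ with $E\subseteq F$ such that for all $\iota,\iota'\in\operatorname{Emb}_\delta(F,X)$ there is $T\in\operatorname{Iso}(X)$ with $\|\iota'|_E-T\circ\iota|_E\|<\varepsilon$. For a guarded Fraïssé class $\mathcal K$, $\operatorname{Flim}(\mathcal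 K)$ is the guarded Fraïssé Banach space $X$ with $\operatorname{Age}_{cl}(X)=\mathcal K$; it exists and is unique up to isometry. *)

(* Defs.v *)
From HB Require Import structures.
From mathcomp Require Import all_boot all_order all_algebra.
From mathcomp Require Import all_classical all_reals all_analysis.
From mathcomp Require Import ring lra.
Import Order.TTheory GRing.Theory Num.Theory.
Import numFieldNormedType.Exports.

Set Implicit Arguments.
Unset Strict Implicit.
Unset Printing Implicit Defensive.

Local Open Scope classical_set_scope.
Local Open Scope ring_scope.
Local Open Scope quotient_scope.

Section operators.
Context {R : realType}.
Implicit Types Y Z : normedModType R.

Definition opnorm Y Z (f : Y -> Z) : R :=
  sup [set `|f y| | y in [set y : Y | `|y| <= 1]].

(* Boundedness of T follows from the upper estimate. *)
Definition Emb (C : R) Y Z : set {linear Y -> Z} :=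
  [set T | forall y, expR (- C) * `|y| <= `|T y| /\ `|T y| <= expR C * `|y|].

Definition Iso Y : set {linear Y -> Y} :=
  [set T | (forall y, `|T y| = `|y|) /\ (forall z, exists y, T y = z)].

Definition isometric Y Z : Prop :=
  exists T : {linear Y -> Z},
    (forall y, `|T y| = `|y|) /\ (forall z, exists y, T y = z).

(* S is the inverse of T. For zero spaces both operator norms vanish and
   ln 0 = 0, so the distance between zero spaces is 0, as it should be. *)
Definition dBM Y Z : R :=
  inf [set r | exists (T : {linear Y -> Z}) (S : {linear Z -> Y}),
    [/\ cancel T S, cancel S T & r = ln (opnorm T * opnorm S)]].

Definition bounded_op Y Z (f : Y -> Z) := exists M, forall y, `|f y| <= M * `|y|.

Lemma opnorm_set_nonempty Y Z (f : Y -> Z) :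
  [set `|f y| | y in [set y : Y | `|y| <= 1]] !=set0.
Proof. by exists `|f 0|; exists 0 => //=; rewrite normr0. Qed.

Lemma opnorm_has_ubound Y Z (f : Y -> Z) : bounded_op f ->
  has_ubound [set `|f y| | y in [set y : Y | `|y| <= 1]].
Proof.
move=> [M fM]; exists `|M| => _ [y /= y1 <-].
apply: le_trans (fM y) _; apply: le_trans (ler_norm _) _.
by rewrite normrM normr_id ler_piMr.
Qed.

Lemma opnorm_ge0 Y Z (f : Y -> Z) : 0 <= opnorm f.
Proof.
rewrite /opnorm; have [fb|/sup_out ->//] := pselect (has_sup
  [set `|f y| | y in [set y : Y | `|y| <= 1]]).
apply: le_trans (normr_ge0 (f 0)) _.
by apply: ub_le_sup; [case: fb | exists 0 => //=; rewrite normr0].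
Qed.

Lemma opnormP Y Z (f : {linear Y -> Z}) y : bounded_op f ->
  `|f y| <= opnorm f * `|y|.
Proof.
move=> fb; have [->|y0] := eqVneq y 0; first by rewrite linear0 !normr0 mulr0.
have ny : 0 < `|y| by rewrite normr_gt0.
rewrite -ler_pdivrMr//; have -> : `|f y| / `|y| = `|f (`|y|^-1 *: y)|.
  by rewrite linearZ/= normrZ ger0_norm ?invr_ge0// mulrC.
apply: ub_le_sup; first exact: opnorm_has_ubound.
by exists (`|y|^-1 *: y) => //=; rewrite normfZV.
Qed.

Lemma opnorm_le Y Z (f : Y -> Z) M : 0 <= M ->
  (forall y, `|f y| <= M * `|y|) -> opnorm f <= M.
Proof.
move=> M0 fM; apply: ge_sup; first exact: opnorm_set_nonempty.
move=> _ [y /= y1 <-]; apply: le_trans (fM y) _.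
by rewrite ler_piMr.
Qed.

Lemma isometric_refl Y : isometric Y Y.
Proof. by exists idfun; split => // z; exists z. Qed.

Lemma isometric_sym Y Z : isometric Y Z -> isometric Z Y.
Proof.
move=> [T [TN TS]].
have Tinj : injective T.
  move=> x y xy; apply/eqP; rewrite -subr_eq0 -normr_eq0 -TN linearB/= xy subrr.
  by rewrite normr0.
pose S z := projT1 (cid (TS z)).
have TSK z : T (S z) = z by rewrite /S; case: cid.
have Slin : linear S.
  by move=> a u v; apply: Tinj; rewrite linearP !TSK.
pose SL := GRing.isLinear.Build _ _ _ _ S Slin.
pose S' : {linear Z -> Y} := HB.pack S SL.
exists S'; split => [z|y]; first by rewrite -TN/= TSK.
by exists (T y); apply: Tinj; rewrite /= TSK.
Qed.

Lemma isometric_trans Y Z W : isometric Y Z -> isometric Z W -> isometric Y W.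
Proof.
move=> [T [TN TS]] [T' [TN' TS']]; exists (T' \o T); split => [y|z] /=.
  by rewrite TN' TN.
by have [y <-] := TS' z; have [x <-] := TS y; exists x.
Qed.

End operators.
Arguments Emb {R} C Y Z.
Arguments Iso {R} Y.

Section fdim_norms.
Context (R : realType).

Record rVnorm (n : nat) := RVNorm {
  rVnorm_fun :> 'rV[R]_n -> R ;
  rVnorm_triangle : forall x y, rVnorm_fun (x + y) <= rVnorm_fun x + rVnorm_fun y ;
  rVnorm_scale : forall a x, rVnorm_fun (a *: x) = `|a| * rVnorm_fun x ;
  rVnorm_eq0 : forall x, rVnorm_fun x = 0 -> x = 0 }.

HB.instance Definition _ n := gen_eqMixin (rVnorm n).
HB.instance Definition _ n := gen_choiceMixin (rVnorm n).

(* Every n-dimensional normed space is isometric to R^n with some norm, so the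
   n-dimensional spaces are represented by the norms on R^n; fdsp N carries the
   norm N instead of the canonical one. *)
Definition fdsp n (N : rVnorm n) : Type := 'rV[R]_n.

HB.instance Definition _ n (N : rVnorm n) := GRing.Lmodule.on (fdsp N).
HB.instance Definition _ n (N : rVnorm n) :=
  Lmodule_isNormed.Build R (fdsp N)
    (@rVnorm_triangle n N) (@rVnorm_scale n N) (@rVnorm_eq0 n N).

Lemma fdsp_normE n (N : rVnorm n) (x : fdsp N) : `|x| = N x.
Proof. by []. Qed.
End fdim_norms.
Arguments fdsp {R n} N.

Section fdim_bounds.
Context {R : realType}.

Section rVseminorm.
Variables (n : nat) (p : 'rV[R]_n -> R).
Hypothesis pD : forall x y, p (x + y) <= p x + p y.
Hypothesis pZ : forall a x, p (a *: x) = `|a| * p x.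

Lemma rVsemi0 : p 0 = 0.
Proof. by rewrite -(scale0r 0) pZ normr0 mul0r. Qed.

Lemma rVsemiN x : p (- x) = p x.
Proof. by rewrite -scaleN1r pZ normrN normr1 mul1r. Qed.

Lemma rVsemi_ge0 x : 0 <= p x.
Proof.
have := pD x (- x); rewrite subrr rVsemi0 rVsemiN -mulr2n.
by rewrite pmulrn_lge0.
Qed.

Lemma rVsemi_dist x y : `|p x - p y| <= p (x - y).
Proof.
rewrite ler_norml; apply/andP; split.
  rewrite lerNl opprB lerBlDr -(rVsemiN (x - y)) opprB addrC.
  by apply: le_trans _ (pD _ _); rewrite addrC subrK.
by rewrite lerBlDr; apply: le_trans _ (pD _ _); rewrite subrK.
Qed.

Lemma rVsemi_sum (I : Type) (s : seq I) (F : I -> 'rV[R]_n) :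
  p (\sum_(i <- s) F i) <= \sum_(i <- s) p (F i).
Proof.
elim: s => [|i s IH]; first by rewrite !big_nil rVsemi0.
by rewrite !big_cons; apply: le_trans (pD _ _) _; rewrite lerD2l.
Qed.

Lemma rVsemi_bound : exists2 C, 0 < C & forall x, p x <= C * `|x|.
Proof.
exists (1 + \sum_i p (delta_mx 0 i)).
  by rewrite ltr_pwDl// sumr_ge0// => i _; exact: rVsemi_ge0.
move=> x; rewrite {1}(row_sum_delta x).
apply: le_trans (rVsemi_sum _ _) _.
rewrite mulrDl mul1r; apply: (@le_trans _ _ ((\sum_i p (delta_mx 0 i)) * `|x|)).
  rewrite mulr_suml; apply: ler_sum => i _.
  rewrite pZ mulrC ler_wpM2l// ?rVsemi_ge0//.
  rewrite [leRHS]/Num.norm /= mx_normrE; apply/bigmax_geP; right => /=.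
  by exists (0, i).
by rewrite lerDr.
Qed.

Lemma rVsemi_continuous : continuous p.
Proof.
have [C C0 pC] := rVsemi_bound.
move=> x; apply/(@cvgrPdist_le _ R^o _ (nbhs x) _ p (p x)) => e e0.
apply/nbhs_ballP; exists (C^-1 * e); first by rewrite /= mulr_gt0// invr_gt0.
move=> y; rewrite -ball_normE /= ltr_pdivlMl// => /ltW xy.
exact: le_trans (rVsemi_dist _ _) (le_trans (pC _) xy).
Qed.

End rVseminorm.

Lemma rVnorm_lower n (N : rVnorm R n) : exists2 c, 0 < c &
  forall x : 'rV[R]_n, `|x| <= c * N x.
Proof.
pose S := [set x : 'rV[R]_n | `|x| = 1].
have [[x0 x01]|S0] := pselect (S !=set0); last first.
  exists 1 => // x; have [->|x0] := eqVneq x 0.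
    by rewrite normr0 (rVsemi0 (@rVnorm_scale _ _ N)) mulr0.
  by exfalso; apply: S0; exists (`|x|^-1 *: x); exact: normfZV.
have cS : compact S.
  apply: bounded_closed_compact.
    exists 1; split; first exact: num_real.
    by move=> r r1 x /= ->; exact: ltW.
  apply: (@closed_comp _ _ (fun x : 'rV[R]_n => `|x|) [set 1]).
    by move=> x _; exact: norm_continuous.
  exact: closed_eq.
have cN : continuous N.
  exact: rVsemi_continuous (@rVnorm_triangle _ _ N) (@rVnorm_scale _ _ N).
have [c Sc cmin] : exists2 c, c \in S & forall t, t \in S -> N c <= N t.
  apply: EVT_min_rV => //; first by exists x0.
  exact: continuous_subspaceT.
have c1 : `|c| = 1 by move: Sc; rewrite inE.
have Nc : 0 < N c.
  rewrite lt_neqAle (rVsemi_ge0 (@rVnorm_triangle _ _ N) (@rVnorm_scale _ _ N)).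
  rewrite andbT eq_sym; apply/eqP => /rVnorm_eq0 c0.
  by move: c1; rewrite c0 normr0 => /eqP; rewrite eq_sym oner_eq0.
exists (N c)^-1; first by rewrite invr_gt0.
move=> x; have [->|x0'] := eqVneq x 0.
  by rewrite normr0 (rVsemi0 (@rVnorm_scale _ _ N)) mulr0.
rewrite mulrC ler_pdivlMr// mulrC.
have nx : 0 < `|x| by rewrite normr_gt0.
rewrite -ler_pdivlMr// [_ / _]mulrC.
have := cmin (`|x|^-1 *: x); rewrite inE => /(_ (normfZV x0')).
by rewrite rVnorm_scale ger0_norm// invr_ge0.
Qed.

Lemma fdsp_bounded n (N : rVnorm R n) (Z : normedModType R)
  (f : {linear fdsp N -> Z}) : bounded_op f.
Proof.
have [c c0 xc] := rVnorm_lower N.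
pose p (x : 'rV[R]_n) : R := `|f (x : fdsp N)|.
have pD x y : p (x + y) <= p x + p y.
  by rewrite /p (linearD f (x : fdsp N) (y : fdsp N)) ler_normD.
have pZ a x : p (a *: x) = `|a| * p x.
  by rewrite /p -normrZ -(linearZ_LR f a (x : fdsp N)).
have [C C0 pC] := rVsemi_bound pD pZ.
exists (C * c) => y; apply: le_trans (pC y) _.
by rewrite -mulrA ler_wpM2l ?(ltW C0)//; exact: xc.
Qed.

End fdim_bounds.

Section BM_metric.
Context {R : realType} {n : nat}.
Implicit Types N M P : rVnorm R n.

Let dset N M := [set r | exists (T : {linear fdsp N -> fdsp M}) (S : {linear fdsp M -> fdsp N}),
    [/\ cancel T S, cancel S T & r = ln (opnorm T * opnorm S)]].

Let opnorm_iso N M (T : {linear fdsp N -> fdsp M}) (S : {linear fdsp M -> fdsp N}) :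
  cancel T S -> cancel S T ->
  (forall x : 'rV[R]_n, x = 0) \/
  [/\ 0 < opnorm T, 0 < opnorm S & 1 <= opnorm T * opnorm S].
Proof.
move=> TK SK; have [|] := pselect (forall x : 'rV[R]_n, x = 0); first by left.
move=> /existsNP[x /eqP x0]; right.
have H : 1 <= opnorm T * opnorm S.
  have nx : 0 < `|x : fdsp N| by rewrite normr_gt0.
  rewrite -(ler_pM2r nx) mul1r -{1}(TK x) mulrC.
  apply: le_trans (opnormP _ (fdsp_bounded S)) _.
  rewrite [_ * (_ * _)]mulrC -mulrA mulrCA ler_wpM2l ?opnorm_ge0//.
  by rewrite opnormP//; exact: fdsp_bounded.
have TS0 : 0 < opnorm T * opnorm S by exact: lt_le_trans H.
split => //.
  rewrite lt_neqAle opnorm_ge0 andbT; apply/eqP => T0.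
  by move: TS0; rewrite -T0 mul0r ltxx.
rewrite lt_neqAle opnorm_ge0 andbT; apply/eqP => T0.
by move: TS0; rewrite -T0 mulr0 ltxx.
Qed.

Let opnorm_triv N M (f : {linear fdsp N -> fdsp M}) : (forall x : 'rV[R]_n, x = 0) ->
  opnorm f = 0.
Proof.
move=> x0; apply/eqP; rewrite eq_le opnorm_ge0 andbT.
by apply: opnorm_le => // y; rewrite [f y]x0 normr0 mul0r.
Qed.

Let dset_ge0 N M : lbound (dset N M) 0.
Proof.
move=> _ [T [S [TK SK ->]]]; have [x0|[T0 S0 TS]] := opnorm_iso TK SK.
  by rewrite opnorm_triv// mul0r ln0.
exact: ln_ge0.
Qed.

Let dset_nonempty N M : dset N M !=set0.
Proof.
pose T : {linear fdsp N -> fdsp M} := [the {linear 'rV[R]_n -> 'rV[R]_n} of idfun].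
pose S : {linear fdsp M -> fdsp N} := [the {linear 'rV[R]_n -> 'rV[R]_n} of idfun].
by exists (ln (opnorm T * opnorm S)), T, S; split.
Qed.

Let dset_has_inf N M : has_inf (dset N M).
Proof. by split; [exact: dset_nonempty|exists 0; exact: dset_ge0]. Qed.

Lemma dBM_ge0 N M : 0 <= dBM (fdsp N) (fdsp M).
Proof. by apply: lb_le_inf; [exact: dset_nonempty|exact: dset_ge0]. Qed.

Lemma dBM_le N M (T : {linear fdsp N -> fdsp M}) (S : {linear fdsp M -> fdsp N}) :
  cancel T S -> cancel S T -> dBM (fdsp N) (fdsp M) <= ln (opnorm T * opnorm S).
Proof.
move=> TK SK; apply: ge_inf; last by exists T, S; split.
by exists 0; exact: dset_ge0.
Qed.

Lemma dBM_isometric N M : isometric (fdsp N) (fdsp M) ->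
  dBM (fdsp N) (fdsp M) = 0.
Proof.
move=> [T [TN TS]]; apply/eqP; rewrite eq_le dBM_ge0 andbT.
have Tinj : injective T.
  move=> x y xy; apply/eqP; rewrite -subr_eq0 -normr_eq0 -TN linearB/= xy subrr.
  by rewrite normr0.
pose S z := projT1 (cid (TS z)).
have TSK z : T (S z) = z by rewrite /S; case: cid.
have Slin : linear S by move=> a u v; apply: Tinj; rewrite linearP !TSK.
pose SL := GRing.isLinear.Build _ _ _ _ S Slin.
pose S' : {linear fdsp M -> fdsp N} := HB.pack S SL.
have SK : cancel T S' by move=> x; apply: Tinj; rewrite TSK.
apply: le_trans (dBM_le (S := S') SK TSK) _.
apply: ln_le0; rewrite -[leRHS]mulr1 ler_pM ?opnorm_ge0//.
  by apply: opnorm_le => // y; rewrite TN mul1r.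
by apply: opnorm_le => // y; rewrite -TN /= TSK mul1r.
Qed.

Lemma dBM_sym N M : dBM (fdsp N) (fdsp M) = dBM (fdsp M) (fdsp N).
Proof.
rewrite /dBM; congr inf; apply/seteqP; split => _ [T [S [TK SK ->]]];
  by exists S, T; split => //; rewrite mulrC.
Qed.

Lemma dBM_triangle M N P :
  dBM (fdsp N) (fdsp P) <= dBM (fdsp N) (fdsp M) + dBM (fdsp M) (fdsp P).
Proof.
apply/ler_addgt0Pr => e e0.
have e20 : 0 < e / 2 by rewrite divr_gt0.
have [_ [T [S [TK SK ->]]] d1] := inf_adherent e20 (dset_has_inf N M).
have [_ [T' [S' [TK' SK' ->]]] d2] := inf_adherent e20 (dset_has_inf M P).
have K1 : cancel (T' \o T) (S \o S') by exact: can_comp.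
have K2 : cancel (S \o S') (T' \o T) by exact: can_comp.
apply: le_trans (dBM_le (T := (T' \o T : {linear _ -> _}))
  (S := (S \o S' : {linear _ -> _})) K1 K2) _.
have cmp (A B C : rVnorm R n) (f : {linear fdsp A -> fdsp B}) (g : {linear fdsp B -> fdsp C}) :
    opnorm (g \o f) <= opnorm g * opnorm f.
  apply: opnorm_le => [|y /=]; first by rewrite mulr_ge0// opnorm_ge0.
  apply: le_trans (opnormP _ (fdsp_bounded g)) _.
  by rewrite -mulrA ler_wpM2l ?opnorm_ge0// opnormP//; exact: fdsp_bounded.
have -> : dBM (fdsp N) (fdsp M) + dBM (fdsp M) (fdsp P) + e =
  (dBM (fdsp N) (fdsp M) + e / 2) + (dBM (fdsp M) (fdsp P) + e / 2) by lra.
apply: le_trans (lerD (ltW d1) (ltW d2)).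
have [x0|[T0 S0 TS]] := opnorm_iso TK SK.
  by rewrite !opnorm_triv// mul0r ln0// addr0.
have [x0|[T0' S0' TS']] := opnorm_iso TK' SK'.
  by rewrite !opnorm_triv// mul0r ln0// addr0.
have [x0|[T0'' S0'' TS'']] := opnorm_iso K1 K2.
  by rewrite !opnorm_triv// mul0r ln0// addr0.
rewrite -lnM ?posrE ?mulr_gt0// ler_ln ?posrE ?mulr_gt0//.
have := ler_pM (opnorm_ge0 _) (opnorm_ge0 _) (cmp _ _ _ T T') (cmp _ _ _ S' S).
by move=> /le_trans; apply; rewrite le_eqVlt; apply/orP; left; apply/eqP; ring.
Qed.

Lemma dBM_eq0 N M : dBM (fdsp N) (fdsp M) = 0 -> isometric (fdsp N) (fdsp M).
Proof.
move=> d0; have [x0|] := pselect (forall x : 'rV[R]_n, x = 0).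
  exists [the {linear 'rV[R]_n -> 'rV[R]_n} of idfun].
  split=> [y|z]; last by exists z.
  change (M y = N y); rewrite (x0 y) (rVsemi0 (@rVnorm_scale _ _ M)).
  by rewrite (rVsemi0 (@rVnorm_scale _ _ N)).
move=> /existsNP[w /eqP w0].
have apprx (k : nat) : exists A : 'M[R]_n, forall x : 'rV[R]_n,
    M (x *m A) <= N x /\ N x <= expR k.+1%:R^-1 * M (x *m A).
  have k0 : 0 < k.+1%:R^-1 :> R by rewrite invr_gt0.
  have [_ [T [S [TK SK ->]]]] := inf_adherent k0 (dset_has_inf N M).
  have -> : inf (dset N M) = 0 by exact: d0.
  have [x0|[T0 S0 TS]] := opnorm_iso TK SK; first by rewrite (x0 w) eqxx in w0.
  rewrite add0r => dk.
  pose f : {linear 'rV[R]_n -> 'rV[R]_n} := (opnorm T)^-1 \*: T.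
  exists (lin1_mx f) => x; rewrite mul_rV_lin1.
  have -> : f x = (opnorm T)^-1 *: (T x) by [].
  rewrite rVnorm_scale ger0_norm ?invr_ge0 ?opnorm_ge0//; split.
    by rewrite ler_pdivrMl//; exact: (@opnormP _ (fdsp N) (fdsp M) T x (fdsp_bounded T)).
  apply: (@le_trans _ _ (opnorm S * M (T x))).
    by rewrite -[X in N X <= _](TK x); exact: (@opnormP _ (fdsp M) (fdsp N) S (T x) (fdsp_bounded S)).
  rewrite mulrA ler_wpM2r//; first exact: (normr_ge0 (T x : fdsp M)).
  rewrite ler_pdivlMr// mulrC -[leLHS]lnK ?posrE ?mulr_gt0// ler_expR.
  exact: ltW.
have [A AP] := choice apprx.
pose V : 'rV[R]_(n * n) -> 'M[R]_n := vec_mx.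
pose u (k : nat) : 'rV[R]_(n * n) := mxvec (A k).
have Vu k : V (u k) = A k by exact: mxvecK.
have cont (x : 'rV[R]_n) : continuous (fun v => M (x *m V v)).
  apply: rVsemi_continuous => [v v'|a v].
    by rewrite /V linearD/= mulmxDr; exact: rVnorm_triangle.
  by rewrite /V linearZ/= -scalemxAr; exact: rVnorm_scale.
pose D := [set v | forall x, M (x *m V v) <= N x].
have Dcl : closed D.
  have -> : D = \bigcap_x ((fun v => M (x *m V v)) @^-1` [set r | r <= N x]).
    by apply/seteqP; split => [v Dv x _|v Dv x]; [exact: Dv|exact: (Dv x)].
  apply: closed_bigI => x _; apply: closed_comp; last exact: closed_le.
  by move=> v _; exact: cont.
have [c c0 cM] := rVnorm_lower M.
have [C C0 NC] := rVsemi_bound (@rVnorm_triangle _ _ N) (@rVnorm_scale _ _ N).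
have Dbd : bounded_set D.
  exists (c * C); split; first exact: num_real.
  move=> r /ltW cr v Dv; apply: le_trans cr.
  have cC0 : 0 <= c * C by rewrite mulr_ge0// ltW.
  rewrite [leLHS]/Num.norm /= mx_normrE; apply/bigmax_leP; split => // -[i j] _.
  rewrite (ord1 i) /= -(vec_mxK v).
  case/mxvec_indexP: j => a b; rewrite mxvecE.
  have -> : vec_mx v a b = ((delta_mx 0 a : 'rV[R]_n) *m V v) 0 b by rewrite -rowE [RHS]mxE.
  have le1 (y : 'rV[R]_n) k : `|y 0 k| <= `|y|.
    rewrite [leRHS]/Num.norm /= mx_normrE; apply/bigmax_geP; right => /=.
    by exists (0, k).
  apply: le_trans (le1 _ _) _; apply: le_trans (cM _) _.
  rewrite ler_pM2l//; apply: le_trans (Dv _) _; apply: le_trans (NC _) _.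
  rewrite ler_piMr ?(ltW C0)//.
  rewrite [leLHS]/Num.norm /= mx_normrE; apply/bigmax_leP; split => // -[i' j'] _ /=.
  by rewrite mxE; case: (_ && _); rewrite ?normr1 ?normr0.
have Dco : compact D by exact: bounded_closed_compact.
have [|v [Dv clv]] := Dco (u @ \oo) _.
  by exists 0%N => // k _ x; rewrite /= Vu; have [] := AP k x.
have vge x : N x <= M (x *m V v).
  have vj (j : nat) : N x <= expR j.+1%:R^-1 * M (x *m V v).
    pose Dj := [set v | N x <= expR j.+1%:R^-1 * M (x *m V v)].
    suff : Dj v by [].
    have Djcl : closed Dj.
      have -> : Dj = (fun v => M (x *m V v)) @^-1` [set r | (expR j.+1%:R^-1)^-1 * N x <= r].
        by apply/seteqP; split => z; rewrite /Dj /= ler_pdivrMl// expR_gt0.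
      by apply: closed_comp; [move=> z _; exact: cont|exact: closed_ge].
    apply: Djcl => B Bv; apply: clv => //.
    exists j => // k /= jk; rewrite /Dj /= Vu.
    have [_ Nk] := AP k x; apply: le_trans Nk _.
    rewrite ler_wpM2r//; first exact: (normr_ge0 (x *m A k : fdsp M)).
    by rewrite ler_expR lef_pV2 ?posrE// ler_nat.
  have cM' : (fun j => expR j.+1%:R^-1 * M (x *m V v)) @ \oo --> M (x *m V v).
    rewrite -[X in _ --> X]mul1r; apply: cvgM; last exact: cvg_cst.
    rewrite -[X in _ --> X]expR0.
    have := cvg_comp (@harmonic R) (@expR R) (@cvg_harmonic R) (@continuous_expR R 0).
    exact.
  rewrite -(cvg_lim _ cM')//; apply: limr_ge; first by apply/cvg_ex; eexists; exact: cM'.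
  exact: nearW.
have vM x : M (x *m V v) = N x by apply/eqP; rewrite eq_le Dv vge.
pose T : {linear fdsp N -> fdsp M} := [the {linear 'rV[R]_n -> 'rV[R]_n} of mulmxr (V v)].
have Vunit : V v \in unitmx.
  rewrite -row_free_unit -kermx_eq0; apply/eqP/row_matrixP => i.
  rewrite row0; apply: (@rVnorm_eq0 _ _ N); rewrite -vM -row_mul mulmx_ker.
  by rewrite row0 (rVsemi0 (@rVnorm_scale _ _ M)).
exists T; split => [y|z]; first exact: vM.
by exists (z *m invmx (V v)); exact: mulmxKV.
Qed.

End BM_metric.

Section BM.
Context (R : realType).

Definition isoR n (N M : rVnorm R n) : bool := `[< isometric (fdsp N) (fdsp M) >].

Lemma isoR_equiv n : equiv_class_of (@isoR n).
Proof.
split=> [N|N M|M N P]; first exact/asboolP/isometric_refl.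
  by apply/asboolP/asboolP; exact: isometric_sym.
by move=> /asboolP NM /asboolP MP; exact/asboolP/(isometric_trans NM).
Qed.

Canonical isoR_equiv_rel n := EquivRelPack (@isoR_equiv n).

Definition BMn n : Type := {eq_quot @isoR n}.
HB.instance Definition _ n := Choice.on (BMn n).
HB.instance Definition _ n := Quotient.on (BMn n).

Definition dBMn n (E F : BMn n) : R := dBM (fdsp (repr E)) (fdsp (repr F)).

Lemma dBMn_eq0 n (E F : BMn n) : dBMn E F = 0 -> E = F.
Proof.
move=> /dBM_eq0 EF; rewrite -[E]reprK -[F]reprK.
by apply/eqquotP; apply/asboolP.
Qed.

(* dBM is invariant under isometry, so the representatives do not matter. *)
HB.instance Definition _ n := isMetric.Build R (BMn n)
  (fun E => dBM_isometric (isometric_refl (fdsp (repr E)))) (@dBMn_eq0 n)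
  (fun E F => dBM_sym (repr E) (repr F))
  (fun F E G => dBM_triangle (repr F) (repr E) (repr G)).

(* The topology on a sigma type is that of the disjoint union. *)
Definition BM : Type := {n : nat & BMn n}.
HB.instance Definition _ := Topological.on BM.

Definition bmsp (E : BM) : normedModType R := fdsp (repr (projT2 E)).

End BM.

Section codings.
Context (R : realType).

Record pseudonorm (W : lmodType R) := Pseudonorm {
  pseudonorm_fun :> W -> R ;
  pseudonorm_triangle : forall x y,
    pseudonorm_fun (x + y) <= pseudonorm_fun x + pseudonorm_fun y ;
  pseudonorm_scale : forall a x,
    pseudonorm_fun (a *: x) = `|a| * pseudonorm_fun x }.

(* A polynomial is a finitely supported sequence (of its coefficients): the
   rational vector space V is {poly rat} and c_00 is {poly R}. *)
Definition Qpseudonorm : set {ptws {poly rat} -> R} :=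
  [set mu | (forall x y, mu (x + y) <= mu x + mu y) /\
            (forall a x, mu (a *: x) = ratr `|a| * mu x)].

Definition codes : Type := set_type Qpseudonorm.
HB.instance Definition _ := Topological.on codes.

Definition code_fun (mu : codes) : {poly rat} -> R := \val mu.
Coercion code_fun : codes >-> Funclass.

Definition rat_inc (v : {poly rat}) : {poly R} := map_poly ratr v.

(* The weighted l^1 norm with weights mu e_i; it dominates mu, so the infimal
   convolution real_ext_fun extends mu. It is the only pseudonorm on c_00 that
   does so (real_ext_unique below). *)
Definition ell (mu : codes) (x : {poly R}) : R :=
  \sum_(i < size x) `|x`_i| * mu 'X^i.

Definition real_ext_fun (mu : codes) (x : {poly R}) : R :=
  inf [set mu v + ell mu (x - rat_inc v) | v in [set: {poly rat}]].

Section real_extension.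
Variable mu : codes.

Lemma codeD x y : mu (x + y) <= mu x + mu y.
Proof. by have [+ _] := set_mem (valP mu); apply. Qed.

Lemma codeZ a x : mu (a *: x) = ratr `|a| * mu x.
Proof. by have [_] := set_mem (valP mu); apply. Qed.

Lemma code0 : mu 0 = 0.
Proof. by rewrite -(scale0r 0) codeZ normr0 rmorph0 mul0r. Qed.

Lemma codeN x : mu (- x) = mu x.
Proof. by rewrite -scaleN1r codeZ normrN normr1 rmorph1 mul1r. Qed.

Lemma code_ge0 x : 0 <= mu x.
Proof.
by have := codeD x (- x); rewrite subrr code0 codeN -mulr2n pmulrn_lge0.
Qed.

Lemma code_sum (I : Type) (s : seq I) (F : I -> {poly rat}) :
  mu (\sum_(i <- s) F i) <= \sum_(i <- s) mu (F i).
Proof.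
elim: s => [|i s IH]; first by rewrite !big_nil code0.
by rewrite !big_cons; apply: le_trans (codeD _ _) _; rewrite lerD2l.
Qed.

Lemma ellE n (x : {poly R}) : (size x <= n)%N ->
  ell mu x = \sum_(i < n) `|x`_i| * mu 'X^i.
Proof.
move=> xn; rewrite /ell.
rewrite -(big_mkord xpredT (fun i => `|x`_i| * mu 'X^i)).
rewrite -[RHS](big_mkord xpredT (fun i => `|x`_i| * mu 'X^i)).
rewrite [RHS](big_cat_nat (leq0n (size x)) xn)/=.
rewrite [X in _ = _ + X]big_nat_cond [X in _ = _ + X]big1 ?addr0// => i.
by move=> /andP[/andP[xi _] _]; rewrite nth_default// normr0 mul0r.
Qed.

Lemma ell_ge0 x : 0 <= ell mu x.
Proof. by apply: sumr_ge0 => i _; rewrite mulr_ge0// code_ge0. Qed.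

Lemma ellD x y : ell mu (x + y) <= ell mu x + ell mu y.
Proof.
pose n := maxn (size x) (size y).
rewrite (@ellE n) ?size_polyD// (@ellE n x) ?leq_maxl// (@ellE n y) ?leq_maxr//.
rewrite -big_split/=; apply: ler_sum => i _.
by rewrite -mulrDl coefD ler_wpM2r ?code_ge0// ler_normD.
Qed.

Lemma ellZ a x : ell mu (a *: x) = `|a| * ell mu x.
Proof.
rewrite (@ellE (size x)) ?size_scale_leq// mulr_sumr.
by apply: eq_bigr => i _; rewrite coefZ normrM mulrA.
Qed.

Lemma ellN x : ell mu (- x) = ell mu x.
Proof. by rewrite -scaleN1r ellZ normrN normr1 mul1r. Qed.

Lemma ell0 : ell mu 0 = 0.
Proof. by rewrite -(scale0r 0) ellZ normr0 mul0r. Qed.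

Lemma incD v w : rat_inc (v + w) = rat_inc v + rat_inc w. Proof. exact: rmorphD. Qed.
Lemma incB v w : rat_inc (v - w) = rat_inc v - rat_inc w. Proof. exact: rmorphB. Qed.
Lemma inc0 : rat_inc 0 = 0. Proof. exact: rmorph0. Qed.
Lemma incZ a v : rat_inc (a *: v) = ratr a *: rat_inc v.
Proof. exact: map_polyZ. Qed.

Lemma code_ell v : mu v <= ell mu (rat_inc v).
Proof.
rewrite -{1}(coefK v) poly_def (@ellE (size v)) ?size_poly//.
apply: le_trans (code_sum _ _) _; apply: ler_sum => i _.
rewrite codeZ /rat_inc coef_map/= ler_wpM2r ?code_ge0//.
by rewrite ratr_norm.
Qed.

Let eset x := [set mu v + ell mu (x - rat_inc v) | v in [set: {poly rat}]].

Let eset_lb x : has_lbound (eset x).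
Proof.
by exists 0 => _ [v _ <-]; rewrite addr_ge0 ?code_ge0 ?ell_ge0.
Qed.

Let eset_inf x : has_inf (eset x).
Proof. by split; [exists (mu 0 + ell mu (x - rat_inc 0)), 0|exact: eset_lb]. Qed.

Lemma real_ext_le x v : real_ext_fun mu x <= mu v + ell mu (x - rat_inc v).
Proof. by apply: ge_inf; [exact: eset_lb|exists v]. Qed.

Lemma real_ext_inc v : real_ext_fun mu (rat_inc v) = mu v.
Proof.
apply/eqP; rewrite eq_le; apply/andP; split.
  by apply: le_trans (real_ext_le _ v) _; rewrite subrr ell0 addr0.
apply: lb_le_inf; first by case: (eset_inf (rat_inc v)).
move=> _ [w _ <-]; rewrite -incB.
apply: le_trans (lerD (lexx _) (code_ell _)).
by apply: le_trans (codeD _ _); rewrite addrC subrK.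
Qed.

Lemma real_ext_triangle x y : real_ext_fun mu (x + y) <= real_ext_fun mu x + real_ext_fun mu y.
Proof.
apply/ler_addgt0Pr => e e0.
have e20 : 0 < e / 2 by rewrite divr_gt0.
have [_ [v _ <-] dv] := inf_adherent e20 (eset_inf x).
have [_ [w _ <-] dw] := inf_adherent e20 (eset_inf y).
apply: le_trans (real_ext_le _ (v + w)) _.
have -> : real_ext_fun mu x + real_ext_fun mu y + e =
  (real_ext_fun mu x + e / 2) + (real_ext_fun mu y + e / 2) by lra.
apply: le_trans (lerD (ltW dv) (ltW dw)).
rewrite addrACA; apply: lerD; first exact: codeD.
by rewrite incD opprD addrACA ellD.
Qed.

Let real_ext_scale_le a x : real_ext_fun mu (a *: x) <= `|a| * real_ext_fun mu x.
Proof.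
have key v : real_ext_fun mu (a *: x) <= `|a| * (mu v + ell mu (x - rat_inc v)).
  apply/ler_addgt0Pr => e e0.
  pose d := e / (1 + mu v + ell mu (rat_inc v)).
  have M0 : 0 < 1 + mu v + ell mu (rat_inc v).
    by rewrite -addrA ltr_pwDl// addr_ge0 ?code_ge0 ?ell_ge0.
  have d0 : 0 < d by rewrite divr_gt0.
  have [q] : exists q : rat, `|a - ratr q| <= d.
    have [q] := @rat_in_itvoo R (a - d) (a + d) (ltac:(lra)).
    rewrite in_itv/= => /andP[q1 q2]; exists q.
    by rewrite ler_norml; apply/andP; split; lra.
  move=> qa; apply: le_trans (real_ext_le _ (q *: v)) _.
  rewrite codeZ incZ.
  have -> : a *: x - ratr q *: rat_inc v = a *: (x - rat_inc v) + (a - ratr q) *: rat_inc v.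
    by rewrite scalerBr scalerBl addrA subrK.
  apply: le_trans (lerD (lexx _) (ellD _ _)) _; rewrite !ellZ ratr_norm.
  have qn : `|ratr q| <= `|a| + d :> R.
    rewrite -lerBlDl; apply: le_trans qa; rewrite distrC.
    exact: lerB_dist.
  have h1 : `|ratr q| * mu v <= (`|a| + d) * mu v by rewrite ler_wpM2r ?code_ge0.
  have h2 : `|a - ratr q| * ell mu (rat_inc v) <= d * ell mu (rat_inc v).
    by rewrite ler_wpM2r ?ell_ge0.
  have h3 : d * (1 + mu v + ell mu (rat_inc v)) = e by rewrite divfK// gt_eqF.
  rewrite -h3; nra.
have [->|a0] := eqVneq a 0.
  by rewrite scale0r normr0 mul0r -inc0 real_ext_inc code0.
have na : 0 < `|a| by rewrite normr_gt0.
rewrite -ler_pdivrMl//; apply: lb_le_inf; first by case: (eset_inf x).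
by move=> _ [v _ <-]; rewrite ler_pdivrMl//; exact: key.
Qed.

Lemma real_ext_scale a x : real_ext_fun mu (a *: x) = `|a| * real_ext_fun mu x.
Proof.
apply/eqP; rewrite eq_le real_ext_scale_le/=.
have [->|a0] := eqVneq a 0.
  by rewrite normr0 mul0r scale0r -inc0 real_ext_inc code0.
have na : 0 < `|a| by rewrite normr_gt0.
rewrite -ler_pdivlMl// -normfV.
by have := real_ext_scale_le a^-1 (a *: x); rewrite scalerA mulVf// scale1r.
Qed.

Definition real_ext : pseudonorm {poly R} := Pseudonorm real_ext_triangle real_ext_scale.

Lemma real_ext_unique (q : pseudonorm {poly R}) :
  (forall v, q (rat_inc v) = mu v) -> q =1 real_ext.
Proof.
move=> qmu x.
have qell (y : {poly R}) : q y <= ell mu y.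
  have q0 : q 0 = 0 by rewrite -(scale0r 0) pseudonorm_scale normr0 mul0r.
  have qsum (I : Type) (s : seq I) (F : I -> {poly R}) :
      q (\sum_(i <- s) F i) <= \sum_(i <- s) q (F i).
    elim: s => [|i s IH]; first by rewrite !big_nil q0.
    rewrite !big_cons; apply: le_trans (pseudonorm_triangle _ _ _) _.
    by rewrite lerD2l.
  rewrite -{1}(coefK y) poly_def; apply: le_trans (qsum _ _ _) _.
  apply: ler_sum => i _; rewrite pseudonorm_scale -qmu.
  by rewrite /rat_inc map_polyXn.
have qN y : q (- y) = q y.
  by rewrite -scaleN1r pseudonorm_scale normrN normr1 mul1r.
apply/eqP; rewrite eq_le; apply/andP; split.
  apply: lb_le_inf; first by case: (eset_inf x).
  move=> _ [v _ <-]; rewrite -qmu; apply: le_trans (lerD (lexx _) (qell _)).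
  by apply: le_trans (pseudonorm_triangle _ _ _); rewrite addrC subrK.
apply/ler_addgt0Pr => e e0.
pose M := 1 + \sum_(i < size x) mu 'X^i.
have M0 : 0 < M by rewrite ltr_pwDl// sumr_ge0// => i _; exact: code_ge0.
have d0 : 0 < e / 2 / M by rewrite !divr_gt0.
have /choice[r rx] : forall i : nat, exists r : rat, `|x`_i - ratr r| <= e / 2 / M.
  move=> i; have [r] := @rat_in_itvoo R (x`_i - e / 2 / M) (x`_i + e / 2 / M) (ltac:(lra)).
  rewrite in_itv/= => /andP[q1 q2]; exists r.
  by rewrite ler_norml; apply/andP; split; lra.
pose v := \poly_(i < size x) r i.
have xv : ell mu (x - rat_inc v) <= e / 2.
  rewrite (@ellE (size x)); last first.
    apply: leq_trans (size_polyD _ _) _; rewrite size_polyN geq_max leqnn/=.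
    by apply: leq_trans (size_poly _ _) _; exact: size_poly.
  have -> : e / 2 = (e / 2 / M) * M by rewrite divfK// gt_eqF.
  rewrite [leRHS]mulrDr mulr1 ler_wpDl ?(ltW d0)// mulr_sumr.
  apply: ler_sum => i _; rewrite ler_wpM2r ?code_ge0//.
  by rewrite coefB coef_map coef_poly ltn_ord.
apply: le_trans (real_ext_le x v) _; rewrite -qmu.
have := pseudonorm_triangle q x (rat_inc v - x).
rewrite [x + _]addrC subrK -[q (rat_inc v - x)]qN opprB.
by have := qell (x - rat_inc v); lra.
Qed.

End real_extension.

End codings.

Section kernel_quotient.
Context {R : realType} {W : lmodType R}.
Variable p : pseudonorm W.

Lemma pn0 : p 0 = 0.
Proof. by rewrite -(scale0r 0) pseudonorm_scale normr0 mul0r. Qed.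

Lemma pnN x : p (- x) = p x.
Proof. by rewrite -scaleN1r pseudonorm_scale normrN normr1 mul1r. Qed.

Lemma pn_ge0 x : 0 <= p x.
Proof.
have := pseudonorm_triangle p x (- x).
by rewrite subrr pn0 pnN -mulr2n pmulrn_lge0.
Qed.

Lemma pn_triangleB z x y : p (x - y) <= p (x - z) + p (z - y).
Proof. by apply: le_trans (pseudonorm_triangle _ _ _); rewrite addrA subrK. Qed.

Definition kereq (x y : W) : bool := p (x - y) == 0.

Lemma kereq_equiv : equiv_class_of kereq.
Proof.
split=> [x|x y|y x z]; rewrite /kereq; first by rewrite subrr pn0.
  by rewrite -pnN opprB.
move=> /eqP xy /eqP yz; rewrite eq_le pn_ge0 andbT.
by rewrite (le_trans (pn_triangleB y _ _))// xy yz addr0.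
Qed.

Canonical kereq_equiv_rel := EquivRelPack kereq_equiv.

Definition kerquot : Type := {eq_quot kereq}.
HB.instance Definition _ := Choice.on kerquot.
HB.instance Definition _ := Quotient.on kerquot.

Definition kerpi (x : W) : kerquot := \pi_kerquot x.

Lemma kerpiP x y : kerpi x = kerpi y <-> p (x - y) = 0.
Proof.
split; first by move=> /eqquotP /eqP.
by move=> xy; apply/eqquotP/eqP.
Qed.

Lemma kerrepr x : p (repr (kerpi x) - x) = 0.
Proof. by apply/kerpiP; exact: reprK. Qed.

Definition kq0 : kerquot := kerpi 0.
Definition kqN (x : kerquot) : kerquot := kerpi (- repr x).
Definition kqD (x y : kerquot) : kerquot := kerpi (repr x + repr y).
Definition kqZ (a : R) (x : kerquot) : kerquot := kerpi (a *: repr x).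
Definition kqnorm (x : kerquot) : R := p (repr x).

Let pn_eq0D x y : p x = 0 -> p y = 0 -> p (x + y) = 0.
Proof.
move=> x0 y0; apply/eqP; rewrite eq_le pn_ge0 andbT.
by rewrite (le_trans (pseudonorm_triangle _ _ _))// x0 y0 addr0.
Qed.

Let kqDE x y : kqD (kerpi x) (kerpi y) = kerpi (x + y).
Proof.
by apply/kerpiP; rewrite opprD addrACA pn_eq0D// kerrepr.
Qed.

Let kqNE x : kqN (kerpi x) = kerpi (- x).
Proof. by apply/kerpiP; rewrite -opprD pnN kerrepr. Qed.

Let kqZE a x : kqZ a (kerpi x) = kerpi (a *: x).
Proof.
by apply/kerpiP; rewrite -scalerBr pseudonorm_scale kerrepr mulr0.
Qed.

Let kqW (P : kerquot -> Prop) : (forall x, P (kerpi x)) -> forall x, P x.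
Proof. by move=> PP x; rewrite -(reprK x); exact: PP. Qed.

Let kqDA : associative kqD.
Proof. by do 3 (elim/kqW => ?); rewrite !kqDE addrA. Qed.
Let kqDC : commutative kqD.
Proof. by do 2 (elim/kqW => ?); rewrite !kqDE addrC. Qed.
Let kq0D : left_id kq0 kqD.
Proof. by elim/kqW => ?; rewrite !kqDE add0r. Qed.
Let kqND : left_inverse kq0 kqN kqD.
Proof. by elim/kqW => ?; rewrite kqNE !kqDE addNr. Qed.

HB.instance Definition _ :=
  GRing.isZmodule.Build kerquot kqDA kqDC kq0D kqND.

Let addE x y : kerpi x + kerpi y = kerpi (x + y).
Proof. exact: kqDE. Qed.

Let kqZA a b x : kqZ a (kqZ b x) = kqZ (a * b) x.
Proof. by elim/kqW: x => x; rewrite !kqZE scalerA. Qed.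
Let kqZ1 : left_id 1 kqZ.
Proof. by elim/kqW => x; rewrite !kqZE scale1r. Qed.
Let kqZDr : right_distributive kqZ +%R.
Proof. by move=> a; do 2 (elim/kqW => ?); rewrite !(addE, kqZE) scalerDr. Qed.
Let kqZDl x : {morph kqZ^~ x : a b / a + b}.
Proof. by elim/kqW: x => x a b; rewrite !kqZE addE scalerDl. Qed.

HB.instance Definition _ :=
  GRing.Zmodule_isLmodule.Build R kerquot kqZA kqZ1 kqZDr kqZDl.

Lemma kqnormE x : kqnorm (kerpi x) = p x.
Proof.
apply/eqP; rewrite eq_le; apply/andP; split.
  rewrite -[leRHS]add0r -(kerrepr x).
  by rewrite (le_trans _ (pseudonorm_triangle _ _ _))// subrK.
rewrite -[leRHS]add0r -(kerrepr x) -[X in X + _]pnN opprB.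
by rewrite (le_trans _ (pseudonorm_triangle _ _ _))// subrK.
Qed.

Let kqnormD x y : kqnorm (x + y) <= kqnorm x + kqnorm y.
Proof.
elim/kqW: x => x; elim/kqW: y => y.
by rewrite addE !kqnormE pseudonorm_triangle.
Qed.
Let scaleE a x : a *: kerpi x = kerpi (a *: x).
Proof. exact: kqZE. Qed.
Let kqnormZ a x : kqnorm (a *: x) = `|a| * kqnorm x.
Proof. by elim/kqW: x => x; rewrite scaleE !kqnormE pseudonorm_scale. Qed.
Let kqnorm_eq0 x : kqnorm x = 0 -> x = 0.
Proof.
by elim/kqW: x => x; rewrite kqnormE => x0; apply/kerpiP; rewrite subr0.
Qed.

HB.instance Definition _ :=
  Lmodule_isNormed.Build R kerquot kqnormD kqnormZ kqnorm_eq0.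

Let kerpi_linear : linear kerpi.
Proof. by move=> a x y; rewrite scaleE addE. Qed.
HB.instance Definition _ := GRing.isLinear.Build R W kerquot _ kerpi kerpi_linear.

Lemma kerpi_norm x : `|kerpi x| = p x.
Proof. exact: kqnormE. Qed.

Lemma kerpi_surj y : exists x, kerpi x = y.
Proof. by exists (repr y); exact: reprK. Qed.

End kernel_quotient.

(* Cauchy sequences modulo sequences of norm tending to 0. *)
Section completion.
Context {R : realType}.
Variable Y : normedModType R.

Definition cauchy_seqs : set (nat -> Y) := [set u | cauchy (u @ \oo)].

Lemma cauchy_seqP (u : nat -> Y) : cauchy_seqs u <->
  forall e, 0 < e -> exists N, forall m n, (N <= m)%N -> (N <= n)%N ->
    `|u m - u n| < e.
Proof.
rewrite /cauchy_seqs /=; split.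
  move=> /cauchyP cu e e0; have e20 : 0 < e / 2 by rewrite divr_gt0.
  have [x [N _ xN]] := cu _ e20; exists N => m n Nm Nn.
  rewrite (splitr e); apply: le_lt_trans (ler_distD x _ _) _.
  have := xN m Nm; have := xN n Nn; rewrite /= -!ball_normE /= => h1 h2.
  by rewrite ltrD// distrC.
move=> cu; apply/cauchyP => e e0; have [N NP] := cu _ e0.
exists (u N); exists N => // n /= Nn; rewrite -ball_normE /=.
exact: NP.
Qed.

Definition cauchy_pred : {pred (nat -> Y)} := mem cauchy_seqs.

Lemma cauchy_submod : submod_closed cauchy_pred.
Proof.
split=> [|a u v]; rewrite /cauchy_pred.
  rewrite inE; apply/cauchy_seqP => e e0; exists 0%N => m n _ _.
  by rewrite subrr normr0.
rewrite !inE => /cauchy_seqP cu /cauchy_seqP cv; apply/cauchy_seqP => e e0.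
have e20 : 0 < e / 2 by rewrite divr_gt0.
have a1 : 0 < `|a| + 1 by rewrite ltr_wpDl.
have [N NP] := cu (e / 2 / (`|a| + 1)) (ltac:(by rewrite divr_gt0)).
have [M MP] := cv (e / 2) e20.
exists (maxn N M) => m n; rewrite !geq_max => /andP[Nm Mm] /andP[Nn Mn].
have -> : (a *: u + v) m - (a *: u + v) n = a *: (u m - u n) + (v m - v n).
  by rewrite scalerBr opprD addrACA.
rewrite (splitr e); apply: le_lt_trans (ler_normD _ _) _.
rewrite ler_ltD ?MP// normrZ.
have h := ltW (NP m n Nm Nn).
rewrite ler_pdivlMr// in h; apply: le_trans h.
by rewrite mulrC ler_wpM2l// lerDl.
Qed.

HB.instance Definition _ :=
  GRing.isSubmodClosed.Build R _ cauchy_pred cauchy_submod.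

Definition cseq : Type := {u : nat -> Y | u \in cauchy_pred}.
HB.instance Definition _ := SubType.on cseq.
HB.instance Definition _ := Choice.on cseq.
HB.instance Definition _ := [SubChoice_isSubLmodule of cseq by <:].

Definition cseq_norm (u : cseq) : R := lim (`|val u n| @[n --> \oo]).

Lemma cseq_norm_cvg (u : cseq) : `|val u n| @[n --> \oo] --> cseq_norm u.
Proof.
have /set_mem/cauchy_seqP cu := valP u.
suff : cvg (`|val u n| @[n --> \oo]) by [].
apply: cauchy_cvg; apply/cauchyP => e e0; have [N NP] := cu e e0.
exists `|val u N|; exists N => // n /= Nn; rewrite -ball_normE /=.
by apply: le_lt_trans (ler_dist_dist _ _) _; exact: NP.
Qed.

Arguments cseq_norm_cvg : clear implicits.

Lemma cseq_norm_triangle u v : cseq_norm (u + v) <= cseq_norm u + cseq_norm v.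
Proof.
apply: (ler_cvg_to (cseq_norm_cvg (u + v))
  (cvgD (cseq_norm_cvg u) (cseq_norm_cvg v))).
by apply: nearW => n; exact: ler_normD.
Qed.

Lemma cseq_norm_scale a u : cseq_norm (a *: u) = `|a| * cseq_norm u.
Proof.
apply/esym; apply: (cvg_unique _ _ (cseq_norm_cvg (a *: u))) => //.
have -> : (fun n => `|val (a *: u) n|) = (fun n => `|a| * `|val u n|).
  by apply/funext => n; rewrite -normrZ.
by apply: cvgM; [exact: cvg_cst|exact: cseq_norm_cvg].
Qed.

Definition cseq_pseudonorm : pseudonorm cseq :=
  Pseudonorm cseq_norm_triangle cseq_norm_scale.

Definition completion : Type := kerquot cseq_pseudonorm.
HB.instance Definition _ := NormedModule.on completion.

Lemma const_cauchy (y : Y) : (fun=> y) \in cauchy_pred.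
Proof.
apply/mem_set/cauchy_seqP => e e0; exists 0%N => m n _ _.
by rewrite subrr normr0.
Qed.

Definition const_cseq (y : Y) : cseq := exist _ (fun=> y) (const_cauchy y).

Definition completion_in (y : Y) : completion := kerpi cseq_pseudonorm (const_cseq y).

Lemma completion_in_linear : linear completion_in.
Proof.
move=> a x y; rewrite /completion_in.
have -> : const_cseq (a *: x + y) = a *: const_cseq x + const_cseq y by apply/val_inj; apply/funext.
exact: linearP.
Qed.
HB.instance Definition _ :=
  GRing.isLinear.Build R Y completion _ completion_in completion_in_linear.

Lemma completion_in_norm y : `|completion_in y| = `|y|.
Proof.
rewrite [LHS]kerpi_norm /= /cseq_norm.
rewrite (_ : (fun n => `|val (const_cseq y) n|) = fun=> `|y|)//.
exact: lim_cst.
Qed.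

Lemma completion_approx (u : cseq) e : 0 < e -> exists N, forall n, (N <= n)%N ->
  `|(kerpi cseq_pseudonorm u : completion) - completion_in (val u n)| <= e.
Proof.
move=> e0; have /set_mem/cauchy_seqP/(_ _ e0)[N NP] := valP u.
exists N => n Nn; have -> : (kerpi cseq_pseudonorm u : completion)
    - completion_in (val u n) =
    kerpi cseq_pseudonorm (u - const_cseq (val u n)).
  by rewrite linearB.
rewrite [leLHS]kerpi_norm /=.
apply: (cvgr_to_le (cseq_norm_cvg (u - const_cseq (val u n)))).
by exists N => // m /= Nm; exact/ltW/NP.
Qed.

Lemma completion_in_dense : dense (range completion_in).
Proof.
move=> O [x Ox] oO; have := open_nbhs_nbhs (conj oO Ox).
move=> /nbhs_ballP [e /= e0 eO].
have [u ux] := kerpi_surj x; have e20 : 0 < e / 2 by rewrite divr_gt0.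
have [N NP] := completion_approx u e20.
exists (completion_in (val u N)); split; last by exists (val u N).
apply: eO; rewrite -ball_normE /= -ux.
by apply: le_lt_trans (NP N (leqnn _)) _; rewrite gtr_pMr// invf_lt1// ltr1n.
Qed.

Lemma completion_complete (F : set_system completion) :
  ProperFilter F -> cauchy F -> cvg F.
Proof.
move=> FF /cauchyP Fc.
have k0 (k : nat) : 0 < k.+1%:R^-1 :> R by rewrite invr_gt0.
have /choice[y yP] : forall k : nat, exists y : Y,
    F (ball (completion_in y) (k.+1%:R^-1 + k.+1%:R^-1)).
  move=> k; have [x Fx] := Fc _ (k0 k).
  have [|z0 [xO [y _ yx]]] := completion_in_dense (O := ball x k.+1%:R^-1) _
    (ball_open x _).
    by exists x; exact: ballxx.
  exists y; apply: filterS Fx => z xz; apply: ball_triangle xz.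
  by rewrite yx; exact: ball_sym.
have near0 e : 0 < e -> exists N, forall k, (N <= k)%N ->
    k.+1%:R^-1 + k.+1%:R^-1 < e :> R.
  move=> e0; have e20 : 0 < e / 2 by rewrite divr_gt0.
  have [N _ NP] := @near_infty_natSinv_lt R (PosNum e20).
  exists N => k Nk; rewrite (splitr e); have := NP k Nk => /= h.
  by rewrite ltrD.
have yc : y \in cauchy_pred.
  apply/mem_set/cauchy_seqP => e e0; have e20 : 0 < e / 2 by rewrite divr_gt0.
  have [N NP] := near0 _ e20; exists N => m n Nm Nn.
  have [z [z1 z2]] := filter_ex (filterI (yP m) (yP n)).
  have -> : `|y m - y n| = `|completion_in (y m) - completion_in (y n)|.
    by rewrite -linearB completion_in_norm.
  rewrite (splitr e); apply: le_lt_trans (ler_distD z _ _) _.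
  move: z1 z2; rewrite -!ball_normE /= => z1 z2.
  rewrite ltrD//; first exact: lt_trans z1 (NP m Nm).
  by rewrite distrC; exact: lt_trans z2 (NP n Nn).
pose u : cseq := exist _ y yc.
apply/cvg_ex; exists (kerpi cseq_pseudonorm u : completion).
apply/cvgrPdist_le => e e0; have e20 : 0 < e / 2 by rewrite divr_gt0.
have [N NP] := near0 _ e20; have [M MP] := completion_approx u e20.
pose k := maxn N M.
have Fk := yP k; apply: filterS Fk => z; rewrite -ball_normE /= => zk.
rewrite (splitr e); apply: le_trans (ler_distD (completion_in (y k)) _ _) _.
apply: lerD; first by apply: MP; exact: leq_maxr.
by apply/ltW/(lt_trans zk)/NP; exact: leq_maxl.
Qed.

HB.instance Definition _ := Uniform_isComplete.Build completion completion_complete.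

End completion.

Section subspaces.
Context {R : realType}.

Definition finite_dim (V : lmodType R) (A : set V) : Prop :=
  exists n (e : 'I_n -> V), A = range (fun a : 'I_n -> R => \sum_i a i *: e i).

Variable X : normedModType R.

Record fdsubspace := FdSubspace {
  fdsubspace_set :> set X ;
  fdsubspaceP : finite_dim fdsubspace_set }.

Definition fdsubspace_pred (F : fdsubspace) : {pred X} := mem (F : set X).

Lemma fdsubspace_submod F : submod_closed (fdsubspace_pred F).
Proof.
have [n [e eE]] := fdsubspaceP F.
split=> [|a u v]; rewrite /fdsubspace_pred.
  rewrite inE eE; exists (fun=> 0) => //.
  by rewrite big1// => i _; rewrite scale0r.
rewrite !inE eE => -[b _ <-] [c _ <-]; exists (fun i => a * b i + c i) => //.
rewrite scaler_sumr -big_split/=; apply: eq_bigr => i _.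
by rewrite scalerDl scalerA.
Qed.

HB.instance Definition _ F :=
  GRing.isSubmodClosed.Build R X (fdsubspace_pred F) (fdsubspace_submod F).

(* The subspace F as a normed space of its own. *)
Definition fdspace (F : fdsubspace) : Type := {x : X | x \in fdsubspace_pred F}.
HB.instance Definition _ F := SubType.on (fdspace F).
HB.instance Definition _ F := Choice.on (fdspace F).
HB.instance Definition _ F := [SubChoice_isSubLmodule of (fdspace F) by <:].

Section norm.
Variable F : fdsubspace.
Let nrm (x : fdspace F) : R := `|val x|.
Let nrmD x y : nrm (x + y) <= nrm x + nrm y. Proof. exact: ler_normD. Qed.
Let nrmZ a x : nrm (a *: x) = `|a| * nrm x. Proof. exact: normrZ. Qed.
Let nrm0 x : nrm x = 0 -> x = 0.
Proof. by move=> /normr0_eq0 x0; exact: val_inj. Qed.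
HB.instance Definition _ := Lmodule_isNormed.Build R (fdspace F) nrmD nrmZ nrm0.
End norm.

Lemma fdspace_normE F (x : fdspace F) : `|x| = `|val x|.
Proof. by []. Qed.

Lemma fdinc_subproof (E F : fdsubspace) (EF : E `<=` F) (x : fdspace E) :
  val x \in fdsubspace_pred F.
Proof. exact/mem_set/EF/set_mem/(valP x). Qed.

Definition fdinc (E F : fdsubspace) (EF : E `<=` F) (x : fdspace E) : fdspace F :=
  exist _ (val x) (fdinc_subproof EF x).

End subspaces.

Section fraisse.
Context {R : realType}.
Implicit Types (K : set (BM R)) (X : completeNormedModType R) (mu : codes R).

(* E is isometric to a subspace of X iff it embeds isometrically into X. *)
Definition Age (X : normedModType R) : set (BM R) :=
  [set E | Emb 0 (bmsp E) X !=set0].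

Definition Age_cl (X : normedModType R) : set (BM R) := closure (Age X).

Definition infinite_dimensional K : Prop :=
  forall n, exists E : BMn R n, K (existT _ n E).

Definition hereditary K : Prop :=
  forall F E, K F -> Emb 0 (bmsp E) (bmsp F) !=set0 -> K E.

Definition JEP K : Prop := forall F G, K F -> K G -> exists H, K H /\
  Emb 0 (bmsp F) (bmsp H) !=set0 /\ Emb 0 (bmsp G) (bmsp H) !=set0.

Definition GAP K : Prop := forall E (e : R), K E -> 0 < e ->
  exists (F : BM R) (phi : {linear bmsp E -> bmsp F}) (d : R),
    [/\ K F, Emb e (bmsp E) (bmsp F) phi, 0 < d &
    forall (G H : BM R) (psiG : {linear bmsp F -> bmsp G})
        (psiH : {linear bmsp F -> bmsp H}),
      K G -> K H -> Emb d (bmsp F) (bmsp G) psiG ->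
      Emb d (bmsp F) (bmsp H) psiH ->
    exists (L : BM R) (iG : {linear bmsp G -> bmsp L})
        (iH : {linear bmsp H -> bmsp L}),
      [/\ K L, Emb 0 (bmsp G) (bmsp L) iG, Emb 0 (bmsp H) (bmsp L) iH &
      opnorm (fun x => iG (psiG (phi x)) - iH (psiH (phi x))) < e]].

Definition guarded_fraisse_class K : Prop :=
  [/\ K !=set0, closed K, hereditary K, JEP K & GAP K].

Definition separable_space (T : topologicalType) : Prop :=
  exists2 D : set T, countable D & dense D.

Definition guarded_fraisse X : Prop := separable_space X /\
  forall (E : fdsubspace X) (e : R), 0 < e ->
  exists (d : R) (F : fdsubspace X) (EF : E `<=` F), 0 < d /\
    forall i i' : {linear fdspace F -> X},
      Emb d (fdspace F) X i -> Emb d (fdspace F) X i' ->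
    exists2 T : {linear X -> X}, Iso X T &
      opnorm (fun x : fdspace E => i' (fdinc EF x) - T (i (fdinc EF x))) < e.

(* The property that determines Flim(K) up to isometry. *)
Definition is_Flim K X : Prop := guarded_fraisse X /\ Age_cl X = K.

Definition Xcode mu : completeNormedModType R := completion (kerquot (real_ext mu)).

Definition Xcode_in mu (x : {poly R}) : Xcode mu :=
  completion_in (kerpi (real_ext mu) x).

Lemma Xcode_in_norm mu x : `|Xcode_in mu x| = real_ext mu x.
Proof. by rewrite completion_in_norm kerpi_norm. Qed.

Lemma Xcode_in_dense mu : dense (range (Xcode_in mu)).
Proof.
move=> O O0 oO; have [z [Oz [y _ yz]]] := completion_in_dense O0 oO.
have [x xy] := kerpi_surj y; exists z; split => //; exists x => //.
by rewrite /Xcode_in xy.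
Qed.

Definition Pinf : set (codes R) := [set mu | ~ finite_dim [set: Xcode mu]].

Definition Bnorms : set (codes R) :=
  Pinf `&` [set mu | forall x, real_ext mu x = 0 -> x = 0].

Definition sigma_class K : set (codes R) := [set mu | Age (Xcode mu) `<=` K].

Definition iso_codes (I : set (codes R)) mu : set (codes R) :=
  [set nu | I nu /\ isometric (Xcode nu) (Xcode mu)].

Definition nowhere_dense (T : topologicalType) (A : set T) : Prop :=
  interior (closure A) = set0.
Definition meager (T : topologicalType) (A : set T) : Prop :=
  exists F : nat -> set T, (forall n, nowhere_dense (F n)) /\ A = \bigcup_n F n.
Definition comeager (T : topologicalType) (A : set T) : Prop := meager (~` A).

Definition comeager_in (T : topologicalType) (A B : set T) : Prop :=
  @comeager (set_type A) (set_val @^-1` B).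

End fraisse.

(* Main.v *)
From HB Require Import structures.
Require Import Defs.
From mathcomp Require Import all_boot all_order all_algebra.
From mathcomp Require Import all_classical all_reals all_analysis.
From mathcomp Require Import ring lra.
Import Order.TTheory GRing.Theory Num.Theory.
Import numFieldNormedType.Exports.

Set Implicit Arguments.
Unset Strict Implicit.
Unset Printing Implicit Defensive.

Local Open Scope classical_set_scope.
Local Open Scope ring_scope.

(** A code is a pseudonorm on the finitely supported sequences, and two codes are
close iff they are close on an initial segment, the span of the first n unit
vectors. A pseudonorm has its quotient in K iff it is induced by a linear map
into a member of K (in_class). As K is closed and hereditary, this property
passes to limits (in_class_closed, in_class_compact), so Baire's theorem holds
for the codes of the spaces whose age lies in K (S_baire). If K is
infinite-dimensional, the codes that are norms are dense among them (realize),
and the three choices of I behave alike.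

From amalgamation to a comeager class. After a small perturbation, an initial
segment of a code is followed by the guard that the amalgamation property
provides for it (guards_dense). Any member of K that extends a guarded segment
almost isometrically can be amalgamated with a longer segment of the code, and
is therefore realized in a nearby code (guards_realize). Up to approximation
these are countably many requirements, hence comeagerly many codes are generic
(generic_comeager): every tuple of vectors has a guard, and every almost
isometric extension of the guard is realized almost isometrically, while the
tuple moves only a little. Between two spaces with this property, guarding in
one space and realizing in the other alternate; the errors are summable, and the
limit is a surjective isometry (back_and_forth). So all generic codes are codes
of the same space. Its age is dense in K, because all members of K are realized
almost isometrically, and back and forth between two embeddings of a guard shows
that it is guarded Fraisse (generic_Flim).

From a comeager class to amalgamation. Suppose that comeagerly many codes have a
copy in X, the space of a fixed code. A copy maps the first n unit vectors close
to one of countably many tuples of X; by Baire's theorem there is a tuple for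
which such codes are dense in a ball around some code, given by closeness on the
first m unit vectors (piece_somewhere_dense). The quotient of this longer
segment is the guard: any two almost isometric extensions of it are, up to a
small error, copied into X with the n vectors close to the same tuple, so the
span of the two copies amalgamates them approximately. By compactness some limit
of these amalgams contains both extensions isometrically (comeager_GAP). *)

(** * Finitely supported sequences and pseudonorms on them *)

Section coordinates.
Context {R : realType}.
Implicit Types (x y : {poly R}) (n : nat).

Definition l1 x : R := \sum_(i < size x) `|x`_i|.

Lemma l1E n x : (size x <= n)%N -> l1 x = \sum_(i < n) `|x`_i|.
Proof.
move=> xn; rewrite /l1 -(big_mkord xpredT (fun i => `|x`_i|)).
rewrite -[RHS](big_mkord xpredT (fun i => `|x`_i|)).
rewrite [RHS](big_cat_nat (leq0n (size x)) xn)/=.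
rewrite [X in _ = _ + X]big_nat_cond [X in _ = _ + X]big1 ?addr0// => i.
by move=> /andP[/andP[xi _] _]; rewrite nth_default// normr0.
Qed.

Lemma l1_ge0 x : 0 <= l1 x.
Proof. by apply: sumr_ge0. Qed.

Lemma l1D x y : l1 (x + y) <= l1 x + l1 y.
Proof.
pose n := maxn (size x) (size y).
rewrite (@l1E n) ?size_polyD// (@l1E n x) ?leq_maxl// (@l1E n y) ?leq_maxr//.
by rewrite -big_split/=; apply: ler_sum => i _; rewrite coefD ler_normD.
Qed.

Lemma l1Z a x : l1 (a *: x) = `|a| * l1 x.
Proof.
rewrite (@l1E (size x)) ?size_scale_leq// mulr_sumr.
by apply: eq_bigr => i _; rewrite coefZ normrM.
Qed.

Lemma l1N x : l1 (- x) = l1 x.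
Proof. by rewrite -scaleN1r l1Z normrN1 mul1r. Qed.

Lemma l1X i : l1 'X^i = 1.
Proof.
rewrite /l1 size_polyXn big_ord_recr/= coefXn eqxx normr1 big1 ?add0r//.
by move=> j _; rewrite coefXn ltn_eqF// normr0.
Qed.

Lemma l1_take n x : l1 (take_poly n x) <= l1 x.
Proof.
rewrite (@l1E (maxn n (size x))) ?(leq_trans (size_take_poly _ _)) ?leq_maxl//.
rewrite (@l1E (maxn n (size x)) x) ?leq_maxr//; apply: ler_sum => i _.
by rewrite coef_take_poly; case: ifP => // _; rewrite normr0.
Qed.

Lemma poly_sumX n x : (size x <= n)%N -> x = \sum_(i < n) x`_i *: 'X^i.
Proof.
move=> xn; apply/polyP => i; rewrite -(poly_def n (fun i => x`_i)) coef_poly.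
by case: ltnP => // /(leq_trans xn) xi; rewrite nth_default.
Qed.

Lemma linear_sumX (V : lmodType R) (T : {linear {poly R} -> V}) n x :
  (size x <= n)%N -> T x = \sum_(i < n) x`_i *: T 'X^i.
Proof.
move=> xn; rewrite {1}(poly_sumX xn) linear_sum.
by apply: eq_bigr => i _; rewrite linearZ.
Qed.

Definition linX (V : lmodType R) (u : nat -> V) x : V :=
  \sum_(i < size x) x`_i *: u i.

Lemma linXE (V : lmodType R) (u : nat -> V) n x : (size x <= n)%N ->
  linX u x = \sum_(i < n) x`_i *: u i.
Proof.
move=> xn; rewrite /linX -(big_mkord xpredT (fun i => x`_i *: u i)).
rewrite -[RHS](big_mkord xpredT (fun i => x`_i *: u i)).
rewrite [RHS](big_cat_nat (leq0n (size x)) xn)/=.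
rewrite [X in _ = _ + X]big_nat_cond [X in _ = _ + X]big1 ?addr0// => i.
by move=> /andP[/andP[xi _] _]; rewrite nth_default// scale0r.
Qed.

Lemma linX_linear (V : lmodType R) (u : nat -> V) : linear (linX u).
Proof.
move=> a x y; pose n := maxn (size x) (size y).
rewrite (@linXE _ _ n) ?(leq_trans (size_polyD _ _)) ?geq_max ?leq_maxr//; last first.
  by rewrite andbT (leq_trans (size_scale_leq _ _)) ?leq_maxl.
rewrite (@linXE _ _ n x) ?leq_maxl// (@linXE _ _ n y) ?leq_maxr//.
rewrite scaler_sumr -big_split/=; apply: eq_bigr => i _.
by rewrite coefD coefZ scalerDl scalerA.
Qed.

HB.instance Definition _ (V : lmodType R) (u : nat -> V) :=
  GRing.isLinear.Build R {poly R} V _ (linX u) (linX_linear u).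

Lemma linXX (V : lmodType R) (u : nat -> V) i : linX u 'X^i = u i.
Proof.
rewrite /linX size_polyXn big_ord_recr/= coefXn eqxx scale1r big1 ?add0r//.
by move=> j _; rewrite coefXn ltn_eqF// scale0r.
Qed.

Definition pull_pn (V W : lmodType R) (p : pseudonorm W) (T : {linear V -> W}) :
  pseudonorm V.
Proof.
by exists (p \o T) => [x y|a x] /=;
  rewrite (linearD, linearZ) (pseudonorm_triangle, pseudonorm_scale).
Defined.

Definition norm_pn (V : lmodType R) (Z : normedModType R) (T : {linear V -> Z}) :
  pseudonorm V.
Proof.
by exists (fun v : V => `|T v|) => [x y|a x] /=;
  rewrite (linearD, linearZ) (ler_normD, normrZ).
Defined.

Lemma pn_sum (V : lmodType R) (p : pseudonorm V) (I : Type) (s : seq I) (F : I -> V) :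
  p (\sum_(i <- s) F i) <= \sum_(i <- s) p (F i).
Proof.
elim: s => [|i s IH]; first by rewrite !big_nil pn0.
rewrite !big_cons; apply: le_trans (pseudonorm_triangle _ _ _) _.
by rewrite lerD2l.
Qed.

Lemma pn_dist (V : lmodType R) (p : pseudonorm V) (x y : V) : `|p x - p y| <= p (x - y).
Proof.
rewrite ler_norml; apply/andP; split.
  rewrite lerNl opprB lerBlDr -(pnN p (x - y)) opprB addrC.
  by apply: le_trans _ (pseudonorm_triangle _ _ _); rewrite addrC subrK.
by rewrite lerBlDr; apply: le_trans _ (pseudonorm_triangle _ _ _); rewrite subrK.
Qed.

Lemma pn_le_l1 (p : pseudonorm {poly R}) n M x : (size x <= n)%N ->
  (forall i, (i < n)%N -> p 'X^i <= M) -> p x <= M * l1 x.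
Proof.
move=> xn pM; rewrite {1}(poly_sumX xn); apply: le_trans (pn_sum _ _ _) _.
rewrite (l1E xn) mulr_sumr; apply: ler_sum => i _.
by rewrite pseudonorm_scale mulrC ler_wpM2r// pM.
Qed.

Lemma pn_bound (p : pseudonorm {poly R}) n : exists2 M, 0 < M &
  forall x, (size x <= n)%N -> p x <= M * l1 x.
Proof.
exists (1 + \sum_(i < n) p 'X^i).
  by rewrite ltr_pwDl// sumr_ge0// => i _; exact: pn_ge0.
move=> x xn; apply: pn_le_l1 xn _ => i i_n.
rewrite (bigD1 (Ordinal i_n))//= addrCA lerDl addr_ge0// sumr_ge0// => j _.
exact: pn_ge0.
Qed.

Lemma norm_le_l1 (Z : normedModType R) (T : {linear {poly R} -> Z}) n M x :
  (size x <= n)%N -> (forall i, (i < n)%N -> `|T 'X^i| <= M) ->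
  `|T x| <= M * l1 x.
Proof. exact: (@pn_le_l1 (norm_pn T)). Qed.

Lemma norm_bound (Z : normedModType R) (T : {linear {poly R} -> Z}) n :
  exists2 M, 0 < M & forall x, (size x <= n)%N -> `|T x| <= M * l1 x.
Proof. exact: (@pn_bound (norm_pn T)). Qed.

(** Unlike closeness up to a factor, closeness relative to the l1 norm is
meaningful for pseudonorms with different kernels. *)
Definition close_on n (d : R) (p q : {poly R} -> R) : Prop :=
  forall x, (size x <= n)%N -> `|p x - q x| <= d * l1 x.

Lemma close_sym n d p q : close_on n d p q -> close_on n d q p.
Proof. by move=> pq x xn; rewrite distrC pq. Qed.

Lemma close_trans n d e p q r :
  close_on n d p q -> close_on n e q r -> close_on n (d + e) p r.
Proof.
move=> pq qr x xn; rewrite mulrDl; apply: le_trans (ler_distD (q x) _ _) _.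
by rewrite lerD ?pq ?qr.
Qed.

Lemma close_weak n m d e p q : (m <= n)%N -> d <= e ->
  close_on n d p q -> close_on m e p q.
Proof.
move=> mn de pq x xm; apply: le_trans (pq x (leq_trans xm mn)) _.
by rewrite ler_wpM2r ?l1_ge0.
Qed.

Lemma close_refl n d p : 0 <= d -> close_on n d p p.
Proof. by move=> d0 x _; rewrite subrr normr0 mulr_ge0 ?l1_ge0. Qed.

Lemma close_on0 d (p q : pseudonorm {poly R}) : close_on 0 d p q.
Proof.
move=> x; rewrite leqn0 size_poly_eq0 => /eqP ->.
by rewrite !pn0 subrr normr0 /l1 size_poly0 big_ord0 mulr0.
Qed.

Lemma close_norm (Z : normedModType R) (S T : {linear {poly R} -> Z}) n d :
  (forall i, (i < n)%N -> `|S 'X^i - T 'X^i| <= d) ->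
  close_on n d (fun x => `|S x|) (fun x => `|T x|).
Proof.
move=> ST x xn; apply: le_trans (ler_dist_dist _ _) _.
exact: (@norm_le_l1 _ (S \- T)) xn _.
Qed.

End coordinates.

(** * Finite-dimensional quotients *)

Section factorization.
Context {R : realType}.
Implicit Types (n : nat).

Lemma take_polyS n (x : {poly R}) : take_poly n.+1 x = take_poly n x + x`_n *: 'X^n.
Proof.
apply/polyP => i; rewrite coefD coefZ coefXn !coef_take_poly ltnS leq_eqVlt.
have [->|i_n] := eqVneq i n; first by rewrite ltnn add0r mulr1.
by case: ifP; rewrite mulr0 addr0.
Qed.

(** Enlarging the initial segment by one unit vector either keeps the quotient
by the kernel of the pseudonorm or adds one dimension to it. *)
Lemma pn_basis (p : pseudonorm {poly R}) n :
  exists r (J : {linear 'rV[R]_r -> {poly R}}),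
    [/\ forall y, (size (J y) <= n)%N, forall y, p (J y) = 0 -> y = 0 &
        forall x : {poly R}, (size x <= n)%N -> exists y, p (x - J y) = 0].
Proof.
elim: n => [|n [r [J [Jn J0 JS]]]].
  exists 0%N, (\0 : {linear 'rV[R]_0 -> {poly R}}).
  split => [y|y _|x]; first by rewrite size_poly0.
    by apply/rowP => -[].
  by rewrite leqn0 size_poly_eq0 => /eqP ->; exists 0; rewrite subr0 pn0.
have [[y Xy]|Xn] := pselect (exists y, p ('X^n - J y) = 0).
  exists r, J; split => // [z|x xn]; first exact: leqW.
  have [z xz] := JS (take_poly n x) (size_take_poly _ _).
  exists (z + x`_n *: y); apply/eqP; rewrite eq_le pn_ge0 andbT.
  rewrite -{1}(take_poly_id xn) take_polyS linearD linearZ/= opprD addrACA.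
  rewrite -scalerBr; apply: le_trans (pseudonorm_triangle _ _ _) _.
  by rewrite xz add0r pseudonorm_scale Xy mulr0.
pose J' (y : 'rV[R]_(r + 1)) : {poly R} := J (lsubmx y) + rsubmx y 0 0 *: 'X^n.
have J'lin : linear J'.
  move=> a u v; rewrite /J' !linearP/= !mxE scalerDl scalerDr !scalerA.
  by rewrite addrACA.
pose J'L := GRing.isLinear.Build _ _ _ _ J' J'lin.
exists (r + 1)%N, (HB.pack_for {linear 'rV[R]_(r + 1) -> {poly R}} J' J'L); split => /= [y|y|x xn].
- rewrite (leq_trans (size_polyD _ _))// geq_max (leqW (Jn _))/=.
  by rewrite (leq_trans (size_scale_leq _ _))// size_polyXn.
- rewrite /J'; set c := rsubmx y 0 0; move=> y0.
  have c0 : c = 0.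
    apply/eqP/negPn/negP => c0; apply: Xn; exists (- c^-1 *: lsubmx y).
    rewrite linearZ/= scaleNr opprK.
    have -> : 'X^n + c^-1 *: J (lsubmx y) = c^-1 *: (J (lsubmx y) + c *: 'X^n).
      by rewrite scalerDr scalerA mulVf// scale1r addrC.
    by rewrite pseudonorm_scale y0 mulr0.
  have ly : lsubmx y = 0 by apply: J0; move: y0; rewrite c0 scale0r addr0.
  rewrite -(hsubmxK y) ly; apply/rowP => i; rewrite [RHS]mxE.
  rewrite mxE; case: splitP => j _; first by rewrite mxE.
  by rewrite (ord1 j) -/c c0.
have [z xz] := JS (take_poly n x) (size_take_poly _ _).
exists (row_mx z (x`_n)%:M); rewrite /J' row_mxKl row_mxKr mxE eqxx mulr1n.
by rewrite -{1}(take_poly_id xn) take_polyS opprD addrACA subrr addr0.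
Qed.

Definition bm_of r (N : rVnorm R r) : BM R := existT _ r (\pi_(BMn R r) N)%qT.

Lemma bm_ofP r (N : rVnorm R r) : isometric (fdsp N) (bmsp (bm_of N)).
Proof.
apply: isometric_sym; rewrite /bmsp /=.
by have /eqquotP/asboolP := reprK (\pi_(BMn R r) N)%qT.
Qed.

Lemma isometry_inverse (Y Z : normedModType R) (T : {linear Y -> Z}) :
  (forall y, `|T y| = `|y|) -> (forall z, exists y, T y = z) ->
  exists S : {linear Z -> Y}, [/\ forall z, `|S z| = `|z|, cancel T S & cancel S T].
Proof.
move=> TN TS.
have Tinj : injective T.
  move=> x y xy; apply/eqP; rewrite -subr_eq0 -normr_eq0 -TN linearB/= xy subrr.
  by rewrite normr0.
have [S TSK] := choice TS.
have Slin : linear S by move=> a u v; apply: Tinj; rewrite linearP !TSK.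
pose SL := GRing.isLinear.Build _ _ _ _ S Slin.
exists (HB.pack_for {linear Z -> Y} S SL); split => // [z|y]; first by rewrite /= -TN TSK.
by apply: Tinj; rewrite /= TSK.
Qed.

Lemma isometry_inv (Y Z : normedModType R) : isometric Y Z ->
  exists (T : {linear Y -> Z}) (S : {linear Z -> Y}),
    [/\ forall y, `|T y| = `|y|, forall z, `|S z| = `|z|, cancel T S & cancel S T].
Proof.
by move=> [T [TN /(isometry_inverse TN)[S [SN TK SK]]]]; exists T, S; split.
Qed.

Lemma l1_fdsp r (N : rVnorm R r) (J : {linear fdsp N -> {poly R}}) :
  exists2 c, 0 < c & forall y, l1 (J y) <= c * `|y|.
Proof.
have [c c0 Nc] := rVnorm_lower N.
have [x y|a x|C C0 lC] := @rVsemi_bound R r (fun y : 'rV[R]_r => l1 (J y)).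
- by rewrite (linearD J (x : fdsp N)) l1D.
- by rewrite (linearZ_LR J a (x : fdsp N)) l1Z.
exists (C * c) => [|y]; first exact: mulr_gt0.
by apply: le_trans (lC y) _; rewrite -mulrA ler_pM2l.
Qed.

(** Q is the quotient by the kernel of p, and J a linear section of it: with these
two maps no quotient space has to be formed. *)
Lemma pn_factor (p : pseudonorm {poly R}) n :
  exists (F : BM R) (J : {linear bmsp F -> {poly R}})
      (Q : {linear {poly R} -> bmsp F}),
    [/\ forall y, (size (J y) <= n)%N, forall y, p (J y) = `|y|,
        forall y, Q (J y) = y, forall x : {poly R}, (size x <= n)%N -> p x = `|Q x| &
        forall x : {poly R}, (size x <= n)%N -> p (x - J (Q x)) = 0].
Proof.
have [r [J [Jn J0 JS]]] := pn_basis p n.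
have ND x y : p (J (x + y)) <= p (J x) + p (J y).
  by rewrite linearD pseudonorm_triangle.
have NZ a x : p (J (a *: x)) = `|a| * p (J x).
  by rewrite linearZ pseudonorm_scale.
pose N : rVnorm R r := RVNorm ND NZ J0.
have [T [S [TN SN TK SK]]] := isometry_inv (bm_ofP N).
have JX i : exists y, (i < n)%N -> p ('X^i - J y) = 0.
  case: ltnP => // i_n; last by exists 0.
  by have [|y Xy] := JS 'X^i; [rewrite size_polyXn|exists y].
have [q qX] := choice JX.
pose J' : {linear fdsp N -> {poly R}} := J.
pose q' : nat -> fdsp N := q.
have Jq (x : {poly R}) : (size x <= n)%N -> p (x - J' (linX q' x)) = 0.
  move=> xn; apply/eqP; rewrite eq_le pn_ge0 andbT.
  rewrite (linXE _ xn) linear_sum {1}(poly_sumX xn) -sumrB.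
  apply: le_trans (pn_sum _ _ _) _; rewrite big1// => i _.
  by rewrite linearZ/= -scalerBr pseudonorm_scale qX ?mulr0.
have eqp (x y : {poly R}) : p (x - y) = 0 -> p x = p y.
  move=> xy; have := pn_dist p x y.
  by rewrite xy normr_le0 subr_eq0 => /eqP.
exists (bm_of N), (J' \o S), (T \o linX q'); split => [y|y|y|x xn|x xn] /=.
- exact: Jn.
- by rewrite -SN.
- rewrite -[RHS]SK; congr (T _); apply/eqP; rewrite -subr_eq0; apply/eqP/J0.
  rewrite -[LHS]/(p (J' _)) linearB/= -pnN opprB; exact/Jq/Jn.
- by rewrite TN; apply: eqp; exact: Jq.
by rewrite TK; exact: Jq.
Qed.

(** The linear section of the quotient map gives every vector of a
finite-dimensional space coordinates that are bounded by its norm. *)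
Lemma bounded_lift (Z : normedModType R) (T : {linear {poly R} -> Z}) n :
  exists2 c, 0 < c & forall x : {poly R}, (size x <= n)%N ->
    exists x' : {poly R}, [/\ (size x' <= n)%N, T x' = T x & l1 x' <= c * `|T x|].
Proof.
have [F [J [Q [Jn pJ QJ pQ xJQ]]]] := pn_factor (norm_pn T) n.
have [c c0 lJ] := l1_fdsp J; exists c => // x xn; exists (J (Q x)); split => //.
  apply/esym/eqP; rewrite -subr_eq0 -linearB -normr_eq0; exact/eqP/xJQ.
by apply: le_trans (lJ _) _; rewrite -pQ.
Qed.

(** The spaces of BM are carried by row vectors, so that coordinates identify
them with initial segments of the space of finitely supported sequences. *)
Definition bm_coord (E : BM R) : {linear {poly R} -> bmsp E} :=
  [the {linear {poly R} -> 'rV[R]_(projT1 E)} of poly_rV].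

Definition bm_vec (E : BM R) : {linear bmsp E -> {poly R}} :=
  [the {linear 'rV[R]_(projT1 E) -> {poly R}} of rVpoly].

Lemma bm_vecK E : cancel (@bm_vec E) (@bm_coord E).
Proof. exact: rVpolyK. Qed.

Lemma size_bm_vec E (y : bmsp E) : (size (bm_vec E y) <= projT1 E)%N.
Proof. exact: size_poly. Qed.

End factorization.

Section embeddings.
Context {R : realType}.

Lemma Emb0P (Y Z : normedModType R) (T : {linear Y -> Z}) :
  Emb 0 Y Z T <-> forall y, `|T y| = `|y|.
Proof.
rewrite /Emb /= oppr0 expR0; split => TN y; last by rewrite TN mul1r.
by have [] := TN y; rewrite mul1r => h1 h2; apply/eqP; rewrite eq_le h1 h2.
Qed.

Lemma Emb_near (C : R) (Y Z : normedModType R) (T : {linear Y -> Z}) : 0 <= C ->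
  (forall y, `| `|T y| - `|y| | <= (1 - expR (- C)) * `|y|) -> Emb C Y Z T.
Proof.
move=> C0 Ty y; have := Ty y; rewrite ler_norml => /andP[h1 h2].
split; first lra.
have : 2 - expR (- C) <= expR C.
  have := expR_ge1Dx C; have := expR_gt0 C; have eC := expRxMexpNx_1 C => e0 e1.
  nra.
by move=> h3; have := normr_ge0 y; nra.
Qed.

Lemma Emb_dist (C : R) (Y Z : normedModType R) (T : {linear Y -> Z}) y :
  0 <= C -> Emb C Y Z T -> `| `|T y| - `|y| | <= (expR C - 1) * `|y|.
Proof.
move=> C0 /(_ y)[h1 h2]; rewrite ler_norml; apply/andP; split; last lra.
have : 2 - expR C <= expR (- C).
  have := expR_ge1Dx C; have := expR_gt0 C; have eC := expRxMexpNx_1 C => e0 e1.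
  by have := expR_gt0 (- C); nra.
by have := normr_ge0 y; nra.
Qed.

(** A norm that is transported by an almost isometric map is close to the norm
one starts with in the Banach-Mazur distance. *)
Lemma closure_approx (A : set (BM R)) (E : BM R) :
  (forall d, 0 < d -> exists (Z : normedModType R) (f : {linear bmsp E -> Z}),
     (forall E', Emb 0 (bmsp E') Z !=set0 -> A E') /\
     forall y, `| `|f y| - `|y| | <= d * `|y|) -> closure A E.
Proof.
case: E => r e H B; rewrite /nbhs/= /sigT_nbhs/= => /nbhs_ballP[e0 /= e00 eB].
pose d := Num.min (2^-1) (e0 / 8).
have d0 : 0 < d by rewrite lt_min invr_gt0 ltr0n/= divr_gt0.
have d1 : d <= 2^-1 by rewrite ge_min lexx.
have d2 : d <= e0 / 8 by rewrite ge_min lexx orbT.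
(* The choice of d makes the distortion (1 + d) / (1 - d) less than exp e0. *)
have [Z [f [fA fN]]] := H d d0.
pose E : BM R := existT _ r e; pose f' : {linear bmsp E -> Z} := f.
have fl (y : bmsp E) : (1 - d) * `|y| <= `|f' y| /\ `|f' y| <= (1 + d) * `|y|.
  by have := fN y; rewrite ler_norml => /andP[h1 h2]; split; lra.
have MD (x y : 'rV[R]_r) : `|f' ((x + y) : bmsp E)| <= `|f' (x : bmsp E)| + `|f' (y : bmsp E)|.
  by rewrite (linearD f' (x : bmsp E)) ler_normD.
have MZ a (x : 'rV[R]_r) : `|f' ((a *: x) : bmsp E)| = `|a| * `|f' (x : bmsp E)|.
  by rewrite (linearZ_LR f' a (x : bmsp E)) normrZ.
have M0 (x : 'rV[R]_r) : `|f' (x : bmsp E)| = 0 -> x = 0.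
  move=> x0; have [+ _] := fl x; rewrite x0 => h.
  by apply: (@normr0_eq0 _ (bmsp E)); have := normr_ge0 (x : bmsp E); nra.
pose M : rVnorm R r := RVNorm MD MZ M0.
have [T [S [TN SN TK SK]]] := isometry_inv (bm_ofP M).
exists (bm_of M); split.
  apply: fA; exists (f' \o [the {linear 'rV[R]_r -> 'rV[R]_r} of idfun] \o S).
  by apply/Emb0P => y /=; rewrite -SN.
apply: eB; rewrite ballEmdist /=.
rewrite /mdist /=.
pose I1 : {linear bmsp E -> fdsp M} := [the {linear 'rV[R]_r -> 'rV[R]_r} of idfun].
pose I2 : {linear fdsp M -> bmsp E} := [the {linear 'rV[R]_r -> 'rV[R]_r} of idfun].
pose TT : {linear bmsp E -> bmsp (bm_of M)} := T \o I1.
pose SS : {linear bmsp (bm_of M) -> bmsp E} := I2 \o S.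
have TTK : cancel TT SS by move=> y; rewrite /TT /SS /= TK.
have SSK : cancel SS TT by move=> y; rewrite /TT /SS /= SK.
have oT : opnorm TT <= 1 + d.
  apply: opnorm_le => [|y]; first lra.
  by rewrite /TT /= TN; have [_] := fl y.
have oS : opnorm SS <= (1 - d)^-1.
  apply: opnorm_le => [|y]; first by rewrite invr_ge0; lra.
  rewrite ler_pdivlMl; last lra.
  have [+ _] := fl (SS y); move/le_trans; apply.
  by rewrite -SN.
apply: le_lt_trans (dBM_le TTK SSK) _.
have [->|TS0] := eqVneq (opnorm TT * opnorm SS) 0; first by rewrite ln0.
have TS : 0 < opnorm TT * opnorm SS.
  by rewrite lt_neqAle eq_sym TS0 mulr_ge0// opnorm_ge0.
rewrite -(expRK e0) ltr_ln ?posrE ?expR_gt0//.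
apply: le_lt_trans (ler_pM (opnorm_ge0 _) (opnorm_ge0 _) oT oS) _.
rewrite ltr_pdivrMr; last lra.
have := expR_ge1Dx e0; nra.
Qed.


End embeddings.

(** * Pseudonorms whose quotients belong to a class of spaces *)

Section class_pseudonorms.
Context {R : realType} (K : set (BM R)).
Implicit Types (p q : {poly R} -> R) (n : nat).

(** The quotient of a pseudonormed space by the kernel belongs to a hereditary
class iff the pseudonorm is induced by a linear map into a member; in this form
no quotient and no choice of a dimension is needed. *)
Definition in_class (V : lmodType R) (p : V -> R) : Prop :=
  exists H, K H /\ exists T : {linear V -> bmsp H}, forall x, p x = `|T x|.

Lemma in_class_norm (V : lmodType R) H (T : {linear V -> bmsp H}) : K H ->
  in_class (fun x => `|T x|).
Proof. by move=> KH; exists H; split => //; exists T. Qed.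

Lemma in_class_comp (V W : lmodType R) (p : W -> R) (S : {linear V -> W}) :
  in_class p -> in_class (p \o S).
Proof.
by move=> [H [KH [T pT]]]; exists H; split => //; exists (T \o S) => x /=.
Qed.

Lemma in_class_ext (V : lmodType R) (p q : V -> R) : p =1 q ->
  in_class p -> in_class q.
Proof.
by move=> pq [H [KH [T pT]]]; exists H; split => //; exists T => x; rewrite -pq.
Qed.

Definition take_lin n : {linear {poly R} -> {poly R}} :=
  [the {linear {poly R} -> {poly R}} of take_poly n].

Lemma pn_factor_class (p : pseudonorm {poly R}) n : hereditary K ->
  in_class (p \o take_poly n) ->
  exists (F : BM R) (J : {linear bmsp F -> {poly R}})
      (Q : {linear {poly R} -> bmsp F}),
    [/\ K F, forall y, (size (J y) <= n)%N, forall y, Q (J y) = y &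
        forall x : {poly R}, (size x <= n)%N -> p x = `|Q x|].
Proof.
move=> hK [H [KH [T pT]]]; have [F [J [Q [Jn pJ QJ pQ _]]]] := pn_factor p n.
exists F, J, Q; split => //; apply: hK KH _; exists (T \o J).
apply/Emb0P => y /=; rewrite -pT /= take_poly_id ?pJ//.
Qed.

(** The limit may have a larger kernel than its approximations. On a complement
of that kernel the limit is a norm, which the approximations distort by a
factor close to 1, so their quotients converge in the Banach-Mazur distance. *)
Lemma in_class_closed (p : pseudonorm {poly R}) n : hereditary K -> closed K ->
  (forall d, 0 < d -> exists2 q, in_class q & close_on n d p q) ->
  in_class (p \o take_poly n).
Proof.
move=> hK cK pq; have [F [J [Q [Jn pJ QJ pQ xJQ]]]] := pn_factor p n.
exists F; split; last first.
  by exists (Q \o take_lin n) => x /=; rewrite pQ// size_take_poly.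
have [c c0 lJ] := l1_fdsp J.
apply: cK; apply: closure_approx => d d0.
have dc : 0 < d / c by rewrite divr_gt0.
have [q [H [KH [T qT]]] pqd] := pq _ dc.
exists (bmsp H), (T \o J); split => [E'|y] /=; first exact: hK.
rewrite distrC -pJ -qT; apply: le_trans (pqd _ (Jn y)) _.
by rewrite pJ -mulrA ler_pM2l// mulrC ler_pdivrMr// mulrC.
Qed.

End class_pseudonorms.

Section compactness.
Context {R : realType}.
Implicit Types (p q : pseudonorm {poly R}) (n : nat).

(** On a bounded family of pseudonorms, closeness on an initial segment is
controlled by finitely many rational vectors: pseudonorms are Lipschitz, so it
suffices to take a fine grid in the unit ball. *)
Lemma grid_control n (M d : R) : 0 <= M -> 0 < d ->
  exists (m : nat) (e : R) (g : 'I_m -> {poly rat}), 0 < e /\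
    forall p q, (forall i, (i < n)%N -> p 'X^i <= M) ->
      (forall j, `|p (rat_inc R (g j)) - q (rat_inc R (g j))| <= e) ->
      close_on n d p q.
Proof.
move=> M0 d0.
(* On the grid of mesh 1 / (k + 1) the values differ by at most e; moving to the
   grid changes p by at most M n / (k + 1) and q by at most (M + 1) n / (k + 1). *)
pose e := Num.min 1 (d / 2).
have e0 : 0 < e by rewrite lt_min ltr01 divr_gt0.
have e1 : e <= 1 by rewrite ge_min lexx.
have e2 : e <= d / 2 by rewrite ge_min lexx orbT.
have [k kP] : exists k : nat, (2 * M + 1) * n%:R <= (d / 2) * k.+1%:R.
  have /archi_boundP : 0 <= (2 * M + 1) * n%:R / (d / 2).
    by rewrite divr_ge0// ?mulr_ge0// ?addr_ge0 ?mulr_ge0 ?divr_ge0// ltW.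
  set b := Num.bound _ => bP; exists b.
  rewrite [leRHS]mulrC -ler_pdivrMr ?divr_gt0//.
  by apply/ltW/(lt_le_trans bP); rewrite ler_nat.
pose I : finType := ({ffun 'I_n -> 'I_(2 * k.+1).+1} + 'I_n)%type.
pose G (s : I) : {poly rat} := match s with
  | inl f => \poly_(i < n)
      (if insub i is Some j then ((f j)%:R - k.+1%:R) / k.+1%:R else 0)
  | inr i => 'X^i end.
exists #|I|, e, (G \o enum_val); split => // p q pM pqe x xn.
have {}pqe s : `|p (rat_inc R (G s)) - q (rat_inc R (G s))| <= e.
  by have := pqe (enum_rank s); rewrite /= enum_rankK.
have qM i : (i < n)%N -> q 'X^i <= M + 1.
  move=> i_n; have := pqe (inr (Ordinal i_n)); rewrite /= /rat_inc map_polyXn.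
  by rewrite ler_norml => /andP[h _]; have := pM i i_n; lra.
have [x0|x0] := eqVneq (l1 x) 0.
  have px : p x = 0.
    apply/eqP; rewrite eq_le pn_ge0 andbT.
    by apply: le_trans (pn_le_l1 xn pM) _; rewrite x0 mulr0.
  have qx : q x = 0.
    apply/eqP; rewrite eq_le pn_ge0 andbT.
    by apply: le_trans (pn_le_l1 xn qM) _; rewrite x0 mulr0.
  by rewrite px qx subrr normr0 x0 mulr0.
have l0 : 0 < l1 x by rewrite lt_neqAle eq_sym x0 l1_ge0.
wlog x1 : x xn x0 l0 / l1 x = 1 => [H|].
  pose y := (l1 x)^-1 *: x.
  have y1 : l1 y = 1 by rewrite l1Z normfV gtr0_norm// mulVf.
  have yn : (size y <= n)%N by apply: leq_trans (size_scale_leq _ _) xn.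
  have := H y yn; rewrite y1 mulr1 oner_eq0 ltr01 => /(_ isT isT erefl).
  rewrite !pseudonorm_scale -mulrBr normrM normr_id normfV (gtr0_norm l0).
  by rewrite ler_pdivrMl// mulrC.
have xi i : `|x`_i| <= 1.
  case: (ltnP i n) => i_n; last by rewrite nth_default ?normr0// (leq_trans xn).
  rewrite -x1 (l1E xn) (bigD1 (Ordinal i_n))//= lerDl.
  by apply: sumr_ge0.
have k0 : 0 < k.+1%:R :> R by rewrite ltr0n.
have fl0 (i : 'I_n) : 0 <= (x`_i + 1) * k.+1%:R.
  by rewrite mulr_ge0// -lerBlDr sub0r; have := xi i; rewrite ler_norml => /andP[].
have fP (i : 'I_n) : (Num.truncn ((x`_i + 1) * k.+1%:R) < (2 * k.+1).+1)%N.
  rewrite ltnS -(ler_nat R) natrM.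
  apply: (@le_trans _ _ ((x`_i + 1) * k.+1%:R)); first by rewrite truncn_le.
  by rewrite ler_pM2r//; have := xi i; rewrite ler_norml => /andP[_]; lra.
pose f : {ffun 'I_n -> 'I_(2 * k.+1).+1} := [ffun i => Ordinal (fP i)].
pose v := rat_inc R (G (inl f)).
have vn : (size v <= n)%N.
  by apply: leq_trans (size_poly _ _) _; exact: size_poly.
have xv : l1 (x - v) <= n%:R / k.+1%:R.
  rewrite (@l1E _ n); last by rewrite (leq_trans (size_polyD _ _))// geq_max xn size_polyN.
  have -> : n%:R / k.+1%:R = \sum_(i < n) k.+1%:R^-1 :> R.
    by rewrite sumr_const card_ord mulr_natl.
  apply: ler_sum => i _; rewrite coefB coef_map/= coef_poly ltn_ord valK ffunE/=.
  rewrite fmorph_div/= rmorphB/= !ratr_nat.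
  have /andP[h1 h2] := truncn_itv (fl0 i).
  set t := (Num.truncn _)%:R in h1 *.
  have {}h2 : (x`_i + 1) * k.+1%:R <= t + 1 by rewrite /t natr1 ltW.
  have -> : x`_i - (t - k.+1%:R) / k.+1%:R = ((x`_i + 1) * k.+1%:R - t) / k.+1%:R.
    by field; rewrite gt_eqF.
  rewrite normrM [X in _ * X]ger0_norm ?invr_ge0 ?(ltW k0)// ler_piMl ?invr_ge0 ?(ltW k0)//.
  by rewrite ger0_norm ?subr_ge0// lerBlDl.
have xvn : (size (x - v)%R <= n)%N.
  by rewrite (leq_trans (size_polyD _ _))// geq_max xn size_polyN.
rewrite x1 mulr1.
have -> : p x - q x = (p x - p v) + (p v - q v) + (q v - q x) by ring.
apply: le_trans (ler_normD _ _) _; apply: le_trans (lerD (ler_normD _ _) (lexx _)) _.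
rewrite [`|q v - _|]distrC.
have := le_trans (pn_dist p x v) (pn_le_l1 xvn pM).
have := le_trans (pn_dist q x v) (pn_le_l1 xvn qM).
have := pqe (inl f); rewrite -/v.
have := l1_ge0 (x - v).
move: xv; rewrite ler_pdivlMr//.
set a := `|_|; set b := `|_|; set c := `|_|; set l := l1 _ => h1 h2 h3 h4 h5.
suff : (2 * M + 1) * l <= d / 2 by nra.
rewrite -(ler_pM2r k0); apply: le_trans _ kP; rewrite -mulrA ler_wpM2l//.
by lra.
Qed.


Lemma ultra_lim (U : set_system nat) (M : R) (u : nat -> R) : UltraFilter U ->
  (forall k, `|u k| <= M) -> exists l : R, u k @[k --> U] --> l.
Proof.
move=> UU uM; have := @segment_compact R (- M) M; rewrite compact_ultra => H.
have uU : (u @ U) `[- M, M]%classic.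
  by apply: (@filterS _ U _ setT) filterT => k _ /=; rewrite in_itv/= -ler_norml.
have UF : UltraFilter (u @ U).
  split=> [|G GF UG]; first exact: fmap_proper_filter.
  apply/seteqP; split => // B GB.
  have [//|nB] := in_ultra_setVsetC (u @^-1` B) UU.
  have : G (~` B `&` B) by apply: filterI => //; exact: UG.
  by rewrite setIC setICr => /filter_not_empty.
by have [l [_ ul]] := H (u @ U) UF uU; exists l.
Qed.

(** Compactness: bounded sequences of pseudonorms converge along an ultrafilter,
and the class of the quotients passes to the limit. *)
Lemma in_class_compact (K : set (BM R)) n (M : R) (q : nat -> pseudonorm {poly R}) :
  hereditary K -> closed K -> 0 <= M ->
  (forall k i, (i < n)%N -> q k 'X^i <= M) ->
  (forall k, in_class K (q k \o take_poly n)) ->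
  exists H (T : {linear {poly R} -> bmsp H}), K H /\
    forall d N, 0 < d -> exists2 k, (N <= k)%N & close_on n d (q k) (fun x => `|T x|).
Proof.
move=> hK cK M0 qM qK.
have [U [UU ooU]] := @ultraFilterLemma nat \oo _.
have qb x k : `|q k (take_poly n x)| <= M * l1 x.
  rewrite ger0_norm ?pn_ge0//.
  apply: le_trans (pn_le_l1 (size_take_poly _ _) (qM k)) _.
  by rewrite ler_wpM2l// l1_take.
have [p0 p0P] := choice (fun x => ultra_lim UU (qb x)).
have p0D x y : p0 (x + y) <= p0 x + p0 y.
  apply: (ler_cvg_to (p0P (x + y)) (cvgD (p0P x) (p0P y))).
  by apply: nearW => k; rewrite linearD; exact: pseudonorm_triangle.
have p0Z a x : p0 (a *: x) = `|a| * p0 x.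
  apply/esym; apply: (cvg_unique _ _ (p0P (a *: x))) => //.
  have -> : (fun k => q k (take_poly n (a *: x))) = (fun k => `|a| * q k (take_poly n x)).
    by apply/funext => k; rewrite linearZ pseudonorm_scale.
  by apply: cvgM; [exact: cvg_cst|exact: p0P].
pose p : pseudonorm {poly R} := Pseudonorm p0D p0Z.
have pM i : (i < n)%N -> p 'X^i <= M.
  move=> i_n; apply: (cvgr_to_le (p0P 'X^i)); apply: nearW => k.
  rewrite take_poly_id ?size_polyXn//; exact: qM.
have pq d N : 0 < d -> exists2 k, (N <= k)%N & close_on n d (q k) p.
  move=> d0; have [m [e [g [e0 ge]]]] := grid_control n M0 d0.
  have near1 j : U [set k | `|p (rat_inc R (g j)) - q k (take_poly n (rat_inc R (g j)))| <= e].
    have /cvgrPdist_le := p0P (rat_inc R (g j)); exact.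
  have U1 : U [set k | forall j, `|p (rat_inc R (g j)) - q k (take_poly n (rat_inc R (g j)))| <= e].
    exact: filter_forall.
  have U2 : U [set k | (N <= k)%N] by apply: ooU; exists N.
  have [k [k1 k2]] := filter_ex (filterI U1 U2); exists k => //.
  apply: close_sym; have := ge p (pull_pn (q k) (take_lin n)) pM k1.
  by move=> h x xn; have := h x xn; rewrite /= take_poly_id.
have [H [KH [T pT]]] : in_class K (p \o take_poly n).
  apply: in_class_closed => // d d0; have [k _ kq] := pq d 0%N d0.
  exists (q k \o take_poly n) => // x xn /=; rewrite take_poly_id// distrC.
  exact: kq.
exists H, T; split => // d N d0; have [k Nk kp] := pq d N d0; exists k => // x xn.
by rewrite -pT /= take_poly_id// kp.
Qed.

(** Rounding the values on a fine grid gives countably many cells. *)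
Lemma in_class_separable (K : set (BM R)) : K !=set0 ->
  exists (G : nat -> BM R) (T : forall j, {linear {poly R} -> bmsp (G j)}),
    (forall j, K (G j)) /\ forall (p : pseudonorm {poly R}) n d, 0 < d -> in_class K p ->
    exists j, close_on n d p (fun x => `|T j x|).
Proof.
move=> [H0 KH0].
pose HT := {H : BM R & {linear {poly R} -> bmsp H}}.
pose T0 : {linear {poly R} -> bmsp H0} := \0.
pose HT0 : HT := existT _ H0 T0.
pose nm (h : HT) : pseudonorm {poly R} := norm_pn (projT2 h).
have cell (t : nat * nat * nat) : exists f : seq nat -> HT,
    (forall s, K (projT1 (f s))) /\
    forall p : pseudonorm {poly R}, in_class K p ->
      (forall i, (i < t.1.1)%N -> p 'X^i <= t.1.2%:R) ->
      exists s, close_on t.1.1 t.2.+1%:R^-1 p (nm (f s)).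
  case: t => [[n M] k] /=.
  have k0 : 0 < k.+1%:R^-1 :> R by rewrite invr_gt0.
  have [m [e [g [e0 ge]]]] := grid_control n (ler0n R M) k0.
  pose code (p : pseudonorm {poly R}) :=
    [seq Num.truncn (p (rat_inc R (g j)) / e) | j <- enum 'I_m].
  have /choice[f fP] (s : seq nat) : exists h : HT, K (projT1 h) /\
      ((exists h', K (projT1 h') /\ code (nm h') = s) -> code (nm h) = s).
    have [[h [Kh hs]]|] := pselect (exists h', K (projT1 h') /\ code (nm h') = s).
      by exists h.
    by move=> no; exists HT0; split.
  exists f; split => [s|p [H [KH [T pT]]] pM]; first by have [] := fP s.
  exists (code p); have [_ cfP] := fP (code p).
  have cT : code p = code (nm (existT _ H T)).
    by apply: eq_map => j; rewrite pT.
  have cf : code (nm (f (code p))) = code p.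
    by apply: cfP; exists (existT _ H T).
  apply: (ge p (nm (f (code p))) pM) => j.
  have : Num.truncn (p (rat_inc R (g j)) / e) =
         Num.truncn (nm (f (code p)) (rat_inc R (g j)) / e).
    by move/eq_in_map : cf => /(_ j); rewrite mem_enum => ->.
  have h0 (q : pseudonorm {poly R}) : 0 <= q (rat_inc R (g j)) / e.
    by rewrite divr_ge0 ?pn_ge0 ?ltW.
  have /andP[a1 a2] := truncn_itv (h0 p).
  have /andP[b1 b2] := truncn_itv (h0 (nm (f (code p)))).
  move=> tt; rewrite tt in a1 a2; move: a1 a2 b1 b2.
  set t := Num.truncn _; rewrite -(natr1 t).
  rewrite !ler_pdivlMr// !ltr_pdivrMr// => a1 a2 b1 b2.
  by rewrite ler_norml; apply/andP; split; nra.
have [F FP] := choice cell.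
pose I : countType := (nat * nat * nat * seq nat)%type.
pose h (j : nat) : HT := if (unpickle j : option I) is Some (t, s) then F t s else HT0.
exists (fun j => projT1 (h j)), (fun j => projT2 (h j)); split => [j|p n d d0 pK].
  by rewrite /h; case: unpickle => [[t s]|//]; have [] := FP t.
have [M M0 pM] := pn_bound p n.
have [k kd] : exists k : nat, k.+1%:R^-1 <= d.
  exists (Num.truncn d^-1); rewrite invf_ple ?posrE// ltW//.
  exact: truncnS_gt.
pose N := (Num.truncn M).+1.
have [_ /(_ p pK)] := FP (n, N, k).
move=> /(_ _)[|s /= ps] /=.
  move=> i i_n; apply: le_trans (pM _ _) _; first by rewrite size_polyXn.
  by rewrite l1X mulr1 ltW// truncnS_gt.
exists (pickle ((n, N, k, s) : I)); rewrite /h pickleK.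
exact: close_weak kd ps.
Qed.

End compactness.

(** * The topology of the space of codes *)

Section codes_topology.
Context {R : realType}.
Implicit Types (mu nu : codes R) (n : nat).

Lemma code_of_subproof (p : pseudonorm {poly R}) :
  (fun v => p (rat_inc R v)) \in @Qpseudonorm R.
Proof.
apply/mem_set; split => [x y|a x]; first by rewrite incD pseudonorm_triangle.
by rewrite incZ pseudonorm_scale ratr_norm.
Qed.

Definition code_of (p : pseudonorm {poly R}) : codes R :=
  exist (fun f => f \in @Qpseudonorm R) _ (code_of_subproof p).

Lemma code_ofE p : real_ext (code_of p) =1 p.
Proof. by move=> x; apply/esym/real_ext_unique. Qed.

Definition code_close n (d : R) mu nu : Prop :=
  close_on n d (real_ext mu) (real_ext nu).

Lemma nbhs_set_val (T : topologicalType) (S : set T) (x : S) (A : set S) :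
  nbhs x A <-> exists2 B, nbhs (\val x) B & set_val @^-1` B `<=` A.
Proof.
split=> [|[B xB BA]].
  move=> [C [[B oB <-] Bx] CA]; exists B => //.
  exact: open_nbhs_nbhs.
by apply: filterS BA _; exact: (@initial_continuous _ _ set_val).
Qed.

Lemma code_eval_continuous (v : {poly rat}) : continuous (fun mu => mu v).
Proof.
move=> mu; apply: (@continuous_comp _ _ _ (fun mu : codes R => \val mu)
  (fun f : {ptws {poly rat} -> R} => f v)).
  exact: initial_continuous.
exact: (@proj_continuous _ (fun=> R) v).
Qed.

(** By grid_control, finitely many rational vectors suffice to control a whole
initial segment; conversely, closeness on longer and longer initial segments
implies pointwise convergence. *)
Lemma nbhs_codeP mu (A : set (codes R)) : nbhs mu A <->
  exists n d, 0 < d /\ forall nu, code_close n d mu nu -> A nu.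
Proof.
split=> [muA|[n [d [d0 nuA]]]]; last first.
  have [M M0 muM] := pn_bound (real_ext mu) n.
  have [m [e [g [e0 ge]]]] := grid_control n (ltW M0) d0.
  have near1 j : nbhs mu [set nu |
      `|real_ext mu (rat_inc R (g j)) - real_ext nu (rat_inc R (g j))| <= e].
    have /cvgrPdist_le := @code_eval_continuous (g j) mu.
    move=> /(_ e e0); apply: filterS => nu.
    by rewrite /real_ext/= !real_ext_inc.
  have : nbhs mu [set nu | forall j,
      `|real_ext mu (rat_inc R (g j)) - real_ext nu (rat_inc R (g j))| <= e].
    exact: (filter_forall (nbhs_filter mu) near1).
  apply: filterS => nu nug; apply: nuA; apply: ge => // i i_n.
  by have := muM 'X^i; rewrite size_polyXn l1X mulr1; apply.
apply: contrapT => noball.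
have bad (k : nat) : exists nu, code_close k k.+1%:R^-1 mu nu /\ ~ A nu.
  apply: contrapT => H; apply: noball; exists k, k.+1%:R^-1; split.
    by rewrite invr_gt0.
  by move=> nu munu; apply: contrapT => nA; apply: H; exists nu.
have [nu nuP] := choice bad.
have [B muB BA] := (nbhs_set_val mu A).1 muA.
have cv : {ptws, (fun k => \val (nu k)) @ \oo --> \val mu}.
  apply/cvg_sup => v B' [C [[D oD <-] Dmu] DB'].
  apply: filterS DB' _.
  have : (fun k => nu k v) @ \oo --> mu v; last first.
    by apply; exact: open_nbhs_nbhs.
  apply/cvgrPdist_le => e e0.
  pose x := rat_inc R v.
  have [k kP] : exists k : nat, l1 x <= e * k%:R.
    exists (Num.truncn (l1 x / e)).+1; rewrite -ler_pdivrMl// mulrC ltW//.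
    exact: truncnS_gt.
  exists (maxn k (size x)) => // j /=; rewrite geq_max => /andP[kj xj].
  have := (nuP j).1 x xj; rewrite /x /real_ext/= !real_ext_inc.
  move/le_trans; apply; rewrite ler_pdivrMl// mulrC.
  by apply: le_trans kP _; rewrite ler_pM2l// ler_nat leqW.
have [N _ NB] := cv B muB.
have [_] := nuP N; apply; apply: BA; exact: (NB N (leqnn N)).
Qed.

Lemma nbhs_codeSP (S : set (codes R)) (x : S) (A : set S) : nbhs x A <->
  exists n d, 0 < d /\ forall y : S, code_close n d (\val x) (\val y) -> A y.
Proof.
split=> [/nbhs_set_val[B /nbhs_codeP[n [d [d0 dB]]] BA]|[n [d [d0 dA]]]].
  by exists n, d; split => // y xy; apply: BA; exact: dB.
apply/nbhs_set_val; exists [set nu | code_close n d (\val x) nu] => //.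
by apply/nbhs_codeP; exists n, d.
Qed.

Definition Xin mu : {linear {poly R} -> Xcode mu} :=
  @completion_in _ (kerquot (real_ext mu)) \o kerpi (real_ext mu).

Local Arguments Xin : simpl never.

Lemma Xin_norm mu x : `|Xin mu x| = real_ext mu x.
Proof. exact: Xcode_in_norm. Qed.

Lemma Xin_dense mu (x : Xcode mu) d : 0 < d -> exists y, `|Xin mu y - x| <= d.
Proof.
move=> d0; have [|z [xz [y _ yz]]] := @Xcode_in_dense _ mu (ball x d) _ (ball_open x _).
  by exists x; exact: ballxx.
exists y; have -> : Xin mu y = z by [].
by move: xz; rewrite -ball_normE /= distrC => /ltW.
Qed.

End codes_topology.
Local Arguments Xin : simpl never.
(* From here on, a coded space is known only through Xin_norm and Xin_dense. *)
Local Opaque real_ext Xcode.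

(** * Dependent choice and counting dimensions *)

Section choice_lemmas.

Lemma dependent_choice_nat (X : Type) (P : nat -> X -> Prop)
    (Q : nat -> X -> X -> Prop) (x0 : X) : P 0%N x0 ->
  (forall k x, P k x -> exists y, P k.+1 y /\ Q k x y) ->
  exists f, f 0%N = x0 /\ forall k, P k (f k) /\ Q k (f k) (f k.+1).
Proof.
move=> P0 PQ.
have /choice[g gP] (kx : nat * X) : exists y, P kx.1 kx.2 -> P kx.1.+1 y /\ Q kx.1 kx.2 y.
  have [/PQ[y]|nP] := pselect (P kx.1 kx.2); first by exists y.
  by exists x0.
pose f := fix f k := if k is k'.+1 then g (k', f k') else x0.
have fP k : P k (f k).
  by elim: k => // k IH; have [] := gP (k, f k) IH.
by exists f; split => // k; split => //; have [] := gP (k, f k) (fP k).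
Qed.

Lemma rV_not_onto (R : realType) (V : lmodType R) k
    (j : {linear 'rV[R]_k.+1 -> V}) (A : {linear 'rV[R]_k -> V}) :
  injective j -> exists y, forall x, j y <> A x.
Proof.
move=> jinj; apply: contrapT => H.
have sol y : exists x, j y = A x.
  by apply: contrapT => nx; apply: H; exists y => x yx; apply: nx; exists x.
have [s sP] := choice (fun a : 'I_k.+1 => sol (delta_mx 0 a)).
pose M : 'M[R]_(k.+1, k) := \matrix_(a < k.+1) s a.
have [u uM u0] : exists2 u : 'rV[R]_k.+1, u *m M = 0 & u != 0.
  have : kermx M != 0.
    rewrite -mxrank_eq0 mxrank_ker subn_eq0 -ltnNge ltnS.
    exact: rank_leq_col.
  move=> /rowV0Pn[u /sub_kermxP uM u0]; by exists u.
have : j u = A (u *m M).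
  rewrite [in LHS](row_sum_delta u) linear_sum mulmx_sum_row linear_sum.
  by apply: eq_bigr => a _; rewrite linearZ sP rowK linearZ.
rewrite uM linear0 => ju; move: u0.
by rewrite (jinj u 0) ?eqxx// ju linear0.
Qed.

End choice_lemmas.

(** * Codes of spaces whose age lies in the class *)

Section codes_class.
Context {R : realType} (K : set (BM R)).
Hypotheses (K_hereditary : hereditary K) (K_closed : closed K).

Lemma Age_in_class (X : normedModType R) (T : {linear {poly R} -> X}) n :
  Age X `<=` K -> in_class K (fun x => `|T (take_poly n x)|).
Proof.
move=> XK; have [F [J [Q [Jn pJ QJ pQ xJQ]]]] := pn_factor (norm_pn T) n.
exists F; split; last first.
  by exists (Q \o take_lin n) => x /=; rewrite -pQ// size_take_poly.
apply: XK; exists (T \o J); apply/Emb0P => y /=; exact: pJ.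
Qed.

Lemma class_of_in_class (X : normedModType R) E (S : {linear bmsp E -> X}) :
  in_class K (fun x => `|S (bm_coord E (take_poly (projT1 E) x))|) ->
  Emb 0 (bmsp E) X S -> K E.
Proof.
move=> [H [KH [T ST]]] /Emb0P SN; apply: K_hereditary KH _.
exists (T \o @bm_vec _ E); apply/Emb0P => y /=.
by rewrite -ST take_poly_id ?size_bm_vec// bm_vecK.
Qed.

(** A finite-dimensional subspace of X is a limit of images of the same
coordinate space under maps whose values lie in the range of T. *)
Lemma Age_dense_range (X : normedModType R) (T : {linear {poly R} -> X}) :
  (forall x d, 0 < d -> exists y, `|T y - x| <= d) ->
  (forall n, in_class K (fun x => `|T (take_poly n x)|)) -> Age X `<=` K.
Proof.
move=> Tdense TK E [S SE].
apply: (class_of_in_class _ SE); set n := projT1 E.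
pose S' : {linear {poly R} -> X} := S \o bm_coord E.
apply: (@in_class_closed _ _ (norm_pn S')) => // d d0.
have [a aP] := choice (fun i => Tdense (S' 'X^i) _ d0).
have [N aN] : exists N, forall i, (i < n)%N -> (size (a i) <= N)%N.
  exists (\max_(i < n) size (a i)) => i i_n.
  exact: (@leq_bigmax _ (fun i : 'I_n => size (a i)) (Ordinal i_n)).
exists (fun x => `|T (take_poly N (linX a (take_poly n x)))|).
  exact: (in_class_comp (linX a \o take_lin n) (TK N)).
move=> x xn; rewrite (take_poly_id xn) take_poly_id; last first.
  rewrite (linXE a xn); apply: (leq_trans (size_sum _ _ _)).
  apply/bigmax_leqP => i _.
  exact: leq_trans (size_scale_leq _ _) (aN i (ltn_ord i)).
rewrite distrC; apply: (@close_norm _ _ (T \o linX a) S') xn => i i_n.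
by rewrite -[X in X - _]/(T (linX a 'X^i)) linXX.
Qed.

Lemma sigma_classP (mu : codes R) : sigma_class K mu <->
  forall n, in_class K (real_ext mu \o take_poly n).
Proof.
split=> [muK n|muK].
  by apply: in_class_ext (Age_in_class (Xin mu) n muK) => x; exact: Xin_norm.
apply: (@Age_dense_range _ (Xin mu)) => [x d d0|n]; first exact: Xin_dense.
by apply: in_class_ext (muK n) => x; rewrite Xin_norm.
Qed.

Hypothesis (K_JEP : JEP K).

(** One more unit vector is made independent of the previous ones, moving it by
at most d; the room for it comes from a space of large dimension. *)
Lemma injective_step k d H (T : {linear {poly R} -> bmsp H}) :
  infinite_dimensional K -> K H -> 0 < d ->
  (forall x : {poly R}, (size x <= k)%N -> T x = 0 -> x = 0) ->
  exists H' (i : {linear bmsp H -> bmsp H'}) (T' : {linear {poly R} -> bmsp H'}),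
    [/\ K H', forall y, `|i y| = `|y|,
        forall x : {poly R}, (size x <= k.+1)%N -> T' x = 0 -> x = 0 &
        forall j, `|T' 'X^j - i (T 'X^j)| <= (if j == k then d else 0)].
Proof.
move=> Kinf KH d0 Tinj; have [E KE] := Kinf k.+1.
have [H' [KH' [[i /Emb0P iN] [j /Emb0P jN]]]] := K_JEP KH KE.
have [v vA] : exists v : bmsp H', forall x : {poly R}, (size x <= k)%N -> v <> i (T x).
  pose j' : {linear 'rV[R]_k.+1 -> bmsp H'} := j.
  have j'inj : injective j'.
    move=> x y xy; apply/eqP; rewrite -subr_eq0.
    apply/eqP/(@normr0_eq0 _ (bmsp (existT _ _ E))).
    by rewrite -jN -[j _]/(j' (x - y)) linearB/= xy subrr normr0.
  pose A : {linear 'rV[R]_k -> bmsp H'} :=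
    i \o T \o [the {linear 'rV[R]_k -> {poly R}} of rVpoly].
  have [y yA] := rV_not_onto A j'inj; exists (j' y) => x xk jx.
  by apply: (yA (poly_rV x)); rewrite /= poly_rV_K.
pose w := i (T 'X^k).
pose sp (z : bmsp H') := exists2 x : {poly R}, (size x <= k)%N & z = i (T x).
have spZ a z : sp z -> sp (a *: z).
  move=> [x xk ->]; exists (a *: x); last by rewrite !linearZ.
  exact: leq_trans (size_scale_leq _ _) xk.
have spB z z' : sp z -> sp z' -> sp (z - z').
  move=> [x xk ->] [x' xk' ->]; exists (x - x'); last by rewrite !linearB.
  by rewrite (leq_trans (size_polyD _ _))// size_polyN geq_max xk.
have vsp : ~ sp v by move=> [x xk vx]; exact: (vA x xk).
have [z [zsp zw]] : exists z, ~ sp z /\ `|z - w| <= d.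
  have [wsp|wsp] := pselect (sp w); last by exists w; rewrite subrr normr0 ltW.
  have v0 : 0 < `|v|.
    rewrite normr_gt0; apply/eqP => v0; apply: vsp; exists 0; last by rewrite !linear0.
    by rewrite size_poly0.
  exists (w + (d / `|v|) *: v); split.
    move=> zsp; apply: vsp; have := spZ (`|v| / d) _ (spB _ _ zsp wsp).
    rewrite addrC addKr scalerA (_ : _ * _ = 1) ?scale1r//.
    by field; rewrite gt_eqF//= gt_eqF.
  rewrite addrC addKr normrZ ger0_norm ?divfK ?gt_eqF//.
  by rewrite divr_ge0// ltW.
pose T' : {linear {poly R} -> bmsp H'} := linX (fun a => if a == k then z else i (T 'X^a)).
have T'X a : T' 'X^a = if a == k then z else i (T 'X^a) by exact: linXX.
have T'k (x : {poly R}) : (size x <= k)%N -> T' x = i (T x).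
  move=> xk; rewrite !(linear_sumX _ xk) linear_sum; apply: eq_bigr => a _.
  by rewrite T'X ltn_eqF// linearZ.
exists H', i, T'; split => // [x xk x0|a]; last first.
  by rewrite T'X; case: eqVneq => [->//|_]; rewrite subrr normr0.
have xE : x = take_poly k x + x`_k *: 'X^k by rewrite -take_polyS take_poly_id.
have tk := size_take_poly k x.
move: x0; rewrite {1}xE linearD linearZ/= T'k// T'X eqxx => x0.
have xk0 : x`_k = 0.
  apply/eqP/negPn/negP => xk0; apply: zsp.
  have : sp (- (x`_k)^-1 *: (i (T (take_poly k x)))) by apply: spZ; exists (take_poly k x).
  move: x0 => /eqP; rewrite addr_eq0 => /eqP ->.
  by rewrite scalerN scaleNr opprK scalerA mulVf// scale1r.
rewrite xE xk0 scale0r addr0; apply: Tinj => //.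
by apply/eqP; rewrite -normr_eq0 -iN; move: x0; rewrite xk0 scale0r addr0 => ->; rewrite normr0.
Qed.

Lemma norm_lower (p : pseudonorm {poly R}) n :
  (forall x : {poly R}, (size x <= n)%N -> p x = 0 -> x = 0) ->
  exists2 c, 0 < c & forall x : {poly R}, (size x <= n)%N -> l1 x <= c * p x.
Proof.
move=> p0; have [F [J [Q [Jn pJ QJ pQ xJQ]]]] := pn_factor p n.
have [c c0 lJ] := l1_fdsp J; exists c => // x xn.
have xE : x = J (Q x).
  apply/eqP; rewrite -subr_eq0; apply/eqP/p0; last exact: xJQ.
  by rewrite (leq_trans (size_polyD _ _))// size_polyN geq_max xn Jn.
by rewrite {1}xE pQ.
Qed.

Lemma norm_infinite_dim (mu : codes R) :
  (forall x, real_ext mu x = 0 -> x = 0) -> Bnorms mu.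
Proof.
move=> mu0; split => // -[n [e eE]].
pose f (a : 'rV[R]_n) : Xcode mu := \sum_i a 0 i *: e i.
have flin : linear f.
  move=> a u v; rewrite /f scaler_sumr -big_split/=; apply: eq_bigr => i _.
  by rewrite !mxE scalerDl scalerA.
pose fL := GRing.isLinear.Build _ _ _ _ f flin.
pose A : {linear 'rV[R]_n -> Xcode mu} := HB.pack_for {linear 'rV[R]_n -> Xcode mu} f fL.
pose j : {linear 'rV[R]_n.+1 -> Xcode mu} :=
  Xin mu \o [the {linear 'rV[R]_n.+1 -> {poly R}} of rVpoly].
have jinj : injective j.
  move=> x y xy; apply: (can_inj (@rVpolyK _ _)); apply/eqP; rewrite -subr_eq0.
  apply/eqP/mu0; rewrite -Xin_norm.
  have -> : Xin mu (rVpoly x - rVpoly y) = j x - j y by rewrite linearB.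
  by rewrite xy subrr normr0.
have [y yA] := rV_not_onto A jinj.
have : [set: Xcode mu] (j y) by [].
rewrite eE => -[a _ ay]; apply: (yA (\row_i a i)).
by rewrite -ay /A /= /f; apply: eq_bigr => i _; rewrite mxE.
Qed.

(** In the iteration of injective_step every unit vector is moved only once, so
that the total error stays below d. *)
Lemma realize_norm (p : {poly R} -> R) d :
  infinite_dimensional K -> in_class K p -> 0 < d ->
  exists mu, [/\ sigma_class K mu, Bnorms mu &
    forall x, `|real_ext mu x - p x| <= d * l1 x].
Proof.
move=> Kinf [H0 [KH0 [T0 pT0]]] d0.
pose HT := {H : BM R & {linear {poly R} -> bmsp H}}.
pose P (k : nat) (h : HT) := [/\ K (projT1 h),
  forall x : {poly R}, (size x <= k)%N -> projT2 h x = 0 -> x = 0 &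
  exists i : {linear bmsp H0 -> bmsp (projT1 h)}, (forall y, `|i y| = `|y|) /\
   forall j, `|projT2 h 'X^j - i (T0 'X^j)| <= (if (j < k)%N then d else 0)].
pose Q (k : nat) (h h' : HT) := forall x : {poly R}, (size x <= k)%N ->
  `|projT2 h' x| = `|projT2 h x|.
have [|k [H T] /= [KH Tinj [i [iN iT]]]|f [_ fP]] := @dependent_choice_nat HT P Q
    (existT (fun H : BM R => {linear {poly R} -> bmsp H}) H0 T0).
- split => //= [x|]; first by rewrite leqn0 size_poly_eq0 => /eqP.
  exists idfun; split => // j; by rewrite /= subrr normr0.
- have [H' [i' [T' [KH' iN' T'inj T'i]]]] := injective_step Kinf KH d0 Tinj.
  exists (existT (fun H : BM R => {linear {poly R} -> bmsp H}) H' T').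
  split => /=; last first.
    move=> x xk /=; rewrite -iN'; congr (`|_|).
    rewrite !(linear_sumX _ xk) linear_sum; apply: eq_bigr => a _ /=.
    rewrite linearZ/=; congr (_ *: _); apply/eqP; rewrite -subr_eq0 -normr_le0.
    by have := T'i a; rewrite ltn_eqF.
  split => //; exists (i' \o i); split => [y|j] /=; first by rewrite iN' iN.
  have -> : T' 'X^j - i' (i (T0 'X^j)) =
      (T' 'X^j - i' (T 'X^j)) + i' (T 'X^j - i (T0 'X^j)).
    by rewrite linearB/= addrA subrK.
  apply: le_trans (ler_normD _ _) _; rewrite iN'.
  apply: le_trans (lerD (T'i j) (iT j)) _.
  by rewrite (ltnS j k) (leq_eqVlt j k); case: eqVneq => [->|_]; rewrite ?ltnn ?addr0 ?add0r.
pose q k (x : {poly R}) := `|projT2 (f k) x|.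
have qS m k (x : {poly R}) : (size x <= k)%N -> q (m + k)%N x = q k x.
  move=> xk; elim: m => // m IH; rewrite -IH addSn.
  have [_] := fP (m + k)%N; apply; exact: leq_trans xk (leq_addl _ _).
pose p0 (x : {poly R}) := q (size x) x.
have p0E k (x : {poly R}) : (size x <= k)%N -> p0 x = q k x.
  by move=> xk; rewrite -(subnK xk) qS.
have pD x y : p0 (x + y) <= p0 x + p0 y.
  pose k := maxn (size x) (size y).
  rewrite (@p0E k) ?size_polyD// (@p0E k x) ?leq_maxl// (@p0E k y) ?leq_maxr//.
  by rewrite /q linearD ler_normD.
have pZ a x : p0 (a *: x) = `|a| * p0 x.
  by rewrite (@p0E (size x)) ?size_scale_leq// /q linearZ normrZ.
pose p' : pseudonorm {poly R} := Pseudonorm pD pZ.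
have muE := code_ofE p'.
exists (code_of p'); split.
- apply/sigma_classP => n; have [[KH _ _] _] := fP n.
  exists (projT1 (f n)); split => //; exists (projT2 (f n) \o take_lin n) => x.
  by rewrite /= [LHS]muE /= (@p0E n)// size_take_poly.
- apply: norm_infinite_dim => x; rewrite muE /= /p0 /q => x0.
  have [[_ finj _] _] := fP (size x); apply: finj => //.
  exact: normr0_eq0.
- move=> x; rewrite muE pT0 /= /p0 /q.
  have [[_ _ [i [iN iT]]] _] := fP (size x).
  rewrite -[X in _ - X]iN.
  apply: (@close_norm _ _ (projT2 (f (size x))) (i \o T0) (size x)) => // j jx.
  by have := iT j; rewrite jx.
Qed.

End codes_class.

(** * Baire category in the spaces of codes *)

Section codes_baire.
Context {R : realType} (K : set (BM R)) (I : set (codes R)).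
Hypotheses (K_hereditary : hereditary K) (K_closed : closed K) (K_JEP : JEP K).
Hypotheses (I_norms : infinite_dimensional K -> @Bnorms R `<=` I)
  (I_all : ~ infinite_dimensional K -> I = setT).

Let S := sigma_class K `&` I.

(** Pseudonorms with quotient in the class are dense among the codes; this is the
only place where the choice of I matters. *)
Lemma realize (p : {poly R} -> R) d : in_class K p -> 0 < d ->
  exists mu, [/\ S mu, infinite_dimensional K -> Bnorms mu &
    forall x, `|real_ext mu x - p x| <= d * l1 x].
Proof.
move=> pK d0; have [Kinf|Kfin] := pselect (infinite_dimensional K).
  have [mu [muK muB mup]] := realize_norm K_hereditary K_closed K_JEP Kinf pK d0.
  by exists mu; split => //; split => //; exact: I_norms.
have [H [KH [T pT]]] := pK.
exists (code_of (norm_pn T)); split => // [|x]; last first.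
  by rewrite code_ofE /= pT subrr normr0 mulr_ge0 ?l1_ge0 ?ltW.
split; last by rewrite I_all.
apply/(sigma_classP K_hereditary K_closed) => n.
apply: in_class_ext (in_class_comp (take_lin n) pK) => x.
by rewrite /= [RHS]code_ofE /= pT.
Qed.

Lemma code_take_class mu n : S mu -> in_class K (real_ext mu \o take_poly n).
Proof. by move=> [+ _] => /(sigma_classP K_hereditary K_closed). Qed.

Lemma S_near mu n d : S mu -> 0 < d ->
  exists nu, [/\ S nu, infinite_dimensional K -> Bnorms nu & code_close n d mu nu].
Proof.
move=> Smu d0; have [nu [Snu nuB nup]] := realize (code_take_class n Smu) d0.
exists nu; split => // x xn; rewrite distrC; have := nup x.
by rewrite /= take_poly_id.
Qed.

(** A nested sequence of balls has a point in common; when the class is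
infinite-dimensional the balls are chosen among those on which all codes are
norms on larger and larger initial segments, so that the limit is a norm. *)
Lemma S_baire (F : nat -> set S) (x0 : S) n0 d0 :
  (forall k, nowhere_dense (F k)) -> 0 < d0 ->
  exists y : S, code_close n0 d0 (\val x0) (\val y) /\ forall k, ~ F k y.
Proof.
move=> Fnd d00.
pose X := (S * nat * R)%type.
pose P (k : nat) (t : X) := 0 < t.2.
pose ball (t : X) y := code_close t.1.2 t.2 (\val t.1.1) y.
pose Q (k : nat) (t t' : X) := [/\ (forall y, ball t' y -> ball t y),
  (forall y : S, ball t' (\val y) -> ~ F k y),
  (infinite_dimensional K -> forall y, ball t' y ->
     forall x : {poly R}, (size x <= k)%N -> real_ext y x = 0 -> x = 0),
  (k <= t'.1.2)%N & t'.2 <= k.+1%:R^-1].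
have [//|k [[x n] d]|f [f0 fP]] := @dependent_choice_nat X P Q ((x0, n0), d0).
  rewrite /P /= => dp.
  have [x1 [n1 [d1 [d10 xx1 x1n]]]] : exists (x1 : S) n1 d1, [/\ 0 < d1,
      (forall y, code_close n1 d1 (\val x1) y -> code_close n d (\val x) y) &
      (infinite_dimensional K -> forall y, code_close n1 d1 (\val x1) y ->
         forall z : {poly R}, (size z <= k)%N -> real_ext y z = 0 -> z = 0)].
    have [Kinf|Kfin] := pselect (infinite_dimensional K); last by exists x, n, d.
    have d20 : 0 < d / 2 by rewrite divr_gt0.
    have [nu [Snu /(_ Kinf)[_ nuB] xnu]] := S_near n (set_mem (valP x)) d20.
    have [c c0 cl] := norm_lower (fun x (_ : (size x <= k)%N) => nuB x).
    exists (exist _ nu (mem_set Snu)), (maxn n k), (Num.min (d / 2) (c^-1 / 2)).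
    split => [|y xy|_ y xy z zk z0] /=.
    - by rewrite lt_min d20 divr_gt0// invr_gt0.
    - rewrite [d](splitr d); apply: close_trans xnu _.
      by apply: close_weak xy; rewrite ?leq_maxl ?ge_min ?lexx.
    - have := xy z (leq_trans zk (leq_maxr _ _)); rewrite z0 subr0.
      have := cl z zk; set l := l1 z => h1 h2.
      have l0 : l <= 0.
        have : l <= c * (c^-1 / 2 * l).
          apply: le_trans h1 _; rewrite ler_pM2l//.
          apply: le_trans (ler_norm _) _; apply: le_trans h2 _.
          by rewrite ler_wpM2r ?l1_ge0// ge_min lexx orbT.
        by rewrite !mulrA divff ?gt_eqF// mul1r; lra.
      apply: nuB; apply/eqP; rewrite eq_le pn_ge0 andbT.
      have [M M0 pM] := pn_bound (real_ext nu) k.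
      by apply: le_trans (pM z zk) _; rewrite pmulr_rle0.
  have d120 : 0 < d1 / 2 by rewrite divr_gt0.
  have [x2 x12 x2F] : exists2 x2 : S, code_close n1 (d1 / 2) (\val x1) (\val x2) &
      ~ closure (F k) x2.
    apply: contrapT => H; have : (closure (F k))^° x1.
      apply/nbhs_codeSP; exists n1, (d1 / 2); split => // y x1y.
      by apply: contrapT => yF; apply: H; exists y.
    by rewrite (Fnd k).
  have [B x2B FB] : exists2 B, nbhs x2 B & forall y, B y -> ~ F k y.
    apply: contrapT => H; apply: x2F => B x2B; apply: contrapT => nFB.
    by apply: H; exists B => // y By Fy; apply: nFB; exists y.
  have [n2 [d2 [d20 x2d]]] := (nbhs_codeSP _ _).1 x2B.
  pose m := maxn (maxn n1 n2) k.
  pose e := Num.min (Num.min (d1 / 2) d2) k.+1%:R^-1.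
  have n1m : (n1 <= m)%N by rewrite /m -maxnA leq_maxl.
  have n2m : (n2 <= m)%N by rewrite /m (maxnC n1) -maxnA leq_maxl.
  have ed1 : e <= d1 / 2 by rewrite !ge_min lexx.
  have ed2 : e <= d2 by rewrite !ge_min lexx orbT.
  have x1y y : code_close m e (\val x2) y -> code_close n1 d1 (\val x1) y.
    move=> x2y; rewrite [d1](splitr d1); apply: close_trans x12 _.
    exact: close_weak x2y.
  exists ((x2, m), e); split.
    by rewrite /P /e /= !lt_min d120 d20 invr_gt0 ltr0n.
  rewrite /Q /ball /=; split => [y /x1y /xx1//|y x2y|Kinf y /x1y||].
  - by apply: FB; apply: x2d; exact: close_weak x2y.
  - exact: x1n.
  - exact: leq_maxr.
  - by rewrite ge_min lexx orbT.
pose nu k := \val (f k).1.1 : codes R.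
have dpos k : 0 < (f k).2 by have [] := fP k.
have nest k j y : ball (f (j + k)%N) y -> ball (f k) y.
  by elim: j => // j IH; rewrite addSn; have [_ [+ _ _ _ _]] := fP (j + k)%N => /[apply].
have nunu k j : (k <= j)%N -> ball (f k) (nu j).
  move=> kj; apply: (@nest k (j - k)%N); rewrite subnK//.
  by apply: close_refl; rewrite ltW.
have dk k : (f k.+1).2 <= k.+1%:R^-1 by have [_ []] := fP k.
have nk k : (k <= (f k.+1).1.2)%N by have [_ []] := fP k.
have small e (x : {poly R}) : 0 < e -> exists k, (size x <= (f k).1.2)%N /\ (f k).2 * l1 x <= e.
  move=> e0; pose k := maxn (size x) (Num.truncn (l1 x / e)).
  exists k.+1; split; first by apply: leq_trans (nk k); exact: leq_maxl.
  apply: le_trans (ler_wpM2r (l1_ge0 _) (dk k)) _.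
  rewrite ler_pdivrMl// -ler_pdivrMr//.
  apply/ltW/(lt_le_trans (truncnS_gt _)).
  by rewrite ler_nat ltnS leq_maxr.
have cvg_nu (x : {poly R}) : cvg (real_ext (nu k) x @[k --> \oo]).
  apply: cauchy_cvg; apply/cauchyP => e e0.
  have e20 : 0 < e / 2 by rewrite divr_gt0.
  have [k [xk dke]] := small _ x e20.
  exists (real_ext (nu k) x); exists k => // j /= kj; rewrite -ball_normE /=.
  apply: le_lt_trans (nunu k j kj x xk) _; apply: le_lt_trans dke _.
  by rewrite ltr_pdivrMr// mulr2n mulrDr mulr1 ltrDl.
pose p0 (x : {poly R}) : R := lim (real_ext (nu k) x @[k --> \oo]).
have p0P x : real_ext (nu k) x @[k --> \oo] --> p0 x by exact: cvg_nu.
have pD x y : p0 (x + y) <= p0 x + p0 y.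
  apply: (ler_cvg_to (p0P (x + y)) (cvgD (p0P x) (p0P y))).
  by apply: nearW => k; exact: pseudonorm_triangle.
have pZ a x : p0 (a *: x) = `|a| * p0 x.
  apply/esym; apply: (cvg_unique _ _ (p0P (a *: x))) => //.
  have -> : (fun k => real_ext (nu k) (a *: x)) = (fun k => `|a| * real_ext (nu k) x).
    by apply/funext => k; rewrite pseudonorm_scale.
  by apply: cvgM; [exact: cvg_cst|exact: p0P].
pose p : pseudonorm {poly R} := Pseudonorm pD pZ.
pose y := code_of p.
have inball k : ball (f k) y.
  move=> x xk; rewrite code_ofE /=.
  apply: (cvgr_to_le (cvg_norm (cvgB (cvg_cst (real_ext (nu k) x)) (p0P x)))).
  by exists k => // j /= kj; exact: nunu.
have yK : sigma_class K y.
  apply/(sigma_classP K_hereditary K_closed) => n.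
  apply: in_class_closed => // d dp.
  have [k [nkk dkd]] : exists k, (n <= (f k).1.2)%N /\ (f k).2 <= d.
    have [k [nk' dk']] := small d 'X^n dp; rewrite l1X mulr1 in dk'.
    by exists k; split => //; apply: ltnW; rewrite -(size_polyXn R n).
  exists (real_ext (nu k) \o take_poly n).
    exact: (code_take_class n (set_mem (valP (f k).1.1))).
  move=> x xn; rewrite /= take_poly_id// distrC.
  exact: close_weak nkk dkd (inball k) x xn.
have yI : I y.
  have [Kinf|Kfin] := pselect (infinite_dimensional K); last by rewrite I_all.
  apply: I_norms => //; apply: norm_infinite_dim => x.
  have [_ [_ _ /(_ Kinf) H _ _]] := fP (size x).
  exact: (H y (inball (size x).+1) x (leqnn _)).
exists (exist _ y (mem_set (conj yK yI))); split; first by have := inball 0%N; rewrite f0.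
move=> k; have [_ [_ H _ _ _]] := fP k; apply: H; exact: inball.
Qed.

End codes_baire.

(** * Guards and generic codes *)

Section shifts.
Context {R : realType}.
Implicit Types (x y : {poly R}) (n : nat).

Definition drop_lin n : {linear {poly R} -> {poly R}} :=
  [the {linear {poly R} -> {poly R}} of drop_poly n].

Definition shift n x : {poly R} := x * 'X^n.

Lemma shift_linear n : linear (shift n).
Proof. by move=> a x y; rewrite /shift mulrDl scalerAl. Qed.
HB.instance Definition _ n :=
  GRing.isLinear.Build R {poly R} {poly R} _ (shift n) (shift_linear n).

Lemma size_shift n m x : (size x <= m)%N -> (size (shift n x) <= n + m)%N.
Proof.
move=> xm; rewrite /shift (leq_trans (size_polyMleq _ _))// size_polyXn addnS/=.
by rewrite addnC leq_add2l.
Qed.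

Lemma l1_linear (T : {linear {poly R} -> {poly R}}) x :
  (forall i, l1 (T 'X^i) <= 1) -> l1 (T x) <= l1 x.
Proof.
move=> T1; pose l1_pn := Pseudonorm (@l1D R) (@l1Z R).
have := @pn_le_l1 _ (pull_pn l1_pn T) (size x) 1 x (leqnn _) (fun i _ => T1 i).
by rewrite mul1r.
Qed.

Lemma l1_shift n x : l1 (shift n x) <= l1 x.
Proof.
apply: (l1_linear (T := shift n)) => i.
by rewrite -[X in l1 X]/('X^i * 'X^n) -exprD l1X.
Qed.

Lemma l1_drop n x : l1 (drop_poly n x) <= l1 x.
Proof.
apply: (l1_linear (T := drop_lin n)) => i /=; have [ni|i_n] := leqP n i.
  by rewrite -(subnK ni) exprD drop_polyMXn_id l1X.
by rewrite drop_poly_eq0 ?size_polyXn// /l1 size_poly0 big_ord0.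
Qed.

End shifts.

Section guards.
Context {R : realType} (K : set (BM R)) (I : set (codes R)).
Hypotheses (K_hereditary : hereditary K) (K_closed : closed K) (K_JEP : JEP K).
Hypotheses (I_norms : infinite_dimensional K -> @Bnorms R `<=` I)
  (I_all : ~ infinite_dimensional K -> I = setT).

Let S := sigma_class K `&` I.

(** Amalgamation over the first n coordinates, up to e, is guarded by the
knowledge of the first m coordinates up to d. *)
Definition guards (p : {poly R} -> R) n m (e d : R) : Prop :=
  forall (G1 G2 : BM R) (T1 : {linear {poly R} -> bmsp G1})
      (T2 : {linear {poly R} -> bmsp G2}), K G1 -> K G2 ->
    close_on m d p (fun x => `|T1 x|) -> close_on m d p (fun x => `|T2 x|) ->
  exists (L : BM R) (i1 : {linear bmsp G1 -> bmsp L}) (i2 : {linear bmsp G2 -> bmsp L}),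
    [/\ K L, forall y, `|i1 y| = `|y|, forall y, `|i2 y| = `|y| &
        forall i, (i < n)%N -> `|i1 (T1 'X^i) - i2 (T2 'X^i)| <= e].

Lemma guards_open p q n m e d : close_on m (d / 2) p q ->
  guards p n m e d -> guards q n m e (d / 2).
Proof.
move=> pq pg G1 G2 T1 T2 K1 K2 q1 q2.
apply: (pg G1 G2 T1 T2 K1 K2); rewrite (splitr d);
  [exact: close_trans pq q1|exact: close_trans pq q2].
Qed.

Lemma guards0 p m e d : guards p 0 m e d.
Proof.
move=> G1 G2 T1 T2 K1 K2 _ _.
have [L [KL [[i1 /Emb0P i1N] [i2 /Emb0P i2N]]]] := K_JEP K1 K2.
by exists L, i1, i2; split.
Qed.

(** The guard supplied by the amalgamation property for the first coordinates of
a code is appended to these coordinates. The map into the guard need not be an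
isometry, which only moves the code a little. *)
Lemma guards_dense mu n e n0 k : GAP K -> S mu -> 0 < e -> 0 < k ->
  exists nu m d, [/\ S nu, code_close n0 k mu nu, 0 < d &
    guards (real_ext nu) n m e d].
Proof.
move=> KGAP Smu e0 k0; pose N := maxn n n0.
have [E [KE [T pT]]] := code_take_class K_hereditary K_closed N Smu.
have [M M0 TM] := norm_bound T N.
(* With distortion a, the map into the guard changes the norm of a unit vector
   by at most k / 2, and the amalgamation error on it is at most e / 2. *)
pose a := Num.min (e / 2 / M) (ln (1 + k / 2 / M)).
have kM : 0 < k / 2 / M by rewrite !divr_gt0.
have a0 : 0 < a by rewrite lt_min !divr_gt0//= ln_gt0// ltrDl.
have aM : a * M <= e / 2 by rewrite -ler_pdivlMr// ge_min lexx.
have expa : (expR a - 1) * M <= k / 2.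
  rewrite -ler_pdivlMr// lerBlDl -[leRHS]lnK ?posrE ?addr_gt0//.
  by rewrite ler_expR ge_min lexx orbT.
have [F [phi [d1 [KF phiE d10 amalg]]]] := KGAP E a KE a0.
pose T' : {linear {poly R} -> bmsp F} :=
  (phi \o T \o take_lin N) \+ (bm_coord F \o drop_lin N).
pose s : {linear bmsp F -> {poly R}} := shift N \o bm_vec F.
have T's y : T' (s y) = y.
  rewrite /T' /s /= /shift take_polyMXn_0 drop_polyMXn_id !linear0 add0r.
  exact: bm_vecK.
have T'T (x : {poly R}) : (size x <= N)%N -> T' x = phi (T x).
  move=> xN; rewrite /T' /= take_poly_id// drop_poly_eq0//.
  by rewrite -[poly_rV 0]/(bm_coord F 0) linear0 addr0.
have [c c0 lc] := l1_fdsp s.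
have {lc}lc (y : bmsp F) : l1 (s y) <= c * `|y| by exact: lc.
(* B bounds the l1 norm of the difference between a unit vector and the vector of
   the guard onto which it is mapped; T' vanishes on this difference. *)
pose B := 1 + c * (expR a * M).
have B0 : 0 < B by rewrite ltr_pwDl// !mulr_ge0// ?expR_ge0 ltW.
have ed1 : 0 < 1 - expR (- d1) by rewrite subr_gt0 -expR0 ltr_expR oppr_lt0.
pose k' := Num.min (k / 2) (Num.min ((1 - expR (- d1)) / (2 * c)) (e / (8 * B))).
have k'0 : 0 < k' by rewrite !lt_min !divr_gt0 ?mulr_gt0.
have k'k : k' <= k / 2 by rewrite ge_min lexx.
have k'c : 2 * k' * c <= 1 - expR (- d1).
  have : k' <= (1 - expR (- d1)) / (2 * c) by rewrite !ge_min lexx orbT.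
  by rewrite ler_pdivlMr ?mulr_gt0// => h; lra.
have k'B : 2 * k' * B <= e / 4.
  have : k' <= e / (8 * B) by rewrite !ge_min lexx !orbT.
  by rewrite ler_pdivlMr ?mulr_gt0// => h; lra.
have [nu [Snu _ nuT']] := realize K_hereditary K_closed K_JEP I_norms I_all
  (in_class_norm T' KF) k'0.
exists nu, (N + projT1 F)%N, k'; split => //.
  move=> x xn0; have xN : (size x <= N)%N by rewrite (leq_trans xn0) ?leq_maxr.
  have -> : real_ext mu x = `|T x| by rewrite -pT /= take_poly_id.
  have h1 := nuT' x; rewrite T'T// in h1.
  have h2 := Emb_dist (T x) (ltW a0) phiE.
  have h3 : (expR a - 1) * `|T x| <= k / 2 * l1 x.
    apply: (@le_trans _ _ ((expR a - 1) * (M * l1 x))).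
      by rewrite ler_wpM2l ?TM// subr_ge0 -expR0 ler_expR ltW.
    by rewrite mulrA ler_wpM2r ?l1_ge0.
  have h4 : k' * l1 x <= k / 2 * l1 x by rewrite ler_wpM2r ?l1_ge0.
  rewrite distrC.
  have -> : real_ext nu x - `|T x| =
    (real_ext nu x - `|phi (T x)|) + (`|phi (T x)| - `|T x|) by ring.
  apply: le_trans (ler_normD _ _) _; lra.
move=> G1 G2 T1 T2 K1 K2 nu1 nu2.
have near (G : BM R) (U : {linear {poly R} -> bmsp G}) (x : {poly R}) :
    close_on (N + projT1 F) k' (real_ext nu) (fun x => `|U x|) ->
    (size x <= N + projT1 F)%N -> `| `|U x| - `|T' x| | <= 2 * k' * l1 x.
  move=> nuU xm; have h1 := nuU x xm; have h2 := nuT' x.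
  rewrite distrC in h1.
  have -> : `|U x| - `|T' x| = (`|U x| - real_ext nu x) + (real_ext nu x - `|T' x|) by ring.
  apply: le_trans (ler_normD _ _) _; lra.
have size_s y : (size (s y) <= N + projT1 F)%N.
  by apply: size_shift; exact: size_bm_vec.
have emb (G : BM R) (U : {linear {poly R} -> bmsp G}) :
    close_on (N + projT1 F) k' (real_ext nu) (fun x => `|U x|) ->
    Emb d1 (bmsp F) (bmsp G) (U \o s).
  move=> nuU; apply: Emb_near => [|y]; first exact: ltW.
  have := near G U (s y) nuU (size_s y); rewrite T's => /le_trans; apply.
  apply: le_trans (ler_wpM2l _ (lc y)) _; first by rewrite mulr_ge0// ltW.
  by rewrite mulrA ler_wpM2r.
have err (G : BM R) (U : {linear {poly R} -> bmsp G}) i :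
    close_on (N + projT1 F) k' (real_ext nu) (fun x => `|U x|) -> (i < n)%N ->
    `|U 'X^i - U (s (phi (T 'X^i)))| <= e / 4.
  move=> nuU i_n; have iN : (i < N)%N by rewrite (leq_trans i_n) ?leq_maxl.
  have XN : (size ('X^i : {poly R}) <= N)%N by rewrite size_polyXn.
  have sz : (size ('X^i - s (phi (T 'X^i)) : {poly R})%R <= N + projT1 F)%N.
    rewrite (leq_trans (size_polyD _ _))// size_polyN geq_max size_s andbT.
    by rewrite (leq_trans XN) ?leq_addr.
  have := near G U _ nuU sz; rewrite [T' _]linearB T's T'T// subrr normr0 subr0.
  rewrite normr_id linearB => /le_trans; apply.
  apply: le_trans k'B; rewrite ler_wpM2l// ?mulr_ge0 ?(ltW k'0)//.
  apply: le_trans (l1D _ _) _; rewrite l1N l1X lerD2l.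
  apply: le_trans (lc _) _; rewrite ler_pM2l//.
  have [_ h] := phiE (T 'X^i); apply: le_trans h _.
  rewrite ler_wpM2l ?expR_ge0//.
  by have := TM 'X^i XN; rewrite l1X mulr1.
have [L [i1 [i2 [KL /Emb0P i1N /Emb0P i2N opn]]]] :=
  amalg G1 G2 (T1 \o s) (T2 \o s) K1 K2 (emb _ _ nu1) (emb _ _ nu2).
exists L, i1, i2; split => // i i_n.
pose f : {linear bmsp E -> bmsp L} := (i1 \o (T1 \o s) \o phi) \- (i2 \o (T2 \o s) \o phi).
have fi : `|f (T 'X^i)| <= e / 2.
  apply: le_trans (opnormP _ (fdsp_bounded f)) _.
  apply: le_trans aM; apply: ler_pM; rewrite ?opnorm_ge0//; first exact: ltW.
  have XN : (size ('X^i : {poly R}) <= N)%N by rewrite size_polyXn (leq_trans i_n) ?leq_maxl.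
  by have := TM 'X^i XN; rewrite l1X mulr1.
have e1 := err _ _ _ nu1 i_n; have e2 := err _ _ _ nu2 i_n.
rewrite -i1N linearB in e1; rewrite -i2N linearB distrC in e2.
have -> : i1 (T1 'X^i) - i2 (T2 'X^i) =
    (i1 (T1 'X^i) - i1 (T1 (s (phi (T 'X^i))))) + f (T 'X^i) +
    (i2 (T2 (s (phi (T 'X^i)))) - i2 (T2 'X^i)).
  by rewrite /f /= !addrA !subrK.
apply: le_trans (ler_normD _ _) _; apply: le_trans (lerD (ler_normD _ _) (lexx _)) _.
lra.
Qed.

(** Amalgamating over the guard, a code is moved a little to make room for a
given member of the class; the new part is put behind the old coordinates. *)
Lemma guards_realize mu n m e d (G : BM R) (T : {linear {poly R} -> bmsp G}) n0 k :
  guards (real_ext mu) n m e d -> S mu -> K G -> 0 < k -> 0 <= d ->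
  close_on m d (real_ext mu) (fun x => `|T x|) ->
  exists nu N, [/\ S nu, code_close n0 k mu nu,
    forall x, `|real_ext nu (shift N x) - `|T x| | <= k * l1 x &
    forall i, (i < n)%N -> real_ext nu (shift N 'X^i - 'X^i) <= e + 2 * k].
Proof.
move=> mug Smu KG k0 d0 muT; pose N := maxn (maxn n m) n0.
have nN : (n <= N)%N by rewrite /N -maxnA leq_maxl.
have mN : (m <= N)%N by rewrite /N (maxnC n) -maxnA leq_maxl.
have n0N : (n0 <= N)%N by exact: leq_maxr.
have [E [KE [U pU]]] := code_take_class K_hereditary K_closed N Smu.
have muU (x : {poly R}) : (size x <= N)%N -> real_ext mu x = `|U x|.
  by move=> xN; rewrite -pU /= take_poly_id.
have [|L [i1 [i2 [KL i1N i2N i12]]]] := mug G E T U KG KE muT.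
  by move=> x xm; rewrite muU ?subrr ?normr0 ?mulr_ge0 ?l1_ge0// (leq_trans xm).
pose V : {linear {poly R} -> bmsp L} := (i2 \o U \o take_lin N) \+ (i1 \o T \o drop_lin N).
have Vshift x : V (shift N x) = i1 (T x).
  by rewrite /V /= /shift take_polyMXn_0 drop_polyMXn_id !linear0 add0r.
have Vtake (x : {poly R}) : (size x <= N)%N -> V x = i2 (U x).
  by move=> xN; rewrite /V /= take_poly_id// drop_poly_eq0// !linear0 addr0.
have [nu [Snu _ nuV]] := realize K_hereditary K_closed K_JEP I_norms I_all
  (in_class_norm V KL) k0.
exists nu, N; split => // [x xn0|x|i i_n].
- have xN := leq_trans xn0 n0N; rewrite distrC muU// -i2N -Vtake//; exact: nuV.
- have := nuV (shift N x); rewrite Vshift i1N => /le_trans; apply.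
  by rewrite ler_pM2l// l1_shift.
- have := nuV (shift N 'X^i - 'X^i); rewrite ler_norml => /andP[_].
  rewrite lerBlDl => /le_trans; apply; apply: lerD.
    rewrite linearB Vshift Vtake ?size_polyXn ?(leq_trans i_n)//.
    exact: i12.
  rewrite mulrC ler_pM2r//; apply: le_trans (l1D _ _) _; rewrite l1N.
  by apply: le_trans (lerD (l1_shift _ _) (lexx _)) _; rewrite l1X.
Qed.

End guards.

Section generic.
Context {R : realType} (K : set (BM R)) (I : set (codes R)).
Hypotheses (K_nonempty : K !=set0) (K_hereditary : hereditary K)
  (K_closed : closed K) (K_JEP : JEP K).
Hypotheses (I_norms : infinite_dimensional K -> @Bnorms R `<=` I)
  (I_all : ~ infinite_dimensional K -> I = setT).

Let S := sigma_class K `&` I.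

(** Almost isometric extensions of the first m coordinates are realized almost
isometrically inside the coded space, moving the first n coordinates by at most
e. The realization takes values in the dense subspace of finitely supported
sequences, so the condition does not mention the completion. *)
Definition absorbs_code (mu : codes R) n m (e d : R) :=
  forall G (T : {linear {poly R} -> bmsp G}), K G ->
    close_on m d (real_ext mu) (fun x => `|T x|) ->
  forall N k, 0 < k -> exists U : {linear {poly R} -> {poly R}},
    close_on N k (real_ext mu \o U) (fun x => `|T x|) /\
    forall i, (i < n)%N -> real_ext mu (U 'X^i - 'X^i) <= e.

Definition generic (mu : codes R) : Prop :=
  (forall n e, 0 < e -> exists m d, 0 < d /\ absorbs_code mu n m e d) /\
  exists e d, absorbs_code mu 0 0 e d.

Lemma nowhere_dense_codes (F : set S) :
  (forall x, F x -> forall n k, 0 < k -> exists y : S,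
     code_close n k (\val x) (\val y) /\ exists n1 d1, 0 < d1 /\
       forall z : S, code_close n1 d1 (\val y) (\val z) -> ~ F z) ->
  nowhere_dense F.
Proof.
move=> FF; rewrite /nowhere_dense -subset0 => x.
move=> /nbhs_codeSP[n [d [d0 xF]]].
have d20 : 0 < d / 2 by rewrite divr_gt0.
have xclF : closure F x by apply: xF; apply: close_refl; exact: ltW.
have [x' [Fx' xx']] : F `&` [set y : S | code_close n (d / 2) (\val x) (\val y)] !=set0.
  by apply: xclF; apply/nbhs_codeSP; exists n, (d / 2).
have [y [x'y [n1 [d1 [d10 yF]]]]] := FF x' Fx' n _ d20.
have yclF : closure F y by apply: xF; rewrite (splitr d); exact: close_trans xx' x'y.
have [z [Fz yz]] : F `&` [set z : S | code_close n1 d1 (\val y) (\val z)] !=set0.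
  by apply: yclF; apply/nbhs_codeSP; exists n1, d1.
exact: yF yz Fz.
Qed.

Let inv (k : nat) : R := k.+1%:R^-1.
Let inv0 k : 0 < inv k. Proof. by rewrite invr_gt0. Qed.
Let inv_le e : 0 < e -> exists k, inv k <= e.
Proof.
move=> e0; exists (Num.truncn e^-1); rewrite /inv invf_ple ?posrE// ltW//.
exact: truncnS_gt.
Qed.

(** The next two families are the countably many ways of failing to be generic. *)
Let unguarded n k : set S :=
  [set x | forall m l, ~ guards K (real_ext (\val x)) n m (inv k) (inv l)].

Let unguarded_nowhere_dense n k : GAP K -> nowhere_dense (unguarded n k).
Proof.
move=> KGAP; apply: nowhere_dense_codes => x _ n0 d0 d00.
have [nu [m [d [Snu xnu dpos nug]]]] := guards_dense K_hereditary K_closed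
  K_JEP I_norms I_all n n0 KGAP (set_mem (valP x)) (inv0 k) d00.
exists (exist _ nu (mem_set Snu)); split => //.
exists m, (d / 2); split => [|z nuz zF]; first by rewrite divr_gt0.
have d20 : 0 < d / 2 by rewrite divr_gt0.
have [l ld] := inv_le d20; apply: (zF m l).
move=> G1 G2 T1 T2 K1 K2 z1 z2; apply: (guards_open nuz nug K1 K2).
  exact: close_weak z1.
exact: close_weak z2.
Qed.

Let unrealized (G : BM R) (T : {linear {poly R} -> bmsp G}) n m k l N h : set S :=
  [set x | [/\ guards K (real_ext (\val x)) n m (inv k) (inv l),
    close_on m (inv l) (real_ext (\val x)) (fun x => `|T x|) &
    ~ exists U : {linear {poly R} -> {poly R}},
        close_on N (inv h) (real_ext (\val x) \o U) (fun x => `|T x|) /\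
        forall i, (i < n)%N -> real_ext (\val x) (U 'X^i - 'X^i) <= 2 * inv k]].

Let unrealized_nowhere_dense (G : BM R) (T : {linear {poly R} -> bmsp G})
  n m k l N h : K G -> nowhere_dense (unrealized T n m k l N h).
Proof.
move=> KG; apply: nowhere_dense_codes => x [xg xT _] n0 d0 d00.
(* d serves twice: as the error of nu, and as the radius of the ball around nu in
   which the realization still works. *)
pose d := Num.min d0 (Num.min (inv h / 4) (inv k / 8)).
have dpos : 0 < d by rewrite !lt_min d00 !divr_gt0.
have dd0 : d <= d0 by rewrite ge_min lexx.
have dh : d <= inv h / 4 by rewrite !ge_min lexx orbT.
have dk : d <= inv k / 8 by rewrite !ge_min lexx !orbT.
have [nu [M [Snu xnu nuT nuX]]] := guards_realize K_hereditary K_closed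
  K_JEP I_norms I_all n0 xg (set_mem (valP x)) KG dpos (ltW (inv0 l)) xT.
exists (exist _ nu (mem_set Snu)); split => /=; first exact: close_weak xnu.
exists (M + maxn N n)%N, d; split => // z nuz [_ _]; apply.
have sz (x0 : {poly R}) p : (size x0 <= p)%N -> (p <= maxn N n)%N ->
    (size (shift M x0) <= M + maxn N n)%N.
  by move=> xp pm; apply: size_shift; exact: leq_trans pm.
exists (shift M); split => [y yN|i i_n] /=.
  have h1 := nuT y; have h2 := nuz _ (sz y N yN (leq_maxl _ _)).
  have h3 : d * l1 (shift M y) <= d * l1 y by rewrite ler_pM2l// l1_shift.
  have h4 : d * l1 y <= inv h / 4 * l1 y by rewrite ler_wpM2r// l1_ge0.
  have h5 := mulr_ge0 (ltW (inv0 h)) (l1_ge0 y).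
  rewrite distrC in h2; have -> : real_ext (\val z) (shift M y) - `|T y| =
    (real_ext (\val z) (shift M y) - real_ext nu (shift M y)) +
    (real_ext nu (shift M y) - `|T y|) by ring.
  apply: le_trans (ler_normD _ _) _; lra.
have sX : (size (shift M 'X^i - 'X^i : {poly R})%R <= M + maxn N n)%N.
  rewrite (leq_trans (size_polyD _ _))// size_polyN geq_max.
  rewrite (sz _ n) ?size_polyXn ?leq_maxr//=.
  by rewrite (leq_trans i_n)// (leq_trans (leq_maxr N n)) ?leq_addl.
have l2 : l1 (shift M 'X^i - 'X^i : {poly R}) <= 2.
  apply: le_trans (l1D _ _) _; rewrite l1N.
  by apply: le_trans (lerD (l1_shift _ _) (lexx _)) _; rewrite l1X.
have h1 := nuX i i_n; have h2 := nuz _ sX.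
have h3 : d * l1 (shift M 'X^i - 'X^i) <= d * 2 by rewrite ler_pM2l.
move: h2; rewrite /= ler_norml => /andP[h2 _].
have := inv0 k; rewrite -/(inv k) in h1 *; lra.
Qed.

Lemma generic_comeager : GAP K ->
  exists F : nat -> set S, (forall k, nowhere_dense (F k)) /\
    forall y : S, (forall k, ~ F k y) -> generic (\val y).
Proof.
move=> KGAP; have [G [T [KG Tdense]]] := in_class_separable K_nonempty.
pose J : countType := (nat * nat + nat * nat * nat * nat * nat * nat * nat)%type.
pose F (j : nat) : set S := match (unpickle j : option J) with
  | Some (inl (n, k)) => unguarded n k
  | Some (inr (j, n, m, k, l, N, h)) => unrealized (T j) n m k l N h
  | None => set0 end.
exists F; split => [j|y yF].
  rewrite /F; case: unpickle => [[[n k]|[[[[[[j' n] m] k] l] N] h]]|].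
  - exact: unguarded_nowhere_dense.
  - exact: unrealized_nowhere_dense.
  - by apply: nowhere_dense_codes => x.
have abs n m k l : guards K (real_ext (\val y)) n m (inv k) (inv l) ->
    absorbs_code (\val y) n m (2 * inv k) (inv l / 2).
  move=> yg H U KH yU N e e0.
  pose d := Num.min (e / 2) (inv l / 2).
  have d0 : 0 < d by rewrite lt_min !divr_gt0.
  have [j Uj] := Tdense (norm_pn U) (maxn N m) d d0 (in_class_norm U KH).
  have e20 : 0 < e / 2 by rewrite divr_gt0.
  have [h he] := inv_le e20.
  have nF := yF (pickle (inr (j, n, m, k, l, N, h) : J)).
  rewrite /F pickleK in nF.
  apply: contrapT => nU; apply: nF; split => //.
    rewrite (splitr (inv l)); apply: close_trans yU _.
    by apply: close_weak Uj; rewrite ?leq_maxr// ge_min lexx orbT.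
  move=> [V [VT VX]]; apply: nU; exists V; split => //.
  rewrite (splitr e); apply: close_trans (close_weak (leqnn _) he VT) _.
  apply: close_sym; apply: close_weak Uj; first exact: leq_maxl.
  by rewrite ge_min lexx.
split.
  move=> n e e0; have e20 : 0 < e / 2 by rewrite divr_gt0.
  have [k ke] := inv_le e20.
  have nF := yF (pickle (inl (n, k) : J)); rewrite /F pickleK in nF.
  have [m [l yg]] : exists m l, guards K (real_ext (\val y)) n m (inv k) (inv l).
    apply: contrapT => H; apply: nF => m l yg; apply: H; by exists m, l.
  exists m, (inv l / 2); split; first by rewrite divr_gt0.
  move=> H U KH yU N d d0.
  have [V [V1 V2]] := abs _ _ _ _ yg H U KH yU N d d0.
  exists V; split => // i /V2 /le_trans; apply; lra.
by exists (2 * inv 0), (inv 0 / 2); apply: abs; exact: guards0.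
Qed.

End generic.

(** * Back and forth *)

Section limits.
Context {R : realType}.

Lemma half_small (c d : R) : 0 <= c -> 0 < d ->
  exists k0, forall k, (k0 <= k)%N -> c * 2^-1 ^+ k <= d.
Proof.
move=> c0 d0; exists (Num.truncn (c / d)) => k kk.
rewrite exprVn ler_pdivrMr ?exprn_gt0// mulrC -ler_pdivrMr//.
apply/ltW/(lt_le_trans (truncnS_gt _)); rewrite -natrX ler_nat.
exact: leq_trans (ltn_expl k (ltnSn 1)).
Qed.

Lemma le_eps_mul (a b c : R) : 0 <= c -> (forall t, 0 < t -> a <= b + t * c) -> a <= b.
Proof.
move=> c0 ab; apply/ler_addgt0Pr => t t0.
have c1 : 0 < c + 1 by rewrite ltr_wpDl.
apply: le_trans (ab (t / (c + 1)) (divr_gt0 t0 c1)) _.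
rewrite lerD2l mulrAC ler_pdivrMr// ler_pM2l//; lra.
Qed.

Lemma geometric_limit (X : completeNormedModType R) (a : nat -> X) c k0 :
  (forall k, (k0 <= k)%N -> `|a k.+1 - a k| <= c * 2^-1 ^+ k) ->
  exists l, forall k, (k0 <= k)%N -> `|l - a k| <= 2 * c * 2^-1 ^+ k.
Proof.
move=> ac.
have c0 : 0 <= c.
  have := le_trans (normr_ge0 _) (ac k0 (leqnn _)).
  by rewrite pmulr_lge0// exprn_gt0.
have aj k j : (k0 <= k)%N ->
    `|a (k + j)%N - a k| <= 2 * c * 2^-1 ^+ k - 2 * c * 2^-1 ^+ (k + j).
  move=> kk; elim: j => [|j IH]; first by rewrite addn0 !subrr normr0.
  have := ac (k + j)%N (leq_trans kk (leq_addr _ _)).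
  rewrite addnS => h; apply: le_trans (ler_distD (a (k + j)%N) _ _) _.
  rewrite exprS; lra.
have ab k j : (k0 <= k)%N -> (k <= j)%N -> `|a j - a k| <= 2 * c * 2^-1 ^+ k.
  move=> kk kj; rewrite -(subnKC kj); apply: le_trans (aj _ _ kk) _.
  by rewrite lerBlDr lerDl !mulr_ge0// exprn_ge0.
have acv : cvg (a k @[k --> \oo]).
  apply: cauchy_cvg; apply/cauchyP => e e0.
  have e20 : 0 < e / 2 by rewrite divr_gt0.
  have c20 : 0 <= 2 * c by rewrite mulr_ge0.
  have [N Ne] := half_small c20 e20.
  exists (a (maxn N k0)); exists (maxn N k0) => // j /= Nj.
  rewrite -ball_normE /= distrC.
  apply: le_lt_trans (ab _ _ (leq_maxr _ _) Nj) _.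
  by apply: le_lt_trans (Ne _ (leq_maxl _ _)) _; lra.
exists (lim (a k @[k --> \oo])) => k kk.
apply: (cvgr_to_le (cvg_norm (cvgB acv (cvg_cst (a k))))).
by exists k => // j /= kj; exact: ab.
Qed.

(** Two dense copies of the same pseudonormed space have isometric completions. *)
Lemma extend_isometry (X Y : completeNormedModType R) (V : lmodType R)
    (f : {linear V -> X}) (g : {linear V -> Y}) :
  (forall a, `|f a| = `|g a|) ->
  (forall x d, 0 < d -> exists a, `|f a - x| <= d) ->
  (forall y d, 0 < d -> exists a, `|g a - y| <= d) ->
  exists T : {linear X -> Y}, [/\ forall x, `|T x| = `|x|,
    forall y, exists x, T x = y & forall a, T (f a) = g a].
Proof.
move=> fg fD gD.
pose G (x : X) (y : Y) := forall d, 0 < d -> exists a, `|f a - x| <= d /\ `|g a - y| <= d.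
have Glin c x y x' y' : G x y -> G x' y' -> G (c *: x + x') (c *: y + y').
  move=> xy xy' d d0; have d20 : 0 < d / 2 by rewrite divr_gt0.
  have c0 : 0 < `|c| + 1 by rewrite ltr_wpDl.
  have [a [ax ay]] := xy (d / 2 / (`|c| + 1)) (divr_gt0 d20 c0).
  have [b [bx b_y]] := xy' _ d20; exists (c *: a + b).
  have small (Z : normedModType R) (u v z w : Z) : `|u - z| <= d / 2 / (`|c| + 1) ->
      `|v - w| <= d / 2 -> `|c *: u + v - (c *: z + w)| <= d.
    move=> uz vw; rewrite opprD addrACA -scalerBr (splitr d).
    apply: le_trans (ler_normD _ _) _; apply: lerD => //; rewrite normrZ.
    apply: (@le_trans _ _ ((`|c| + 1) * `|u - z|)); first by rewrite ler_wpM2r// lerDl.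
    by rewrite mulrC -ler_pdivlMr.
  by rewrite (linearP f) (linearP g); split; exact: small.
have Gnorm x y : G x y -> `|x| = `|y|.
  move=> xy; apply/eqP; rewrite -subr_eq0 -normr_le0; apply/ler_addgt0Pr => d d0.
  have d20 : 0 < d / 2 by rewrite divr_gt0.
  have [a [ax ay]] := xy _ d20; rewrite add0r.
  have -> : `|x| - `|y| = (`|x| - `|f a|) + (`|g a| - `|y|) by rewrite fg addrA subrK.
  apply: le_trans (ler_normD _ _) _; rewrite (splitr d); apply: lerD.
    by apply: le_trans (ler_dist_dist _ _) _; rewrite distrC.
  exact: le_trans (ler_dist_dist _ _) _.
have Gfun x y y' : G x y -> G x y' -> y = y'.
  move=> xy xy'; have := Glin (-1) _ _ _ _ xy xy'; rewrite !scaleN1r !addNr => /Gnorm.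
  by rewrite normr0 => /esym/normr0_eq0/eqP; rewrite addrC subr_eq0 => /eqP.
have inv20 k : 0 < 2^-1 ^+ k :> R by rewrite exprn_gt0.
have lift (Z W : completeNormedModType R) (p : {linear V -> Z}) (q : {linear V -> W}) z :
    (forall a, `|p a| = `|q a|) -> (forall z d, 0 < d -> exists a, `|p a - z| <= d) ->
    exists w, forall d, 0 < d -> exists a, `|p a - z| <= d /\ `|q a - w| <= d.
  move=> pq pD; have /choice[a aP] := fun k => pD z _ (inv20 k).
  have [k _|w wP] := @geometric_limit W (q \o a) 2 0%N.
    rewrite /= -linearB -pq linearB.
    apply: le_trans (ler_distD z _ _) _; rewrite [`|z - _|]distrC.
    apply: le_trans (lerD (aP _) (aP _)) _; rewrite exprS.
    by have := inv20 k; lra.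
  exists w => d d0; have [k kP] := half_small (ltW (ltr0n R 4)) d0.
  exists (a k); split.
    apply: le_trans (aP k) _; apply: le_trans (kP k (leqnn _)).
    by have := inv20 k; lra.
  rewrite distrC; apply: le_trans (wP k (leq0n _)) _.
  by apply: le_trans (kP k (leqnn _)); have := inv20 k; lra.
have /choice[T TP] : forall x, exists y, G x y by move=> x; exact: lift.
have TD : linear T.
  move=> c x y; apply: (Gfun (c *: x + y)) (TP _) _; exact: Glin (TP _) (TP _).
pose TL := GRing.isLinear.Build _ _ _ _ T TD.
exists (HB.pack_for {linear X -> Y} T TL); split => [x|y|a] /=.
- by apply/esym/Gnorm.
- have [x xP] : exists x, forall d, 0 < d -> exists a, `|g a - y| <= d /\ `|f a - x| <= d.
    by apply: lift => // a.
  exists x; apply: Gfun (TP x) _ => d d0; have [a [ay ax]] := xP d d0.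
  by exists a.
- apply: Gfun (TP _) _ => d d0; exists a.
  by rewrite !subrr !normr0 ltW.
Qed.

End limits.

Section back_and_forth.
Context {R : realType} (K : set (BM R)).

(** The vectors u e_i of X are guarded, as the unit vectors are in absorbs_code. *)
Definition absorbs (X : normedModType R) (u : {linear {poly R} -> X}) n m (e d : R) :=
  forall G (T : {linear {poly R} -> bmsp G}), K G ->
    close_on m d (fun x => `|u x|) (fun x => `|T x|) ->
  forall N k, 0 < k -> exists U : {linear {poly R} -> X},
    close_on N k (fun x => `|U x|) (fun x => `|T x|) /\
    forall i, (i < n)%N -> `|U 'X^i - u 'X^i| <= e.

Definition absorbing (X : normedModType R) : Prop :=
  forall (u : {linear {poly R} -> X}) n e, 0 < e ->
  exists (u' : {linear {poly R} -> X}) m d,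
    [/\ (forall i, (i < n)%N -> u' 'X^i = u 'X^i), (n <= m)%N, 0 < d &
        absorbs u' n m e d].

Lemma absorbs_weak (X : normedModType R) (u : {linear {poly R} -> X}) n m m' e d d' :
  (m <= m')%N -> d' <= d -> absorbs u n m e d -> absorbs u n m' e d'.
Proof.
move=> mm dd ua G T KG uT; apply: ua => //; exact: close_weak uT.
Qed.

Lemma eq_on_X (V : lmodType R) (u v : {linear {poly R} -> V}) n (x : {poly R}) :
  (forall i, (i < n)%N -> u 'X^i = v 'X^i) -> (size x <= n)%N -> u x = v x.
Proof.
move=> uv xn; rewrite !(linear_sumX _ xn); apply: eq_bigr => i _.
by rewrite uv.
Qed.

(** The guarded pair (u, v) becomes, with the roles of the two spaces exchanged,
the guarded pair (v', u'): first v is guarded in Y, then its guard is absorbed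
in X, at the price of moving u a little. *)
Lemma back_step (X Y : normedModType R) (u : {linear {poly R} -> X})
    (v : {linear {poly R} -> Y}) n m e d (y : Y) e1 :
  Age Y `<=` K -> absorbing Y -> absorbs u n m e d ->
  close_on m d (fun x => `|u x|) (fun x => `|v x|) -> 0 < e1 ->
  exists (v' : {linear {poly R} -> Y}) (u' : {linear {poly R} -> X}) m' d',
    [/\ absorbs v' m.+1 m' e1 d' /\ (m.+1 <= m')%N, 0 < d' /\ d' <= e1,
        close_on m' d' (fun x => `|v' x|) (fun x => `|u' x|),
        (forall i, (i < m)%N -> v' 'X^i = v 'X^i) /\ v' 'X^m = y &
        forall i, (i < n)%N -> `|u' 'X^i - u 'X^i| <= e].
Proof.
move=> YK Yabs uabs uv e10.
pose v1 : {linear {poly R} -> Y} := linX (fun i => if (i < m)%N then v 'X^i else y).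
have v1X i : v1 'X^i = if (i < m)%N then v 'X^i else y by exact: linXX.
have [v' [m' [d1 [v'v1 mm' d10 v'abs]]]] := Yabs v1 m.+1 e1 e10.
pose d' := Num.min d1 e1.
have d'0 : 0 < d' by rewrite lt_min d10.
have v'v i : (i < m)%N -> v' 'X^i = v 'X^i.
  by move=> im; rewrite v'v1 ?(leqW im)// v1X im.
have [G [KG [T vT]]] := @Age_in_class _ K Y v' m' YK.
have {}vT (x : {poly R}) : (size x <= m')%N -> `|v' x| = `|T x|.
  by move=> xm; rewrite -vT take_poly_id.
have [|U [UT Uu]] := uabs G T KG _ m' d' d'0.
  move=> x xm; rewrite -vT ?(leq_trans xm) 1?ltnW//.
  by rewrite (eq_on_X v'v xm); exact: uv.
exists v', U, m', d'; split => //.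
- by split => //; apply: absorbs_weak v'abs => //; rewrite ge_min lexx.
- by split => //; rewrite ge_min lexx orbT.
- by move=> x xm; rewrite vT// distrC; exact: UT.
- by split => //; rewrite v'v1// v1X ltnn.
Qed.

(** Along the iteration of back_step, u and v change by errors that sum up, so
they converge on each unit vector, and the limits U and V define the same
pseudonorm. At step k the vectors dX k and dY k are put into the ranges, which
therefore are dense in the limit. *)
Lemma back_and_forth (X Y : completeNormedModType R) (dX : nat -> X) (dY : nat -> Y)
    (u : {linear {poly R} -> X}) (v : {linear {poly R} -> Y}) n m e d :
  Age X `<=` K -> Age Y `<=` K -> absorbing X -> absorbing Y ->
  (forall x d N, 0 < d -> exists2 k, (N <= k)%N & `|dX k - x| <= d) ->
  (forall y d N, 0 < d -> exists2 k, (N <= k)%N & `|dY k - y| <= d) ->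
  absorbs u n m e d -> (n <= m)%N -> 0 < e ->
  close_on m d (fun x => `|u x|) (fun x => `|v x|) ->
  exists T : {linear X -> Y}, [/\ forall x, `|T x| = `|x|,
    forall y, exists x, T x = y &
    forall i, (i < n)%N -> `|T (u 'X^i) - v 'X^i| <= 4 * e].
Proof.
move=> XK YK Xabs Yabs dXD dYD uabs nm e0 uv.
pose E k : R := e * 2^-1 ^+ k.
have E0 k : 0 < E k by rewrite mulr_gt0// exprn_gt0.
have ES k : E k.+1 = E k / 2 by rewrite /E exprS; ring.
pose St := ({linear {poly R} -> X} * {linear {poly R} -> Y} * (nat * nat) * R)%type.
pose P k (s : St) := let: (u, v, (n, m), d) := s in
  [/\ absorbs u n m (E k) d, (k <= n)%N, (n <= m)%N &
      close_on m d (fun x => `|u x|) (fun x => `|v x|)].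
pose Q k (s s' : St) := let: (u, v, (n, m), d) := s in
  let: (u', v', (n', m'), d') := s' in
  [/\ (m < n')%N /\ d' <= E k.+1, forall i, (i < n)%N -> `|u' 'X^i - u 'X^i| <= E k,
      forall i, (i < m)%N -> `|v' 'X^i - v 'X^i| <= E k,
      `|v' 'X^m - dY k| <= E k & exists2 i, (i < n')%N & u' 'X^i = dX k].
have [||f [f0 fP]] := @dependent_choice_nat St P Q (u, v, (n, m), d).
- by split => //; rewrite /E expr0 mulr1.
- move=> k [[[u0 v0] [n0 m0]] d0] [u0abs kn0 nm0 uv0].
  have [v1 [u1 [m1 [d1 [[v1abs mm1] [d10 d1e] vu1 [v1v0 v1m] u1u0]]]]] :=
    back_step (dY k) YK Yabs u0abs uv0 (E0 k.+1).
  have [u2 [v2 [m2 [d2 [[u2abs mm2] [d20 d2e] uv2 [u2u1 u2m] v2v1]]]]] :=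
    back_step (dX k) XK Xabs v1abs vu1 (E0 k.+1).
  have EE : E k.+1 <= E k by rewrite ES; have := E0 k; lra.
  exists (u2, v2, (m1.+1, m2), d2); split => /=; split => //.
  + by rewrite ltnS (leq_trans kn0)// (leq_trans nm0)// ltnW.
  + by split => //; rewrite ltnS ltnW.
  + by move=> i i_n; rewrite u2u1 ?u1u0// (leq_trans i_n)// (leq_trans nm0)// ltnW.
  + by move=> i im; rewrite -v1v0// (le_trans _ EE)// v2v1// ltnW.
  + by rewrite -v1m (le_trans _ EE)// v2v1.
  + by exists m1.
pose uk k := (f k).1.1.1; pose vk k := (f k).1.1.2.
pose nk k := (f k).1.2.1; pose mk k := (f k).1.2.2; pose dk k := (f k).2.
have PP k : [/\ absorbs (uk k) (nk k) (mk k) (E k) (dk k), (k <= nk k)%N,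
    (nk k <= mk k)%N & close_on (mk k) (dk k) (fun x => `|uk k x|) (fun x => `|vk k x|)].
  have [+ _] := fP k; rewrite /uk /vk /nk /mk /dk.
  by case: (f k) => [[[? ?] [? ?]] ?].
have QQ k : [/\ (mk k < nk k.+1)%N /\ dk k.+1 <= E k.+1,
    forall i, (i < nk k)%N -> `|uk k.+1 'X^i - uk k 'X^i| <= E k,
    forall i, (i < mk k)%N -> `|vk k.+1 'X^i - vk k 'X^i| <= E k,
    `|vk k.+1 'X^(mk k) - dY k| <= E k &
    exists2 i, (i < nk k.+1)%N & uk k.+1 'X^i = dX k].
  have [_] := fP k; rewrite /uk /vk /nk /mk /dk.
  by case: (f k) => [[[? ?] [? ?]] ?]; case: (f k.+1) => [[[? ?] [? ?]] ?].
have nmono j k : (j <= k)%N -> (nk j <= nk k)%N.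
  move=> jk; rewrite -(subnK jk); elim: (k - j)%N => // i IH.
  rewrite addSn; apply: leq_trans IH _.
  have [_ _ h _] := PP (i + j)%N; have [[h' _] _ _ _ _] := QQ (i + j)%N.
  exact: leq_trans h (ltnW h').
have limX i : exists l, forall k, (i < nk k)%N -> `|l - uk k 'X^i| <= 2 * E k.
  have ex : exists k, (i < nk k)%N by exists i.+1; have [_ ? _ _] := PP i.+1.
  have ki := ex_minnP ex; case: ki => k0 k0i k0min.
  have [k kk|l lP] := @geometric_limit _ X (fun k => uk k 'X^i) e k0.
    by have [_ h _ _ _] := QQ k; apply: h; exact: leq_trans k0i (nmono _ _ kk).
  by exists l => k ik; rewrite /E mulrA; apply: lP; exact: k0min.
have limY i : exists l, forall k, (i < nk k)%N -> `|l - vk k 'X^i| <= 2 * E k.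
  have ex : exists k, (i < nk k)%N by exists i.+1; have [_ ? _ _] := PP i.+1.
  have ki := ex_minnP ex; case: ki => k0 k0i k0min.
  have [k kk|l lP] := @geometric_limit _ Y (fun k => vk k 'X^i) e k0.
    have [_ _ h _ _] := QQ k; apply: h; apply: leq_trans k0i _.
    by have [_ _ h _] := PP k; exact: leq_trans (nmono _ _ kk) h.
  by exists l => k ik; rewrite /E mulrA; apply: lP; exact: k0min.
have [a aP] := choice limX; have [b bP] := choice limY.
pose U : {linear {poly R} -> X} := linX a.
pose V : {linear {poly R} -> Y} := linX b.
have UX i : U 'X^i = a i by exact: linXX.
have VX i : V 'X^i = b i by exact: linXX.
have UV x : `|U x| = `|V x|.
  apply/eqP; rewrite -subr_eq0 -normr_le0; apply/ler_addgt0Pr => t t0; rewrite add0r.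
  have c0 : 0 <= 5 * e * l1 x by rewrite !mulr_ge0 ?l1_ge0 ?ltW.
  have [k0 k0P] := half_small c0 t0.
  pose k := (maxn k0 (size x)).+1.
  have xn : (size x <= nk k)%N.
    by have [_ h _ _] := PP k; rewrite (leq_trans _ h)// /k leqW// leq_maxr.
  have h1 : `| `|U x| - `|uk k x| | <= 2 * E k * l1 x.
    by apply: (@close_norm _ _ U (uk k) (nk k)) => // i i_n; rewrite UX aP.
  have h2 : `| `|V x| - `|vk k x| | <= 2 * E k * l1 x.
    by apply: (@close_norm _ _ V (vk k) (nk k)) => // i i_n; rewrite VX bP.
  have h3 : `| `|uk k x| - `|vk k x| | <= E k * l1 x.
    have [_ _ nm' h] := PP k; apply: le_trans (h x (leq_trans xn nm')) _.
    by rewrite ler_wpM2r ?l1_ge0//; have [[_ ?] _ _ _ _] := QQ (maxn k0 (size x)).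
  have h4 : 5 * E k * l1 x <= t.
    have := k0P k (leqW (leq_maxl _ _)); rewrite /E; lra.
  rewrite distrC in h2.
  have -> : `|U x| - `|V x| = (`|U x| - `|uk k x|) + (`|uk k x| - `|vk k x|) +
    (`|vk k x| - `|V x|) by ring.
  apply: le_trans (ler_normD _ _) _; apply: le_trans (lerD (ler_normD _ _) (lexx _)) _.
  lra.
have UD x t : 0 < t -> exists z, `|U z - x| <= t.
  move=> t0; have t20 : 0 < t / 2 by rewrite divr_gt0.
  have [k0 k0P] := half_small (ltW e0) t20.
  have [k kk dkx] := dXD x _ k0 t20.
  have [_ _ _ _ [i i_n ui]] := QQ k; exists 'X^i.
  rewrite UX (splitr t); apply: le_trans (ler_distD (dX k) _ _) _; apply: lerD => //.
  rewrite -ui; apply: le_trans (aP i _ i_n) _; rewrite ES.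
  have := k0P k kk; rewrite -/(E k); lra.
have VD y t : 0 < t -> exists z, `|V z - y| <= t.
  move=> t0; have t20 : 0 < t / 2 by rewrite divr_gt0.
  have c0 : 0 <= 2 * e by rewrite mulr_ge0// ltW.
  have [k0 k0P] := half_small c0 t20.
  have [k kk dky] := dYD y _ k0 t20.
  have [[mn _] _ _ vm _] := QQ k; exists 'X^(mk k).
  rewrite VX (splitr t); apply: le_trans (ler_distD (dY k) _ _) _; apply: lerD => //.
  apply: le_trans (ler_distD (vk k.+1 'X^(mk k)) _ _) _.
  apply: le_trans (lerD (bP _ _ mn) vm) _; rewrite ES.
  have := k0P k kk; rewrite -mulrA -/(E k); lra.
have [T [TN TS TU]] := extend_isometry UV UD VD.
exists T; split => // i i_n.
have n0 : nk 0%N = n by rewrite /nk f0.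
have h1 : `|U 'X^i - u 'X^i| <= 2 * e.
  have := aP i 0%N; rewrite n0 => /(_ i_n).
  by rewrite UX /E expr0 mulr1 /uk f0.
have h2 : `|V 'X^i - v 'X^i| <= 2 * e.
  have := bP i 0%N; rewrite n0 => /(_ i_n).
  by rewrite VX /E expr0 mulr1 /vk f0.
apply: le_trans (ler_distD (T (U 'X^i)) _ _) _.
rewrite -linearB TN TU [X in X + _]distrC.
apply: le_trans (lerD h1 h2) _; lra.
Qed.

End back_and_forth.

(** * Spaces with generic codes *)

Section absorbing_spaces.
Context {R : realType} (K : set (BM R)).

(** Only tuples in a dense subspace need to be guarded: an arbitrary tuple u is
approximated there, and the guard of u consists of u followed by the guard of
the approximation. *)
Lemma absorbing_dense (X : normedModType R) (f : {linear {poly R} -> X}) :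
  (forall x d, 0 < d -> exists y, `|f y - x| <= d) ->
  (forall n e, 0 < e -> exists m d, 0 < d /\ absorbs K f n m e d) ->
  absorbing K X.
Proof.
move=> fD fabs u n e e0; pose t := e / 5.
have t0 : 0 < t by rewrite divr_gt0.
have [a aP] := choice (fun i => fD (u 'X^i) _ t0).
pose N' := \max_(i < n) size (a i).
pose c := 1 + \sum_(i < n) l1 (a i).
have aN i : (i < n)%N -> (size (a i) <= N')%N.
  by move=> i_n; exact: (@leq_bigmax _ (fun i : 'I_n => size (a i)) (Ordinal i_n)).
have c0 : 0 < c by rewrite ltr_pwDl// sumr_ge0// => i _; exact: l1_ge0.
have ac i : (i < n)%N -> 1 + l1 (a i) <= c.
  move=> i_n; rewrite lerD2l (bigD1 (Ordinal i_n))//= lerDl sumr_ge0// => j _.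
  exact: l1_ge0.
have e'0 : 0 < t / c by rewrite divr_gt0.
have [m0 [d0 [d00 fabs0]]] := fabs N' _ e'0.
pose m' := maxn m0 N'; pose d := Num.min d0 (t / c).
have dpos : 0 < d by rewrite lt_min d00.
have fabs' : absorbs K f N' m' (t / c) d.
  by apply: absorbs_weak fabs0; rewrite ?leq_maxl// ge_min lexx.
pose u' : {linear {poly R} -> X} :=
  linX (fun i => if (i < n)%N then u 'X^i else f 'X^(i - n)).
have u'X i : u' 'X^i = if (i < n)%N then u 'X^i else f 'X^(i - n) by exact: linXX.
have u'shift x : u' (shift n x) = f x.
  rewrite (poly_sumX (leqnn (size x))) !linear_sum; apply: eq_bigr => i _.
  rewrite !linearZ/=; congr (_ *: _).
  by rewrite /shift -exprD u'X ltnNge leq_addl/= addnK.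
exists u', (n + m')%N, d; split => // [i i_n||G T KG uT N k k0].
- by rewrite u'X i_n.
- exact: leq_addr.
pose T' : {linear {poly R} -> bmsp G} :=
  (T \o shift n \o take_lin m') \+ (T \o drop_lin m').
have T'shift x : T' (shift m' x) = T x.
  by rewrite /T' /= /shift take_polyMXn_0 drop_polyMXn_id mul0r linear0 add0r.
have T'take (x : {poly R}) : (size x <= m')%N -> T' x = T (shift n x).
  by move=> xm; rewrite /T' /= take_poly_id// drop_poly_eq0// linear0 addr0.
have fT' : close_on m' d (fun x => `|f x|) (fun x => `|T' x|).
  move=> x xm; rewrite T'take// -u'shift.
  apply: le_trans (uT _ (size_shift n xm)) _.
  by rewrite ler_pM2l// l1_shift.
pose k' := Num.min k (t / c).
have k'0 : 0 < k' by rewrite lt_min k0.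
have [V [VT' Vf]] := fabs' G T' KG fT' (m' + maxn N n)%N k' k'0.
exists (V \o shift m'); split => [x xN|i i_n] /=.
  rewrite -T'shift; apply: le_trans (VT' _ _) _.
    by apply: leq_trans (size_shift m' xN) _; rewrite leq_add2l leq_maxl.
  rewrite (@le_trans _ _ (k' * l1 x))//; first by rewrite ler_pM2l// l1_shift.
  by rewrite ler_wpM2r ?l1_ge0// ge_min lexx.
have am : (size (a i) <= m')%N by rewrite (leq_trans (aN i i_n))// leq_maxr.
pose z : {poly R} := shift m' 'X^i - a i.
have zc : l1 z <= c.
  apply: le_trans (ac i i_n); apply: le_trans (l1D _ _) _; rewrite l1N lerD2r.
  by apply: le_trans (l1_shift _ _) _; rewrite l1X.
have zs : (size z <= m' + maxn N n)%N.
  rewrite (leq_trans (size_polyD _ _))// size_polyN geq_max; apply/andP; split.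
    by rewrite size_shift// size_polyXn (leq_trans i_n)// leq_maxr.
  by rewrite (leq_trans am)// leq_addr.
(* The error is at most 5 t: one t for approximating u by a, one for moving a,
   and three for z, which is almost null. *)
have Vz : `|V z| <= 3 * t.
  have h1 := VT' z zs; rewrite ler_norml in h1; have /andP[_ {}h1] := h1.
  have T'z : T' z = T ('X^i - shift n (a i)) by rewrite /z !linearB T'shift T'take.
  have ys : (size ('X^i - shift n (a i) : {poly R})%R <= n + m')%N.
    rewrite (leq_trans (size_polyD _ _))// size_polyN geq_max size_shift//.
    by rewrite size_polyXn (leq_trans i_n)// leq_addr.
  have := uT _ ys; rewrite -T'z linearB u'shift u'X i_n => h2.
  rewrite ler_norml in h2; have /andP[{}h2 _] := h2.
  have lc : l1 ('X^i - shift n (a i)) <= c.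
    apply: le_trans (ac i i_n); apply: le_trans (l1D _ _) _; rewrite l1N l1X lerD2l.
    exact: l1_shift.
  have h3 := aP i; rewrite distrC in h3.
  have tc : t / c * c = t by rewrite divfK// gt_eqF.
  have h4 : k' * l1 z <= t.
    rewrite -tc; apply: ler_pM; rewrite ?l1_ge0 ?(ltW k'0)//.
    by rewrite ge_min lexx orbT.
  have h5 : d * l1 ('X^i - shift n (a i)) <= t.
    rewrite -tc; apply: ler_pM; rewrite ?l1_ge0 ?(ltW dpos)//.
    by rewrite ge_min lexx orbT.
  lra.
have Va : `|V (a i) - f (a i)| <= t.
  apply: le_trans (@norm_le_l1 _ _ (V \- f) N' (t / c) (a i) (aN i i_n) Vf) _.
  rewrite mulrAC ler_pdivrMr// ler_pM2l//.
  by have := ac i i_n; lra.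
have -> : V (shift m' 'X^i) - u' 'X^i = V z + (V (a i) - f (a i)) + (f (a i) - u 'X^i).
  by rewrite /z linearB u'X i_n !addrA !subrK.
apply: le_trans (ler_normD _ _) _; apply: le_trans (lerD (ler_normD _ _) (lexx _)) _.
have := aP i; rewrite (_ : e = 5 * t); last by rewrite /t; field.
lra.
Qed.

(** Two copies of the guard of E are moved onto the guard itself by isometries
of the space, which are close to the embeddings on E. *)
Lemma absorbing_guarded_fraisse (X : completeNormedModType R) (dX : nat -> X) :
  Age X `<=` K -> absorbing K X ->
  (forall x d N, 0 < d -> exists2 k, (N <= k)%N & `|dX k - x| <= d) ->
  forall (E : fdsubspace X) (e : R), 0 < e ->
  exists (d : R) (F : fdsubspace X) (EF : E `<=` F), 0 < d /\
    forall i i' : {linear fdspace F -> X},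
      Emb d (fdspace F) X i -> Emb d (fdspace F) X i' ->
    exists2 T : {linear X -> X}, Iso X T &
      opnorm (fun x : fdspace E => i' (fdinc EF x) - T (i (fdinc EF x))) < e.
Proof.
move=> XK Xabs dXD E e e0; have [n [b bE]] := fdsubspaceP E.
pose u0 : {linear {poly R} -> X} :=
  linX (fun i => if (insub i : option 'I_n) is Some j then b j else 0).
have u0E (x : {poly R}) : (size x <= n)%N -> u0 x = \sum_(i < n) x`_i *: b i.
  by move=> xn; rewrite /u0 /= (linXE _ xn); apply: eq_bigr => i _; rewrite valK.
have [c c0 lift] := bounded_lift u0 n.
pose t := e / (16 * c).
have t0 : 0 < t by rewrite divr_gt0// mulr_gt0.
have tc : 8 * t * c = e / 2 by rewrite /t; field; rewrite gt_eqF.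
have [u [m [d [uu0 nm d0 uabs]]]] := Xabs u0 n t t0.
have Ffin : finite_dim (fun x => exists2 z : {poly R}, (size z <= m)%N & u z = x).
  exists m, (fun i : 'I_m => u 'X^i); apply/seteqP; split => x /=.
    by move=> [z zm <-]; exists (fun i : 'I_m => z`_i) => //; rewrite (linear_sumX u zm).
  move=> [a _ <-]; exists (\sum_(i < m) a i *: 'X^i).
    apply: (leq_trans (size_sum _ _ _)); apply/bigmax_leqP => i _.
    by rewrite (leq_trans (size_scale_leq _ _))// size_polyXn.
  by rewrite linear_sum; apply: eq_bigr => i _; rewrite linearZ.
pose F : fdsubspace X := FdSubspace Ffin.
have EF : E `<=` F.
  rewrite bE => x [a _ <-]; pose z := \poly_(i < n) (if insub i is Some j then a j else 0).
  have zn : (size z <= n)%N by exact: size_poly.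
  exists z; first exact: leq_trans nm.
  rewrite (eq_on_X uu0 zn) u0E//; apply: eq_bigr => i _.
  by rewrite coef_poly ltn_ord valK.
have [M M0 uM] := norm_bound u m.
pose r := ln (1 + d / M).
have dM : 0 < d / M by rewrite divr_gt0.
have r0 : 0 < r by rewrite ln_gt0// ltrDl.
have rM : (expR r - 1) * M = d.
  by rewrite /r lnK ?posrE ?addr_gt0// addrAC subrr add0r divfK// gt_eqF.
have wP (x : {poly R}) : u (take_poly m x) \in fdsubspace_pred F.
  by apply/mem_set; exists (take_poly m x) => //; exact: size_take_poly.
pose w0 (x : {poly R}) : fdspace F :=
  exist (fun y => y \in fdsubspace_pred F) _ (wP x).
have wlin : linear w0.
  by move=> a x y; apply: val_inj; rewrite /= [take_poly _ _](linearP (take_lin m)) linearP.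
pose wL := GRing.isLinear.Build _ _ _ _ w0 wlin.
pose w : {linear {poly R} -> fdspace F} := HB.pack_for {linear {poly R} -> fdspace F} w0 wL.
have wN (x : {poly R}) : (size x <= m)%N -> `|w x| = `|u x|.
  by move=> xm; rewrite fdspace_normE /= take_poly_id.
exists r, F, EF; split => // i i' iE i'E.
have move_guard (j : {linear fdspace F -> X}) : Emb r (fdspace F) X j ->
    exists T : {linear X -> X}, [/\ forall x, `|T x| = `|x|,
      forall y, exists x, T x = y &
      forall i, (i < n)%N -> `|T (u 'X^i) - j (w 'X^i)| <= 4 * t].
  move=> jE; apply: (@back_and_forth _ K X X dX dX u (j \o w) n m t d) => //.
  move=> x xm; rewrite distrC -wN// (le_trans (Emb_dist _ (ltW r0) jE))//.
  rewrite wN// -rM -mulrA ler_wpM2l ?uM//.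
  by rewrite subr_ge0 -expR0 ler_expR ltW.
have [P [PN PS Pw]] := move_guard i iE.
have [P' [P'N P'S P'w]] := move_guard i' i'E.
have [Q [QN PK QK]] := isometry_inverse PN PS.
exists (P' \o Q).
  split => [x|y] /=; first by rewrite P'N QN.
  by have [x <-] := P'S y; exists (P x); rewrite PK.
apply: (@le_lt_trans _ _ (8 * t * c)); last by rewrite tc; lra.
have tc0 : 0 <= 8 * t * c by rewrite tc ltW// divr_gt0.
apply: opnorm_le => [//|x].
have [y yn yx] : exists2 y : {poly R}, (size y <= n)%N & u0 y = val x.
  have /set_mem := valP x; rewrite bE => -[a _ ax].
  exists (\poly_(i < n) (if insub i is Some j then a j else 0)); first exact: size_poly.
  rewrite u0E ?size_poly// -ax; apply: eq_bigr => k _.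
  by rewrite coef_poly ltn_ord valK.
have [z [zn zy lz]] := lift y yn; rewrite yx in lz zy.
have xw : fdinc EF x = w z.
  apply: val_inj; rewrite /= take_poly_id; last exact: leq_trans nm.
  by rewrite -zy (eq_on_X uu0 zn).
rewrite xw; have h1 : `|i' (w z) - P' (u z)| <= 4 * t * l1 z.
  apply: (@norm_le_l1 _ _ ((i' \o w) \- (P' \o u)) n _ _ zn) => k kn.
  by rewrite distrC; exact: P'w.
have h2 : `|P (u z) - i (w z)| <= 4 * t * l1 z.
  apply: (@norm_le_l1 _ _ ((P \o u) \- (i \o w)) n _ _ zn) => k kn.
  exact: Pw.
have -> : i' (w z) - (P' \o Q) (i (w z)) =
    (i' (w z) - P' (u z)) + P' (Q (P (u z) - i (w z))).
  by rewrite [X in _ = _ + P' X]linearB PK linearB /= addrA subrK.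
apply: le_trans (ler_normD _ _) _; rewrite P'N QN.
apply: le_trans (lerD h1 h2) _.
have -> : 4 * t * l1 z + 4 * t * l1 z = 8 * t * l1 z by ring.
by rewrite -[leRHS]mulrA ler_wpM2l// mulr_ge0// ltW.
Qed.

End absorbing_spaces.

Section rational_density.
Context {R : realType}.

Lemma rat_dense (x : {poly R}) d : 0 < d ->
  exists v, (size (rat_inc R v) <= size x)%N /\ l1 (rat_inc R v - x) <= d.
Proof.
move=> d0; pose n := size x; pose e := d / n.+1%:R.
have e0 : 0 < e by rewrite divr_gt0.
have /choice[r rx] : forall i : nat, exists r : rat, `|x`_i - ratr r| <= e.
  move=> i; have [r] := @rat_in_itvoo R (x`_i - e) (x`_i + e) (ltac:(lra)).
  rewrite in_itv/= => /andP[q1 q2]; exists r.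
  by rewrite ler_norml; apply/andP; split; lra.
have vs : (size (rat_inc R (\poly_(i < n) r i)) <= n)%N.
  by rewrite (leq_trans (size_poly _ _))// size_poly.
exists (\poly_(i < n) r i); split => //; rewrite (@l1E _ n); last first.
  by rewrite (leq_trans (size_polyD _ _))// size_polyN geq_max leqnn andbT.
apply: (@le_trans _ _ (\sum_(i < n) e)).
  apply: ler_sum => i _; rewrite coefB coef_map/= coef_poly ltn_ord distrC.
  exact: rx.
rewrite sumr_const card_ord -mulr_natl /e mulrCA ler_piMr ?ltW//.
by rewrite ltr_pdivrMr// mul1r ltr_nat.
Qed.

Lemma injective_unbounded (g : nat -> nat) N : injective g -> exists j, (N <= g j)%N.
Proof.
move=> ginj; apply: contrapT => H.
have gN j : (g j < N)%N by rewrite ltnNge; apply/negP => Nj; apply: H; exists j.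
have : injective (fun j : 'I_N.+1 => Ordinal (gN j)).
  by move=> i j /(congr1 val) /= /ginj; exact: val_inj.
by move=> /leq_card; rewrite !card_ord ltnn.
Qed.

Lemma dense_sequence (X : normedModType R) (f : {linear {poly R} -> X}) :
  (forall x d, 0 < d -> exists y, `|f y - x| <= d) ->
  exists dX : nat -> X,
    forall x d N, 0 < d -> exists2 k, (N <= k)%N & `|dX k - x| <= d.
Proof.
move=> fD; pose J : countType := ({poly rat} * nat)%type.
exists (fun k => if (unpickle k : option J) is Some (v, _) then f (rat_inc R v) else 0).
move=> x d N d0; have d20 : 0 < d / 2 by rewrite divr_gt0.
have [y yx] := fD x _ d20.
have [M M0 fM] := norm_bound f (size y).
have dM : 0 < d / 2 / M by rewrite divr_gt0.
have [v [vs vy]] := rat_dense y dM.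
have [j Nj] : exists j, (N <= pickle ((v, j) : J))%N.
  by apply: injective_unbounded => i j /(pcan_inj pickleK) [].
exists (pickle ((v, j) : J)) => //; rewrite pickleK (splitr d).
apply: le_trans (ler_distD (f y) _ _) _; apply: lerD => //.
rewrite -linearB; apply: le_trans (fM _ _) _.
  by rewrite (leq_trans (size_polyD _ _))// size_polyN geq_max vs leqnn.
by rewrite mulrC -ler_pdivlMr.
Qed.

End rational_density.

Section generic_spaces.
Context {R : realType} (K : set (BM R)) (K_closed : closed K).
Implicit Types (mu nu : codes R).

Lemma absorbs_Xin mu n m e d : absorbs_code K mu n m e d ->
  absorbs K (Xin mu) n m e d.
Proof.
move=> mua G T KG muT N k k0; have [|U [UT UX]] := mua G T KG _ N k k0.
  by move=> x xm; rewrite -Xin_norm muT.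
exists (Xin mu \o U); split => [x xN|i i_n].
  by have := UT x xN; rewrite /= -Xin_norm.
by have := UX i i_n; rewrite -Xin_norm linearB.
Qed.

Lemma generic_absorbing mu : generic K mu -> absorbing K (Xcode mu).
Proof.
move=> [mua _]; apply: (@absorbing_dense _ _ _ (Xin mu)) => [x d|n e e0].
  exact: Xin_dense.
have [m [d [d0 mud]]] := mua n e e0; exists m, d; split => //.
exact: absorbs_Xin.
Qed.

Lemma absorbs_universal (X : normedModType R) (f : {linear {poly R} -> X}) e d G
    (T : {linear {poly R} -> bmsp G}) N k :
  absorbs K f 0 0 e d -> K G -> 0 < k ->
  exists U : {linear {poly R} -> X}, close_on N k (fun x => `|U x|) (fun x => `|T x|).
Proof.
move=> fabs KG k0; have [|U [UT _]] := fabs G T KG _ N k k0; last by exists U.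
exact: (close_on0 _ (norm_pn f) (norm_pn T)).
Qed.

Lemma generic_universal mu G (T : {linear {poly R} -> bmsp G}) N k :
  generic K mu -> K G -> 0 < k ->
  exists U : {linear {poly R} -> Xcode mu}, close_on N k (fun x => `|U x|) (fun x => `|T x|).
Proof. by move=> [_ [e [d /absorbs_Xin mua]]]; exact: absorbs_universal mua. Qed.

Lemma dense_seq_separable (X : normedModType R) (dX : nat -> X) :
  (forall x d N, 0 < d -> exists2 k, (N <= k)%N & `|dX k - x| <= d) ->
  separable_space X.
Proof.
move=> dXD; exists (range dX); first exact: card_image_le.
move=> O [x Ox] oO; have := open_nbhs_nbhs (conj oO Ox).
move=> /nbhs_ballP[e /= e0 eO]; have e20 : 0 < e / 2 by rewrite divr_gt0.
have [k _ kx] := dXD x _ 0%N e20; exists (dX k); split; last by exists k.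
apply: eO; rewrite -ball_normE /= distrC; apply: le_lt_trans kx _; lra.
Qed.

Lemma absorbing_isometric (X Y : completeNormedModType R) (dX : nat -> X) (dY : nat -> Y) :
  Age X `<=` K -> Age Y `<=` K -> absorbing K X -> absorbing K Y ->
  (forall x d N, 0 < d -> exists2 k, (N <= k)%N & `|dX k - x| <= d) ->
  (forall y d N, 0 < d -> exists2 k, (N <= k)%N & `|dY k - y| <= d) ->
  (forall G (T : {linear {poly R} -> bmsp G}) N k, K G -> 0 < k ->
    exists U : {linear {poly R} -> Y}, close_on N k (fun x => `|U x|) (fun x => `|T x|)) ->
  isometric X Y.
Proof.
move=> XK YK XA YA dXD dYD Yuniv.
have [u [m [d [_ nm d0 uabs]]]] := XA \0 0%N 1 ltr01.
have [G [KG [T uT]]] := @Age_in_class _ K _ u m XK.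
have [v vT] := Yuniv G T m d KG d0.
have uv : close_on m d (fun x => `|u x|) (fun x => `|v x|).
  move=> x xm; rewrite distrC.
  have -> : `|u x| = `|T x| by rewrite -uT take_poly_id.
  exact: vT.
have [S [SN SS _]] := back_and_forth XK YK XA YA dXD dYD uabs nm ltr01 uv.
by exists S.
Qed.

Lemma universal_Age_cl (X : normedModType R) : Age X `<=` K ->
  (forall G (T : {linear {poly R} -> bmsp G}) N k, K G -> 0 < k ->
    exists U : {linear {poly R} -> X}, close_on N k (fun x => `|U x|) (fun x => `|T x|)) ->
  Age_cl X = K.
Proof.
move=> XK Xuniv; apply/seteqP; split => E.
  by move=> /(closureS XK); exact: K_closed.
move=> KE; apply: closure_approx => d d0.
have [c c0 lc] := l1_fdsp (bm_vec E : {linear fdsp _ -> _}).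
have dc : 0 < d / c by rewrite divr_gt0.
have [U UT] := Xuniv E (bm_coord E) (projT1 E) _ KE dc.
exists X, (U \o bm_vec E); split => [E' XE'|y]; first exact: XE'.
have := UT _ (size_bm_vec y); rewrite bm_vecK => /le_trans; apply.
rewrite mulrAC ler_pdivrMr// -mulrA ler_pM2l// mulrC; exact: lc.
Qed.

Lemma generic_isometric mu nu : sigma_class K mu -> sigma_class K nu ->
  generic K mu -> generic K nu -> isometric (Xcode mu) (Xcode nu).
Proof.
move=> muK nuK mug nug.
have [dX dXD] := dense_sequence (@Xin_dense _ mu).
have [dY dYD] := dense_sequence (@Xin_dense _ nu).
apply: (absorbing_isometric muK nuK (generic_absorbing mug) (generic_absorbing nug)
  dXD dYD) => G T N k KG k0; exact: (generic_universal T N nug KG k0).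
Qed.

Lemma generic_Flim mu : sigma_class K mu -> generic K mu -> is_Flim K (Xcode mu).
Proof.
move=> muK mug; have [dX dXD] := dense_sequence (@Xin_dense _ mu).
split.
  split; first exact: dense_seq_separable dXD.
  exact: absorbing_guarded_fraisse muK (generic_absorbing mug) dXD.
apply: universal_Age_cl muK _ => G T N k KG k0; exact: (generic_universal T N mug KG k0).
Qed.

End generic_spaces.

(** * Amalgamation from a comeager isometry class *)

Section comeager_GAP.
Context {R : realType} (K : set (BM R)) (I : set (codes R)).
Hypotheses (K_hereditary : hereditary K) (K_closed : closed K) (K_JEP : JEP K).
Hypotheses (I_norms : infinite_dimensional K -> @Bnorms R `<=` I)
  (I_all : ~ infinite_dimensional K -> I = setT).

Let S := sigma_class K `&` I.

Section copies.
Variables (X : normedModType R) (dX : nat -> X) (F : nat -> set S).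
Hypotheses (dXD : forall x d N, 0 < d -> exists2 k, (N <= k)%N & `|dX k - x| <= d)
  (F_nd : forall k, nowhere_dense (F k))
  (F_copy : forall y : S, (forall k, ~ F k y) ->
     exists U : {linear {poly R} -> X}, forall x, `|U x| = real_ext (\val y) x).

(** The codes with a copy in X whose first n vectors are close to given points
of a countable dense set; by Baire category one of these countably many pieces
is dense in a ball. *)
Let piece n (e : R) (w : seq nat) : set S :=
  [set y | exists U : {linear {poly R} -> X}, (forall x, `|U x| = real_ext (\val y) x) /\
     forall i, (i < n)%N -> `|U 'X^i - dX (nth 0%N w i)| <= e].

Lemma piece_somewhere_dense (x0 : S) n (e : R) : 0 < e ->
  exists (w : seq nat) (x1 : S) m d,
    [/\ code_close n e (\val x0) (\val x1), 0 < d &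
    forall (y : S) N k, code_close m d (\val x1) (\val y) -> 0 < k ->
      exists z : S, piece n e w z /\ code_close N k (\val y) (\val z)].
Proof.
move=> e0; apply: contrapT => H.
pose ball : set S := [set y | code_close n e (\val x0) (\val y)].
have piece_nd w : nowhere_dense (piece n e w `&` ball).
  rewrite /nowhere_dense -subset0 => x /nbhs_codeSP[m [d [d0 xd]]].
  apply: H; have d20 : 0 < d / 2 by rewrite divr_gt0.
  have xcl : closure (piece n e w `&` ball) x by apply: xd; apply: close_refl; exact: ltW.
  have [x1 [[_ x1b] xx1]] : (piece n e w `&` ball) `&`
      [set y : S | code_close m (d / 2) (\val x) (\val y)] !=set0.
    by apply: xcl; apply/nbhs_codeSP; exists m, (d / 2).
  exists w, x1, m, (d / 2); split => // y N k x1y k0.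
  have ycl : closure (piece n e w `&` ball) y.
    by apply: xd; rewrite (splitr d); exact: close_trans xx1 x1y.
  have [z [[zp _] yz]] : (piece n e w `&` ball) `&`
      [set z : S | code_close N k (\val y) (\val z)] !=set0.
    by apply: ycl; apply/nbhs_codeSP; exists N, k.
  by exists z.
pose J : countType := (nat + seq nat)%type.
pose G (j : nat) : set S := match (unpickle j : option J) with
  | Some (inl k) => F k
  | Some (inr w) => piece n e w `&` ball
  | None => set0 end.
have G_nd j : nowhere_dense (G j).
  rewrite /G; case: unpickle => [[k|w]|]; [exact: F_nd|exact: piece_nd|].
  by rewrite /nowhere_dense closure0 interior0.
have [y [x0y yG]] := S_baire K_hereditary K_closed K_JEP I_norms I_all x0 n G_nd e0.
have [U Uy] : exists U : {linear {poly R} -> X}, forall x, `|U x| = real_ext (\val y) x.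
  by apply: F_copy => k; have := yG (pickle (inl k : J)); rewrite /G pickleK.
have near i : exists k, `|dX k - U 'X^i| <= e.
  by have [k _ ?] := dXD (U 'X^i) 0%N e0; exists k.
have [w wP] := choice near.
have := yG (pickle (inr (mkseq w n) : J)); rewrite /G pickleK; apply; split => //.
exists U; split => // i i_n; rewrite nth_mkseq// distrC.
exact: wP.
Qed.

Hypothesis (X_age : Age X `<=` K).

(** The copies of the two extensions lie in the same space X and almost agree on
E, so the span of their union is an approximate amalgam; W k is the map from the
disjoint sum of the extensions onto it. The limit of its norm along a
subsequence is exact on both extensions. *)
Lemma comeager_GAP : GAP K.
Proof.
move=> E e KE e0; pose n := projT1 E; pose s := bm_vec E.
have [c c0 lc] := l1_fdsp (s : {linear fdsp _ -> _}).
have {lc}lc (y : bmsp E) : l1 (s y) <= c * `|y| by exact: lc.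
have sn y : (size (s y) <= n)%N by exact: size_bm_vec.
have ee : 0 < 1 - expR (- e) by rewrite subr_gt0 -expR0 ltr_expR oppr_lt0.
pose h := Num.min (e / (4 * c)) ((1 - expR (- e)) / (2 * c)).
have h0 : 0 < h by rewrite lt_min !divr_gt0// mulr_gt0.
have hc : 2 * h * c <= e / 2.
  have : h <= e / (4 * c) by rewrite ge_min lexx.
  by rewrite ler_pdivlMr ?mulr_gt0// => ?; lra.
have hc' : 2 * h * c <= 1 - expR (- e).
  have : h <= (1 - expR (- e)) / (2 * c) by rewrite ge_min lexx orbT.
  by rewrite ler_pdivlMr ?mulr_gt0// => ?; lra.
have [nu0 [Snu0 _ nu0T]] := realize K_hereditary K_closed K_JEP I_norms I_all
  (in_class_norm (bm_coord E) KE) h0.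
have [w [x1 [m0 [d [x01 d0 dense_w]]]]] :=
  piece_somewhere_dense (exist _ nu0 (mem_set Snu0)) n h0.
pose m := maxn m0 n.
have {dense_w}dense_w (y : S) N k : code_close m d (\val x1) (\val y) -> 0 < k ->
    exists z : S, piece n h w z /\ code_close N k (\val y) (\val z).
  by move=> x1y; apply: dense_w; apply: close_weak x1y; rewrite ?leq_maxl.
have [F' [J [Q [KF _ QJ pQ]]]] := pn_factor_class K_hereditary
  (code_take_class K_hereditary K_closed m (set_mem (valP x1))).
have nm : (n <= m)%N by exact: leq_maxr.
pose phi : {linear bmsp E -> bmsp F'} := Q \o s.
have [M M0 QM] := norm_bound Q m.
pose r := ln (1 + d / 2 / M).
have dM : 0 < d / 2 / M by rewrite !divr_gt0.
have r0 : 0 < r by rewrite ln_gt0// ltrDl.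
have rM : (expR r - 1) * M = d / 2.
  by rewrite /r lnK ?posrE ?addr_gt0// addrAC subrr add0r divfK// gt_eqF.
exists F', phi, r; split => //.
  apply: Emb_near => [|y]; first exact: ltW.
  apply: (@le_trans _ _ (2 * h * l1 (s y))); last first.
    apply: le_trans (ler_wpM2l _ (lc y)) _; first by rewrite mulr_ge0// ltW.
    by rewrite mulrA ler_wpM2r.
  rewrite /phi /= -pQ ?(leq_trans (sn y))//.
  have := x01 _ (sn y); have := nu0T (s y); rewrite bm_vecK /= => h1 h2.
  rewrite distrC in h2; have -> : real_ext (\val x1) (s y) - `|y| =
    (real_ext (\val x1) (s y) - real_ext nu0 (s y)) + (real_ext nu0 (s y) - `|y|) by ring.
  apply: le_trans (ler_normD _ _) _; lra.
move=> G H psiG psiH KG KH GE HE.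
(* The first m unit vectors are sent through the guard F', the next ones to the
   coordinate basis of A. *)
pose ext (A : BM R) (psi : {linear bmsp F' -> bmsp A}) : {linear {poly R} -> bmsp A} :=
  (psi \o Q \o take_lin m) \+ (bm_coord A \o drop_lin m).
have extshift A psi (y : bmsp A) : ext A psi (shift m (bm_vec A y)) = y.
  rewrite /ext /= /shift take_polyMXn_0 drop_polyMXn_id !linear0 add0r.
  exact: bm_vecK.
have exttake A psi (x : {poly R}) : (size x <= m)%N -> ext A psi x = psi (Q x).
  move=> xm; rewrite /ext /= take_poly_id// drop_poly_eq0//.
  by rewrite -[poly_rV 0]/(bm_coord A 0) linear0 addr0.
have copy A (psi : {linear bmsp F' -> bmsp A}) (k : nat) : K A -> Emb r (bmsp F') (bmsp A) psi ->
    exists U : {linear {poly R} -> X},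
      close_on (m + projT1 A) (2 * k.+1%:R^-1) (fun x => `|U x|) (fun x => `|ext A psi x|) /\
      forall i, (i < n)%N -> `|U 'X^i - dX (nth 0%N w i)| <= h.
  move=> KA psiE; pose t := Num.min k.+1%:R^-1 (d / 2).
  have t0 : 0 < t by rewrite lt_min invr_gt0 ltr0n divr_gt0.
  have [y [Sy _ yT]] := realize K_hereditary K_closed K_JEP I_norms I_all
    (in_class_norm (ext A psi) KA) t0.
  have x1y : code_close m d (\val x1) y.
    move=> x xm; have h1 := yT x; rewrite exttake// in h1.
    have h2 := Emb_dist (Q x) (ltW r0) psiE; rewrite -pQ// in h2.
    have h3 : (expR r - 1) * real_ext (\val x1) x <= d / 2 * l1 x.
      rewrite pQ// -rM -mulrA ler_wpM2l ?QM//.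
      by rewrite subr_ge0 -expR0 ler_expR ltW.
    have h4 : t * l1 x <= d / 2 * l1 x.
      by rewrite ler_wpM2r ?l1_ge0// ge_min lexx orbT.
    rewrite distrC; have -> : real_ext y x - real_ext (\val x1) x =
      (real_ext y x - `|psi (Q x)|) + (`|psi (Q x)| - real_ext (\val x1) x) by ring.
    apply: le_trans (ler_normD _ _) _; lra.
  have k0 : 0 < k.+1%:R^-1 :> R by rewrite invr_gt0.
  have [z [[U [Uz Uw]] yz]] := dense_w (exist _ y (mem_set Sy)) (m + projT1 A)%N _ x1y k0.
  exists U; split => // x xm; rewrite Uz.
  have h1 : `|real_ext (\val z) x - real_ext y x| <= k.+1%:R^-1 * l1 x.
    by rewrite distrC; exact: yz.
  have h2 := yT x.
  have h3 : t * l1 x <= k.+1%:R^-1 * l1 x by rewrite ler_wpM2r ?l1_ge0// ge_min lexx.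
  have -> : real_ext (\val z) x - `|ext A psi x| =
    (real_ext (\val z) x - real_ext y x) + (real_ext y x - `|ext A psi x|) by ring.
  have -> : 2 * k.+1%:R^-1 * l1 x = k.+1%:R^-1 * l1 x + k.+1%:R^-1 * l1 x by ring.
  apply: le_trans (ler_normD _ _) _; apply: lerD => //; exact: le_trans h2 h3.
pose g := projT1 G; pose g' := projT1 H.
have [UG UGP] := choice (fun k => copy G psiG k KG GE).
have [UH UHP] := choice (fun k => copy H psiH k KH HE).
have [MG MG0 extG] := norm_bound (ext G psiG) (m + g)%N.
have [MH MH0 extH] := norm_bound (ext H psiH) (m + g')%N.
have inv0 k : 0 <= k.+1%:R^-1 :> R by rewrite invr_ge0.
have inv1 k : k.+1%:R^-1 <= 1 :> R by rewrite invf_le1// ler1n.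
pose W k : {linear {poly R} -> X} :=
  (UG k \o shift m \o take_lin g) \+ (UH k \o shift m \o take_lin g' \o drop_lin g).
have bound A (U : {linear {poly R} -> X}) (V : {linear {poly R} -> bmsp A}) B j k (x : {poly R}) :
    close_on (m + j) (2 * k.+1%:R^-1) (fun x => `|U x|) (fun x => `|V x|) ->
    (forall x : {poly R}, (size x <= m + j)%N -> `|V x| <= B * l1 x) ->
    0 < B -> (size x <= j)%N -> `|U (shift m x)| <= (B + 2) * l1 x.
  move=> UV VB B0 xj; have zs := size_shift m xj.
  have := UV _ zs; rewrite ler_norml => /andP[_ h1].
  have h2 := VB _ zs; have h3 := l1_shift m x.
  have h4 : 2 * k.+1%:R^-1 * l1 (shift m x) <= 2 * l1 (shift m x).
    by rewrite ler_wpM2r ?l1_ge0// ler_piMr.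
  have h5 : (B + 2) * l1 (shift m x) <= (B + 2) * l1 x.
    by rewrite ler_pM2l// addr_gt0.
  rewrite lerBlDl in h1; apply: le_trans h1 (le_trans _ h5).
  by rewrite [leRHS]mulrDl; exact: (lerD h2 h4).
have W_bound k x : `|W k x| <= (MG + MH + 4) * l1 x.
  have [hG _] := UGP k; have [hH _] := UHP k.
  have b1 := bound _ _ _ _ _ _ _ hG extG MG0 (size_take_poly g x).
  have b2 := bound _ _ _ _ _ _ _ hH extH MH0 (size_take_poly g' (drop_poly g x)).
  have b3 : (MG + 2) * l1 (take_poly g x) <= (MG + 2) * l1 x.
    by rewrite ler_pM2l ?l1_take// addr_gt0.
  have b4 : (MH + 2) * l1 (take_poly g' (drop_poly g x)) <= (MH + 2) * l1 x.
    by rewrite ler_pM2l ?addr_gt0// (le_trans (l1_take _ _))// l1_drop.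
  by apply: le_trans (ler_normD _ _) _ => /=; lra.
have W_X k i : (i < g + g')%N -> norm_pn (W k) 'X^i <= MG + MH + 4.
  by have := W_bound k 'X^i; rewrite l1X mulr1.
have B0 : 0 <= MG + MH + 4 by rewrite !addr_ge0// ltW.
have [L [T [KL WT]]] := in_class_compact K_hereditary K_closed B0 W_X
  (fun k => Age_in_class (W k) _ X_age).
have {}WT t N : 0 < t -> exists2 k, (N <= k)%N &
    close_on (g + g') t (fun x => `|W k x|) (fun x => `|T x|) by exact: WT.
have small t : 0 < t -> exists N, forall k, (N <= k)%N -> k.+1%:R^-1 <= t :> R.
  move=> t0; exists (Num.truncn t^-1) => k Nk; rewrite invf_ple ?posrE//.
  apply/ltW/(lt_le_trans (truncnS_gt _)); by rewrite ler_nat ltnS.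
have T_le (x : {poly R}) a b : (size x <= g + g')%N -> 0 <= b ->
    (forall k, `|W k x| <= a + b * k.+1%:R^-1) -> `|T x| <= a.
  move=> xs b0 Wx; apply: (@le_eps_mul _ _ _ (b + l1 x)).
    by rewrite addr_ge0// l1_ge0.
  move=> t t0; have [N Nt] := small t t0; have [k /Nt kt kW] := WT t N t0.
  have := kW x xs; rewrite ler_norml => /andP[h1 _].
  have := Wx k; have : b * k.+1%:R^-1 <= b * t by rewrite ler_wpM2l.
  set q := b * k.+1%:R^-1; lra.
have T_ge (x : {poly R}) a b : (size x <= g + g')%N -> 0 <= b ->
    (forall k, a - b * k.+1%:R^-1 <= `|W k x|) -> a <= `|T x|.
  move=> xs b0 Wx; apply: (@le_eps_mul _ _ _ (b + l1 x)).
    by rewrite addr_ge0// l1_ge0.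
  move=> t t0; have [N Nt] := small t t0; have [k /Nt kt kW] := WT t N t0.
  have := kW x xs; rewrite ler_norml => /andP[_ h1].
  have := Wx k; have : b * k.+1%:R^-1 <= b * t by rewrite ler_wpM2l.
  set q := b * k.+1%:R^-1; lra.
have WG k y : W k (bm_vec G y) = UG k (shift m (bm_vec G y)).
  rewrite /W /= take_poly_id ?size_bm_vec//.
  by rewrite (drop_poly_eq0 (size_bm_vec y)) take_poly0r !linear0 addr0.
have WH k z : W k (shift g (bm_vec H z)) = UH k (shift m (bm_vec H z)).
  rewrite /W /= /shift take_polyMXn_0 drop_polyMXn_id mul0r linear0 add0r.
  by rewrite take_poly_id// size_bm_vec.
have T_iso (x : {poly R}) a b : (size x <= g + g')%N -> 0 <= b ->
    (forall k, `| `|W k x| - a | <= b * k.+1%:R^-1) -> `|T x| = a.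
  move=> xs b0 Wx; apply/eqP; rewrite eq_le; apply/andP; split.
    by apply: (T_le _ _ b) => // k; have := Wx k; rewrite ler_norml lerBlDl => /andP[].
  apply: (T_ge _ _ b) => // k; have := Wx k; rewrite ler_norml => /andP[+ _].
  set q := b * _; lra.
have copy_norm A psi (U : {linear {poly R} -> X}) k (y : bmsp A) :
    close_on (m + projT1 A) (2 * k.+1%:R^-1) (fun x => `|U x|) (fun x => `|ext A psi x|) ->
    `| `|U (shift m (bm_vec A y))| - `|y| | <= 2 * l1 (bm_vec A y) * k.+1%:R^-1.
  move=> UV; have := UV _ (size_shift m (size_bm_vec y)); rewrite extshift.
  by move/le_trans; apply; rewrite [leRHS]mulrAC ler_wpM2l ?l1_shift.
have sG y : (size (bm_vec G y) <= g + g')%N.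
  by rewrite (leq_trans (size_bm_vec y))// leq_addr.
have sH z : (size (shift g (bm_vec H z)) <= g + g')%N.
  by apply: size_shift; exact: size_bm_vec.
exists L, (T \o bm_vec G), (T \o shift g \o bm_vec H); split => //.
- apply/Emb0P => y; apply: (T_iso (bm_vec G y) _ (2 * l1 (bm_vec G y))) => //.
    by rewrite mulr_ge0// l1_ge0.
  by move=> k; rewrite WG; apply: (copy_norm G psiG); have [] := UGP k.
- apply/Emb0P => z; apply: (T_iso (shift g (bm_vec H z)) _ (2 * l1 (bm_vec H z))) => //.
    by rewrite mulr_ge0// l1_ge0.
  by move=> k; rewrite WH; apply: (copy_norm H psiH); have [] := UHP k.
apply: (@le_lt_trans _ _ (2 * h * c)); last by apply: le_lt_trans hc _; lra.
apply: opnorm_le => [|y]; first by rewrite ltW// !mulr_gt0.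
pose y1 := psiG (phi y); pose y2 := psiH (phi y).
pose x := bm_vec G y1 - shift g (bm_vec H y2).
have -> : (T \o bm_vec G) y1 - (T \o shift g \o bm_vec H) y2 = T x.
  by rewrite /x linearB.
have defect A psi (U : {linear {poly R} -> X}) k :
    close_on (m + projT1 A) (2 * k.+1%:R^-1) (fun x => `|U x|) (fun x => `|ext A psi x|) ->
    `|U (shift m (bm_vec A (psi (phi y))) - s y)| <=
      2 * l1 (shift m (bm_vec A (psi (phi y))) - s y) * k.+1%:R^-1.
  move=> UV; set z := _ - s y.
  have zs : (size z <= m + projT1 A)%N.
    rewrite (leq_trans (size_polyD _ _))// size_polyN geq_max.
    rewrite size_shift ?size_bm_vec//= (leq_trans (sn y))// (leq_trans nm)//.
    exact: leq_addr.
  have z0 : ext A psi z = 0.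
    by rewrite /z linearB extshift exttake ?subrr// (leq_trans (sn y)).
  have := UV z zs; rewrite z0 normr0 subr0 normr_id => /le_trans; apply.
  by rewrite mulrAC.
set zG := shift m (bm_vec G y1) - s y; set zH := shift m (bm_vec H y2) - s y.
apply: (T_le _ _ (2 * l1 zG + 2 * l1 zH)).
- by rewrite (leq_trans (size_polyD _ _))// size_polyN geq_max sG sH.
- by rewrite addr_ge0// mulr_ge0// l1_ge0.
move=> k; have [hG hGw] := UGP k; have [hH hHw] := UHP k.
have e1 : `|UG k zG| <= 2 * l1 zG * k.+1%:R^-1 := defect _ _ _ _ hG.
have e2 : `|UH k zH| <= 2 * l1 zH * k.+1%:R^-1 := defect _ _ _ _ hH.
have e3 : `|UG k (s y) - UH k (s y)| <= 2 * h * c * `|y|.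
  apply: (@le_trans _ _ (2 * h * l1 (s y))).
    apply: (@norm_le_l1 _ _ (UG k \- UH k) n _ _ (sn y)) => i i_n.
    have -> : 2 * h = h + h by ring.
    apply: le_trans (ler_distD (dX (nth 0%N w i)) _ _) _.
    by rewrite lerD ?hGw// distrC hHw.
  by rewrite -[leRHS]mulrA ler_pM2l ?mulr_gt0.
have WE : W k x = UG k zG + (UG k (s y) - UH k (s y)) - UH k zH.
  by rewrite /x (linearB (W k)) WG WH (linearB (UG k)) (linearB (UH k)) opprB !addrA !subrK.
rewrite WE; apply: le_trans (ler_normB _ _) _.
apply: le_trans (lerD (ler_normD _ _) (lexx _)) _.
apply: le_trans (lerD (lerD e1 e3) e2) _.
by rewrite [X in _ <= _ + X]mulrDl [leRHS]addrCA [leRHS]addrA.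
Qed.

End copies.

End comeager_GAP.

(** * The equivalence *)

Section equivalence.
Context {R : realType} (K : set (BM R)) (I : set (codes R)).
Hypotheses (K_nonempty : K !=set0) (K_hereditary : hereditary K)
  (K_closed : closed K) (K_JEP : JEP K).
Hypotheses (I_norms : infinite_dimensional K -> @Bnorms R `<=` I)
  (I_all : ~ infinite_dimensional K -> I = setT).

Let S := sigma_class K `&` I.

Lemma S_nonempty : S !=set0.
Proof.
have [H KH] := K_nonempty; pose Z : {linear {poly R} -> bmsp H} := \0.
have [mu [Smu _ _]] := realize K_hereditary K_closed K_JEP I_norms I_all
  (in_class_norm Z KH) ltr01.
by exists mu.
Qed.

Lemma GAP_comeager : GAP K ->
  exists mu, [/\ S mu, comeager_in S (iso_codes I mu) & is_Flim K (Xcode mu)].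
Proof.
move=> KGAP; have [F [F_nd F_gen]] := generic_comeager K_nonempty K_hereditary
  K_closed K_JEP I_norms I_all KGAP.
have [mu0 Smu0] := S_nonempty.
have [y [_ yF]] := S_baire K_hereditary K_closed K_JEP I_norms I_all
  (exist _ mu0 (mem_set Smu0)) 0 F_nd ltr01.
have [yK yI] : S (\val y) := set_mem (valP y).
have yg := F_gen y yF.
exists (\val y); split => //; last exact: (generic_Flim K_closed yK yg).
exists (fun k => F k `&` ~` (set_val @^-1` iso_codes I (\val y))); split.
  move=> k; rewrite /nowhere_dense -subset0; rewrite -(F_nd k).
  by apply: interiorS; apply: closureS => z [].
apply/seteqP; split => [z zy|z [k _ []]//].
apply: contrapT => nF; apply: (zy); have [zK zI] : S (\val z) := set_mem (valP z).
split => //; apply: (generic_isometric zK yK _ yg).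
by apply: F_gen => k Fz; apply: nF; exists k.
Qed.

Lemma comeager_in_GAP mu : S mu -> comeager_in S (iso_codes I mu) -> GAP K.
Proof.
move=> [muK _] [F [F_nd FE]].
have [dX dXD] := dense_sequence (@Xin_dense _ mu).
apply: (comeager_GAP K_hereditary K_closed K_JEP I_norms I_all dXD F_nd _ muK) => y yF.
have [_ [T [TN _]]] : iso_codes I mu (\val y).
  apply: contrapT => niso; have : (~` (set_val @^-1` iso_codes I mu)) y by [].
  by rewrite FE => -[k _]; exact: yF.
by exists (T \o Xin (\val y)) => x; rewrite -Xin_norm -TN.
Qed.

End equivalence.

Theorem theorem3p11 (R : realType) (K : set (BM R)) (I : set (codes R))
  (K_nonempty : K !=set0) (K_closed : closed K)
  (K_hereditary : hereditary K) (K_JEP : JEP K)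
  (I_infdim : infinite_dimensional K -> I = setT \/ I = Pinf \/ I = Bnorms)
  (I_fdim : ~ infinite_dimensional K -> I = setT) :
  (guarded_fraisse_class K <->
   exists mu, (sigma_class K `&` I) mu /\
     comeager_in (sigma_class K `&` I) (iso_codes I mu)) /\
  (guarded_fraisse_class K ->
   exists mu, [/\ (sigma_class K `&` I) mu,
     comeager_in (sigma_class K `&` I) (iso_codes I mu) &
     is_Flim K (Xcode mu)]).
Proof.
have I_norms : infinite_dimensional K -> @Bnorms R `<=` I.
  by move=> /I_infdim[->//|[->|->//]] mu [].
have GAPP : guarded_fraisse_class K -> GAP K by case.
split; last by move=> /GAPP; exact: GAP_comeager.
split=> [/GAPP KGAP|[mu [Smu muC]]].
  have [mu [Smu muC _]] := GAP_comeager K_nonempty K_hereditary K_closed K_JEP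
    I_norms I_fdim KGAP.
  by exists mu.
by split => //; exact: comeager_in_GAP Smu muC.
Qed.
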